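(* For each true $\Pi^0_1$ sentence $\pi$ there exists an automatic binary relation $R_\pi$ (i.e. a structure $(A,R_\pi)$ with an automatic presentation) which is well-founded and such that $\mathsf{PRA}+\mathrm{TI}(R_\pi;\Delta_0)\vdash\pi$.
   Context: A relational structure is automatic if it has an isomorphic copy whose universe is a regular set of words over a finite alphabet and whose relations are recognized by synchronous multi-tape finite automata. A binary relation $R$ on $A$ is well-founded if every nonempty subset of $A$ has an $R$-minimal element. $\mathsf{PRA}$ is primitive recursive arithmetic; $\Delta_0$ is the class of bounded arithmetical formulas; for an arithmetically definable binary relation $R$, $\mathrm{TI}(R;\Delta_0)$ is the schema $\forall x(\forall y\,(yRx\to\phi(y))\to\phi(x))\to\forall x\,\phi(x)$ for $\phi\in\Delta_0$ (with the automatic relation $R_\pi$ naturally arithmetized). *)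

(* Defs.v *)
From Stdlib Require Import List Arith.
Import ListNotations.

Inductive PRF : nat -> Type :=
| PZ (n : nat) : PRF n
| PS : PRF 1
| PP (n i : nat) : Nat.ltb i n = true -> PRF n
| PC (n m : nat) : PRF m -> PRFs n m -> PRF n
| PR (n : nat) : PRF n -> PRF (S (S n)) -> PRF (S n)
with PRFs : nat -> nat -> Type :=
| PNil (n : nat) : PRFs n 0
| PCons (n m : nat) : PRF n -> PRFs n m -> PRFs n (S m).
Arguments PCons {n m} _ _.

Fixpoint eval {n : nat} (f : PRF n) (xs : list nat) {struct f} : nat :=
  match f with
  | PZ _ => 0
  | PS => S (hd 0 xs)
  | PP _ i _ => nth i xs 0
  | PC _ _ g hs => eval g (evals hs xs)
  | PR _ g h =>
      (fix go (y : nat) : nat :=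
         match y with
         | O => eval g (tl xs)
         | S y' => eval h (y' :: go y' :: tl xs)
         end) (hd 0 xs)
  end
with evals {n m : nat} (hs : PRFs n m) (xs : list nat) {struct hs} : list nat :=
  match hs with
  | PNil _ => []
  | PCons h hs' => eval h xs :: evals hs' xs
  end.

Inductive term : Type :=
| Var : nat -> term
| App : forall n : nat, PRF n -> terms n -> term
with terms : nat -> Type :=
| TNil : terms 0
| TCons : forall n : nat, term -> terms n -> terms (S n).
Arguments App {n} _ _.
Arguments TCons {n} _ _.

Inductive form : Type :=
| FEq : term -> term -> form
| FBot : form
| FImp : form -> form -> form
| FAnd : form -> form -> form
| FOr : form -> form -> form
| FAll : form -> form
| FEx : form -> form.

Definition FNot (a : form) : form := FImp a FBot.

Definition scons {A : Type} (x : A) (f : nat -> A) : nat -> A :=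
  fun i => match i with O => x | S j => f j end.

Fixpoint teval (rho : nat -> nat) (t : term) {struct t} : nat :=
  match t with
  | Var i => rho i
  | App f ts => eval f (tseval rho ts)
  end
with tseval (rho : nat -> nat) {n : nat} (ts : terms n) {struct ts} : list nat :=
  match ts with
  | TNil => []
  | TCons t ts' => teval rho t :: tseval rho ts'
  end.

Fixpoint sat (rho : nat -> nat) (a : form) : Prop :=
  match a with
  | FEq s t => teval rho s = teval rho t
  | FBot => False
  | FImp a b => sat rho a -> sat rho b
  | FAnd a b => sat rho a /\ sat rho b
  | FOr a b => sat rho a \/ sat rho b
  | FAll a => forall d : nat, sat (scons d rho) a
  | FEx a => exists d : nat, sat (scons d rho) a
  end.

Fixpoint trename (xi : nat -> nat) (t : term) {struct t} : term :=
  match t with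
  | Var i => Var (xi i)
  | App f ts => App f (tsrename xi ts)
  end
with tsrename (xi : nat -> nat) {n : nat} (ts : terms n) {struct ts} : terms n :=
  match ts with
  | TNil => TNil
  | TCons t ts' => TCons (trename xi t) (tsrename xi ts')
  end.

Fixpoint tsubst (sg : nat -> term) (t : term) {struct t} : term :=
  match t with
  | Var i => sg i
  | App f ts => App f (tssubst sg ts)
  end
with tssubst (sg : nat -> term) {n : nat} (ts : terms n) {struct ts} : terms n :=
  match ts with
  | TNil => TNil
  | TCons t ts' => TCons (tsubst sg t) (tssubst sg ts')
  end.

Definition upren (xi : nat -> nat) : nat -> nat :=
  fun i => match i with O => O | S j => S (xi j) end.
Definition upsub (sg : nat -> term) : nat -> term :=
  fun i => match i with O => Var O | S j => trename S (sg j) end.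

Fixpoint frename (xi : nat -> nat) (a : form) : form :=
  match a with
  | FEq s t => FEq (trename xi s) (trename xi t)
  | FBot => FBot
  | FImp a b => FImp (frename xi a) (frename xi b)
  | FAnd a b => FAnd (frename xi a) (frename xi b)
  | FOr a b => FOr (frename xi a) (frename xi b)
  | FAll a => FAll (frename (upren xi) a)
  | FEx a => FEx (frename (upren xi) a)
  end.

Fixpoint fsubst (sg : nat -> term) (a : form) : form :=
  match a with
  | FEq s t => FEq (tsubst sg s) (tsubst sg t)
  | FBot => FBot
  | FImp a b => FImp (fsubst sg a) (fsubst sg b)
  | FAnd a b => FAnd (fsubst sg a) (fsubst sg b)
  | FOr a b => FOr (fsubst sg a) (fsubst sg b)
  | FAll a => FAll (fsubst (upsub sg) a)
  | FEx a => FEx (fsubst (upsub sg) a)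
  end.

Definition shiftT (t : term) : term := trename S t.
Definition shiftF (a : form) : form := frename S a.
Definition subst0 (t : term) (a : form) : form := fsubst (scons t Var) a.

Fixpoint tfv (k : nat) (t : term) {struct t} : Prop :=
  match t with
  | Var i => i < k
  | App f ts => tsfv k ts
  end
with tsfv (k : nat) {n : nat} (ts : terms n) {struct ts} : Prop :=
  match ts with
  | TNil => True
  | TCons t ts' => tfv k t /\ tsfv k ts'
  end.

Fixpoint ffv (k : nat) (a : form) : Prop :=
  match a with
  | FEq s t => tfv k s /\ tfv k t
  | FBot => True
  | FImp a b | FAnd a b | FOr a b => ffv k a /\ ffv k b
  | FAll a | FEx a => ffv (S k) a
  end.

Fixpoint nAll (n : nat) (a : form) : form :=
  match n with O => a | S m => FAll (nAll m a) end.

Definition zeroT : term := App (PZ 0) TNil.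
Definition succT (t : term) : term := App PS (TCons t TNil).
Definition oneT : term := succT zeroT.
Definition App2 (f : PRF 2) (s t : term) : term := App f (TCons s (TCons t TNil)).

Definition proj (n i : nat) : PRF n :=
  match Nat.ltb i n as b return Nat.ltb i n = b -> PRF n with
  | true => fun H => PP n i H
  | false => fun _ => PZ n
  end eq_refl.
Definition c1 {n : nat} (f : PRF 1) (g : PRF n) : PRF n := PC n 1 f (PCons g (PNil n)).
Definition c2 {n : nat} (f : PRF 2) (g h : PRF n) : PRF n :=
  PC n 2 f (PCons g (PCons h (PNil n))).
Definition c3 {n : nat} (f : PRF 3) (g h l : PRF n) : PRF n :=
  PC n 3 f (PCons g (PCons h (PCons l (PNil n)))).
Fixpoint constP (n c : nat) : PRF n :=
  match c with O => PZ n | S c' => c1 PS (constP n c') end.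

Definition predP : PRF 1 := PR 0 (PZ 0) (proj 2 0).
Definition rsubP : PRF 2 := PR 1 (proj 1 0) (c1 predP (proj 3 1)).
Definition subP : PRF 2 := c2 rsubP (proj 2 1) (proj 2 0).
Definition addP : PRF 2 := PR 1 (proj 1 0) (c1 PS (proj 3 1)).
Definition mulP : PRF 2 := PR 1 (PZ 1) (c2 addP (proj 3 1) (proj 3 2)).
Definition nsgP : PRF 1 := c2 subP (constP 1 1) (proj 1 0).
Definition sgP : PRF 1 := c1 nsgP nsgP.
Definition eqcP : PRF 2 :=
  c1 nsgP (c2 addP (c2 subP (proj 2 0) (proj 2 1)) (c2 subP (proj 2 1) (proj 2 0))).

Definition Lt (s t : term) : form := FEq (App2 subP (succT s) t) zeroT.

Inductive QF : form -> Prop :=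
| qf_eq s t : QF (FEq s t)
| qf_bot : QF FBot
| qf_imp a b : QF a -> QF b -> QF (FImp a b)
| qf_and a b : QF a -> QF b -> QF (FAnd a b)
| qf_or a b : QF a -> QF b -> QF (FOr a b).

Inductive Delta0 : form -> Prop :=
| d0_eq s t : Delta0 (FEq s t)
| d0_bot : Delta0 FBot
| d0_imp a b : Delta0 a -> Delta0 b -> Delta0 (FImp a b)
| d0_and a b : Delta0 a -> Delta0 b -> Delta0 (FAnd a b)
| d0_or a b : Delta0 a -> Delta0 b -> Delta0 (FOr a b)
| d0_ball t a : Delta0 a -> Delta0 (FAll (FImp (Lt (Var 0) (shiftT t)) a))
| d0_bex t a : Delta0 a -> Delta0 (FEx (FAnd (Lt (Var 0) (shiftT t)) a)).

Definition Pi01 (a : form) : Prop :=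
  exists n th, a = nAll n th /\ Delta0 th /\ ffv n th.

Inductive Prov : list form -> form -> Prop :=
| P_ax G a : In a G -> Prov G a
| P_raa G a : Prov (FNot a :: G) FBot -> Prov G a
| P_impI G a b : Prov (a :: G) b -> Prov G (FImp a b)
| P_impE G a b : Prov G (FImp a b) -> Prov G a -> Prov G b
| P_andI G a b : Prov G a -> Prov G b -> Prov G (FAnd a b)
| P_andE1 G a b : Prov G (FAnd a b) -> Prov G a
| P_andE2 G a b : Prov G (FAnd a b) -> Prov G b
| P_orI1 G a b : Prov G a -> Prov G (FOr a b)
| P_orI2 G a b : Prov G b -> Prov G (FOr a b)
| P_orE G a b c : Prov G (FOr a b) -> Prov (a :: G) c -> Prov (b :: G) c -> Prov G c
| P_allI G a : Prov (map shiftF G) a -> Prov G (FAll a)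
| P_allE G a t : Prov G (FAll a) -> Prov G (subst0 t a)
| P_exI G a t : Prov G (subst0 t a) -> Prov G (FEx a)
| P_exE G a c : Prov G (FEx a) -> Prov (a :: map shiftF G) (shiftF c) -> Prov G c
| P_refl G t : Prov G (FEq t t)
| P_eqE G a s t : Prov G (FEq s t) -> Prov G (subst0 s a) -> Prov G (subst0 t a).

Definition Provable (T : form -> Prop) (a : form) : Prop :=
  exists G : list form, (forall b, In b G -> T b) /\ Prov G a.

Fixpoint varsT (k n : nat) : terms n :=
  match n as n0 return terms n0 with
  | O => TNil
  | S n' => TCons (Var k) (varsT (S k) n')
  end.

Fixpoint appsT {n m : nat} (hs : PRFs n m) : terms n -> terms m :=
  match hs in PRFs n0 m0 return terms n0 -> terms m0 with
  | PNil _ => fun _ => TNil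
  | PCons h hs' => fun ts => TCons (App h ts) (appsT hs' ts)
  end.

Definition sucsub : nat -> term := scons (succT (Var 0)) (fun j => Var (S j)).

Inductive PRAax : form -> Prop :=
| ax_S1 : PRAax (FAll (FNot (FEq (succT (Var 0)) zeroT)))
| ax_S2 : PRAax (FAll (FAll (FImp (FEq (succT (Var 1)) (succT (Var 0))) (FEq (Var 1) (Var 0)))))
| ax_Z n : PRAax (nAll n (FEq (App (PZ n) (varsT 0 n)) zeroT))
| ax_P n i H : PRAax (nAll n (FEq (App (PP n i H) (varsT 0 n)) (Var i)))
| ax_C n m g hs :
    PRAax (nAll n (FEq (App (PC n m g hs) (varsT 0 n)) (App g (appsT hs (varsT 0 n)))))
| ax_R0 n g h :
    PRAax (nAll n (FEq (App (PR n g h) (TCons zeroT (varsT 0 n))) (App g (varsT 0 n))))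
| ax_RS n g h :
    PRAax (nAll (S n)
      (FEq (App (PR n g h) (TCons (succT (Var 0)) (varsT 1 n)))
           (App h (TCons (Var 0) (TCons (App (PR n g h) (TCons (Var 0) (varsT 1 n))) (varsT 1 n))))))
| ax_Ind n a : QF a -> ffv (S n) a ->
    PRAax (nAll n (FImp (FAnd (subst0 zeroT a) (FAll (FImp a (fsubst sucsub a)))) (FAll a))).

Definition upS : nat -> nat := fun i => match i with O => O | S j => S (S j) end.

Inductive TIax (Rf : term -> term -> form) : form -> Prop :=
| ax_TI n a : Delta0 a -> ffv (S n) a ->
    TIax Rf (nAll n (FImp (FAll (FImp (FAll (FImp (Rf (Var 0) (Var 1)) (frename upS a))) a))
                          (FAll a))).

(* Alphabet {0,...,k-1}; padding symbol k.  A is recognized by a DFA with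
   states {0..NA-1}; R by a synchronous 2-tape DFA with states {0..NR-1}
   reading the padded convolution. *)
Record AutPres : Type := {
  alph : nat;
  NA : nat; qA0 : nat; dA : nat -> nat -> nat; fA : nat -> bool;
  NR : nat; qR0 : nat; dR : nat -> nat -> nat -> nat; fR : nat -> bool }.

Definition valid (P : AutPres) : Prop :=
  1 <= alph P /\
  qA0 P < NA P /\ (forall q a, q < NA P -> a < alph P -> dA P q a < NA P) /\
  qR0 P < NR P /\
  (forall q a b, q < NR P -> a <= alph P -> b <= alph P -> dR P q a b < NR P).

Definition inA (P : AutPres) (w : list nat) : Prop :=
  Forall (fun a => a < alph P) w /\
  fA P (fold_left (dA P) w (qA0 P)) = true.

Definition pad (k n : nat) (w : list nat) : list nat := w ++ repeat k (n - length w).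
Definition conv (k : nat) (u v : list nat) : list (nat * nat) :=
  let n := Nat.max (length u) (length v) in combine (pad k n u) (pad k n v).

Definition relR (P : AutPres) (u v : list nat) : Prop :=
  inA P u /\ inA P v /\
  fR P (fold_left (fun q p => dR P q (fst p) (snd p)) (conv (alph P) u v) (qR0 P)) = true.

Definition wf_pres (P : AutPres) : Prop :=
  forall S : list nat -> Prop,
    (forall w, S w -> inA P w) -> (exists w, S w) ->
    exists m, S m /\ forall w, S w -> ~ relR P w m.

(* Natural arithmetization: a word a_0 ... a_{n-1} over {0..k-1} is coded
   by sum (a_i + 1) k^i (bijective base-k numeration); a primitive
   recursive code simulates the automata on the codes.                  *)
Definition iteP {n : nat} (c a b : PRF n) : PRF n :=
  c2 addP (c2 mulP (c1 sgP c) a) (c2 mulP (c1 nsgP c) b).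

Definition modkP (k : nat) : PRF 1 :=
  PR 0 (PZ 0) (c2 mulP (c1 nsgP (c2 eqcP (c1 PS (proj 2 1)) (constP 2 k))) (c1 PS (proj 2 1))).
Definition divkP (k : nat) : PRF 1 :=
  PR 0 (PZ 0) (c2 addP (proj 2 1) (c2 eqcP (c1 PS (c1 (modkP k) (proj 2 0))) (constP 2 k))).
Definition digP (k : nat) : PRF 1 := c1 (modkP k) predP.    (* first letter *)
Definition restP (k : nat) : PRF 1 := c1 (divkP k) predP.   (* code of the tail *)
Definition tailP (k : nat) : PRF 2 :=
  PR 1 (proj 1 0) (c1 (restP k) (proj 3 1)).

Definition sumP {n : nat} (l : list (PRF n)) : PRF n :=
  fold_right (fun g acc => c2 addP g acc) (PZ n) l.
Definition tab1 (N : nat) (f : nat -> nat) : PRF 1 :=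
  sumP (map (fun q => c2 mulP (c2 eqcP (proj 1 0) (constP 1 q)) (constP 1 (f q))) (seq 0 N)).
Definition tab2 (N A : nat) (f : nat -> nat -> nat) : PRF 2 :=
  sumP (flat_map (fun q => map (fun a =>
      c2 mulP (c2 mulP (c2 eqcP (proj 2 0) (constP 2 q)) (c2 eqcP (proj 2 1) (constP 2 a)))
              (constP 2 (f q a))) (seq 0 A)) (seq 0 N)).
Definition tab3 (N A : nat) (f : nat -> nat -> nat -> nat) : PRF 3 :=
  sumP (flat_map (fun q => flat_map (fun a => map (fun b =>
      c2 mulP (c2 mulP (c2 eqcP (proj 3 0) (constP 3 q))
                       (c2 mulP (c2 eqcP (proj 3 1) (constP 3 a)) (c2 eqcP (proj 3 2) (constP 3 b))))
              (constP 3 (f q a b))) (seq 0 A)) (seq 0 A)) (seq 0 N)).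

Definition b2n (b : bool) : nat := if b then 1 else 0.

Section Arith.
Variable P : AutPres.
Let k := alph P.

Definition run1P : PRF 2 :=
  let tH := c2 (tailP k) (proj 3 0) (proj 3 2) in
  PR 1 (constP 1 (qA0 P))
       (iteP tH (c2 (tab2 (NA P) k (dA P)) (proj 3 1) (c1 (digP k) tH)) (proj 3 1)).
Definition acc1P : PRF 1 :=
  c1 (tab1 (NA P) (fun q => b2n (fA P q))) (c2 run1P (proj 1 0) (proj 1 0)).

Definition run2P : PRF 3 :=
  let t1 := c2 (tailP k) (proj 4 0) (proj 4 2) in
  let t2 := c2 (tailP k) (proj 4 0) (proj 4 3) in
  let letter (t : PRF 4) := iteP t (c1 (digP k) t) (constP 4 k) in
  PR 2 (constP 2 (qR0 P))
       (iteP (c2 addP t1 t2)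
             (c3 (tab3 (NR P) (S k) (dR P)) (proj 4 1) (letter t1) (letter t2))
             (proj 4 1)).
Definition acc2P : PRF 2 :=
  c1 (tab1 (NR P) (fun q => b2n (fR P q)))
     (c3 run2P (c2 addP (proj 2 0) (proj 2 1)) (proj 2 0) (proj 2 1)).

Definition relcodeP : PRF 2 :=
  c2 mulP (c2 mulP (c1 acc1P (proj 2 0)) (c1 acc1P (proj 2 1))) acc2P.
End Arith.

Definition Rform (P : AutPres) (s t : term) : form := FEq (App2 (relcodeP P) s t) oneT.

Definition PRA_TI (P : AutPres) : form -> Prop :=
  fun a => PRAax a \/ TIax (Rform P) a.

(* Main.v *)
(* A true Pi01 sentence is, provably in PRA, of the form "f(x) = 0 for all x" with f primitive
   recursive.  Compile f into a LOOP program and add a move that, once the output is nonzero,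
   jumps back to the start state with an arbitrary input.  Let u R v say that u is a next
   configuration of v.  A LOOP program halts from every configuration, honest or not, and an
   honest run never reaches the jump when the sentence is true, so R is well-founded.
   Conversely, a value f(x) <> 0 yields a nonempty definable set of configurations (those
   satisfying the Floyd-Hoare assertions of the program) without R-minimal element, against TI.

   R is automatic because a configuration (s, a_1, ..., a_m) is the word whose first letter is
   the state s and whose rest is the number W with W + 1 = b_1^a_1 ... b_m^a_m: every
   instruction is then a linear relation between W and W'.  The zero test is linear too: with
   b_i = 0 and b_j = 1 (j <> i) modulo M_i, the register a_i is zero iff M_i divides W.

   Provability comes from completeness of the calculus: one argues in an arbitrary model of
   PRA + TI.  The same Hoare logic, read in the standard model, describes the honest runs. *)
From Stdlib Require Import List Arith Lia Ring Classical ClassicalEpsilon.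
From Stdlib Require Import FunctionalExtensionality PropExtensionality ProofIrrelevance.
From Stdlib Require Import Eqdep Cantor.
Require Import Defs.
Import ListNotations.

Local Arguments Nat.max : simpl never.

(** * Substitution and provability *)

(* Well-foundedness must hold on all numbers W, most of which code no registers, and the automaton
   does not sort them out. The decrease of a loop is therefore measured without decoding: entering
   the body of a loop on register i divides W + 1 by [b i], a multiple of M_i, while the body, up to
   tests that restore W, multiplies or divides W + 1 by numbers congruent to 1 modulo M_i. So the
   exponent of M_i in W + 1 falls in each round. A run from a dishonest configuration resets at most
   once, since a reset yields an honest start. The reset is regular because words are read in base k
   = [b 0]: in bijective numeration the numbers k^x - 1 are the words over the single letter k - 2.
   All other moves are relations V = pU + e, for which the automaton has to remember p and a carry.
   In a nonstandard model a run may have nonstandard length, and induction is quantifier-free. So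
   runs are never coded: assertions carve out sets in which every configuration has a successor, and
   a run trapped inside violates TI as well as the intended cycle does. The assertions are Delta0
   because no register exceeds W. *)
Scheme term_mut := Induction for term Sort Prop
  with terms_mut := Induction for terms Sort Prop.
Combined Scheme term_terms_ind from term_mut, terms_mut.

Scheme PRF_mut := Induction for PRF Sort Prop
  with PRFs_mut := Induction for PRFs Sort Prop.
Combined Scheme PRF_PRFs_ind from PRF_mut, PRFs_mut.

Lemma trename_tsubst xi :
  (forall t, trename xi t = tsubst (fun i => Var (xi i)) t) /\
  (forall n (ts : terms n), tsrename xi ts = tssubst (fun i => Var (xi i)) ts).
Proof. apply term_terms_ind; simpl; intros; congruence. Qed.

Lemma tsubst_tsubst s1 s2 :
  (forall t, tsubst s2 (tsubst s1 t) = tsubst (fun i => tsubst s2 (s1 i)) t) /\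
  (forall n (ts : terms n), tssubst s2 (tssubst s1 ts) = tssubst (fun i => tsubst s2 (s1 i)) ts).
Proof. apply term_terms_ind; simpl; intros; congruence. Qed.

Lemma tsubst_Var :
  (forall t, tsubst Var t = t) /\ (forall n (ts : terms n), tssubst Var ts = ts).
Proof. apply term_terms_ind; simpl; intros; congruence. Qed.

Lemma upsub_Var xi : upsub (fun i => Var (xi i)) = fun i => Var (upren xi i).
Proof. extensionality i; destruct i; reflexivity. Qed.

Lemma upsub_comp s1 s2 :
  (fun i => tsubst (upsub s2) (upsub s1 i)) = upsub (fun i => tsubst s2 (s1 i)).
Proof.
  extensionality i; destruct i as [|i]; simpl; [reflexivity|].
  rewrite !(proj1 (trename_tsubst S)), !(proj1 (tsubst_tsubst _ _)).
  f_equal; extensionality j; simpl.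
  now rewrite (proj1 (trename_tsubst S)).
Qed.

Lemma frename_fsubst a : forall xi, frename xi a = fsubst (fun i => Var (xi i)) a.
Proof.
  induction a; intros xi; simpl; rewrite ?(proj1 (trename_tsubst xi)), ?upsub_Var; f_equal; auto.
Qed.

Lemma fsubst_fsubst a : forall s1 s2,
  fsubst s2 (fsubst s1 a) = fsubst (fun i => tsubst s2 (s1 i)) a.
Proof.
  induction a; intros s1 s2; simpl; rewrite ?(proj1 (tsubst_tsubst s1 s2)), <- ?upsub_comp; f_equal; auto.
Qed.

Lemma upsub_id : upsub Var = Var.
Proof. extensionality i; destruct i; reflexivity. Qed.

Lemma fsubst_Var a : fsubst Var a = a.
Proof. induction a; simpl; rewrite ?(proj1 tsubst_Var), ?upsub_id; f_equal; auto. Qed.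

Lemma shiftF_fsubst a : shiftF a = fsubst (fun i => Var (S i)) a.
Proof. apply frename_fsubst. Qed.

Lemma fsubst_shiftF s a : fsubst (upsub s) (shiftF a) = shiftF (fsubst s a).
Proof.
  rewrite !shiftF_fsubst, !fsubst_fsubst; f_equal; extensionality i; simpl.
  now rewrite (proj1 (trename_tsubst S)).
Qed.

Lemma fsubst_subst0 s t a :
  fsubst s (subst0 t a) = subst0 (tsubst s t) (fsubst (upsub s) a).
Proof.
  unfold subst0; rewrite !fsubst_fsubst; f_equal; extensionality i; destruct i as [|i]; simpl; auto.
  rewrite (proj1 (trename_tsubst S)), (proj1 (tsubst_tsubst _ _)); simpl.
  symmetry; apply (proj1 tsubst_Var).
Qed.

Lemma tsubst_ffv k s1 s2 : (forall i, i < k -> s1 i = s2 i) ->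
  (forall t, tfv k t -> tsubst s1 t = tsubst s2 t) /\
  (forall n (ts : terms n), tsfv k ts -> tssubst s1 ts = tssubst s2 ts).
Proof.
  intros H; apply term_terms_ind; simpl; intros; auto.
  - f_equal; auto.
  - destruct H2; f_equal; auto.
Qed.

Lemma fsubst_ffv a : forall k s1 s2, (forall i, i < k -> s1 i = s2 i) ->
  ffv k a -> fsubst s1 a = fsubst s2 a.
Proof.
  assert (U : forall k (s1 s2 : nat -> term), (forall i, i < k -> s1 i = s2 i) ->
              forall i, i < S k -> upsub s1 i = upsub s2 i).
  { intros k s1 s2 H [|i] Hi; simpl; auto. rewrite H; auto; lia. }
  induction a; simpl; intros k s1 s2 H F; auto;
    try (destruct F; f_equal; eauto; fail).
  - destruct F; f_equal; apply (proj1 (tsubst_ffv k s1 s2 H)); auto.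
  - f_equal; eauto.
  - f_equal; eauto.
Qed.

Lemma tfv_mono k k' : k <= k' ->
  (forall t, tfv k t -> tfv k' t) /\ (forall n (ts : terms n), tsfv k ts -> tsfv k' ts).
Proof. intros H; apply term_terms_ind; simpl; intros; intuition lia. Qed.

Lemma ffv_mono a : forall k k', k <= k' -> ffv k a -> ffv k' a.
Proof.
  induction a; simpl; intros k k' H F; pose proof (proj1 (tfv_mono _ _ H)) as Ht; auto;
    try (destruct F; split; eauto; fail).
  - eapply IHa; [|eassumption]; lia.
  - eapply IHa; [|eassumption]; lia.
Qed.

Lemma tfv_exists : (forall t, exists k, tfv k t) /\ (forall n (ts : terms n), exists k, tsfv k ts).
Proof.
  apply term_terms_ind; simpl.
  - intros n; exists (S n); lia.
  - auto.
  - exists 0; auto.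
  - intros n t [k Hk] ts [k' Hk']; exists (max k k'); split.
    + apply (proj1 (tfv_mono k (max k k') ltac:(lia))); auto.
    + apply (proj2 (tfv_mono k' (max k k') ltac:(lia))); auto.
Qed.

Lemma ffv_exists a : exists k, ffv k a.
Proof.
  induction a as [s t| |a [k Ha] b [k' Hb]|a [k Ha] b [k' Hb]|a [k Ha] b [k' Hb]|a [k Ha]|a [k Ha]]; simpl.
  2: now exists 0.
  1: destruct (proj1 tfv_exists s) as [k Hk], (proj1 tfv_exists t) as [k' Hk']; exists (max k k'); split;
     [apply (proj1 (tfv_mono k (max k k') ltac:(lia))) | apply (proj1 (tfv_mono k' (max k k') ltac:(lia)))]; auto.
  1-3: exists (max k k'); split; [apply (ffv_mono _ k)|apply (ffv_mono _ k')]; auto; lia.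
  1-2: exists k; apply (ffv_mono _ k); auto; lia.
Qed.

Lemma Prov_weaken G a : Prov G a -> forall G', incl G G' -> Prov G' a.
Proof.
  assert (C : forall (x : form) G G', incl G G' -> incl (x :: G) (x :: G')).
  { intros x G1 G2 H y [|]; simpl; auto. }
  induction 1; intros G' HG.
  - apply P_ax; auto.
  - apply P_raa; auto.
  - apply P_impI; auto.
  - eapply P_impE; eauto.
  - apply P_andI; auto.
  - eapply P_andE1; eauto.
  - eapply P_andE2; eauto.
  - apply P_orI1; auto.
  - apply P_orI2; auto.
  - eapply P_orE; eauto.
  - apply P_allI, IHProv, incl_map; auto.
  - apply P_allE; auto.
  - eapply P_exI; eauto.
  - eapply P_exE; eauto. apply IHProv2, C, incl_map; auto.
  - apply P_refl.
  - eapply P_eqE; eauto.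
Qed.

Lemma Prov_subst G a : Prov G a -> forall s, Prov (map (fsubst s) G) (fsubst s a).
Proof.
  assert (M : forall s G, map (fsubst (upsub s)) (map shiftF G) = map shiftF (map (fsubst s) G)).
  { intros s G'; rewrite !map_map; apply map_ext; intros b; apply fsubst_shiftF. }
  induction 1; intros s0; simpl in *.
  - apply P_ax, in_map; auto.
  - apply P_raa; apply IHProv.
  - apply P_impI; auto.
  - eapply P_impE; eauto.
  - apply P_andI; auto.
  - eapply P_andE1; eauto.
  - eapply P_andE2; eauto.
  - apply P_orI1; auto.
  - apply P_orI2; auto.
  - eapply P_orE; eauto.
  - apply P_allI. rewrite <- M; auto.
  - rewrite fsubst_subst0; apply P_allE; auto.
  - eapply P_exI. rewrite <- fsubst_subst0; eauto.
  - eapply P_exE; eauto. rewrite <- M, <- fsubst_shiftF; auto.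
  - apply P_refl.
  - rewrite fsubst_subst0. eapply P_eqE; [apply IHProv1|].
    rewrite <- fsubst_subst0; auto.
Qed.

(** * Injective coding of the syntax by natural numbers *)

Definition cpair (x y : nat) : nat := to_nat (x, y).

Lemma cpair_inj x y x' y' : cpair x y = cpair x' y' -> x = x' /\ y = y'.
Proof.
  unfold cpair; intros H. apply (f_equal of_nat) in H.
  rewrite !cancel_of_to in H; inversion H; auto.
Qed.

Fixpoint codePRF {n} (f : PRF n) : nat :=
  match f with
  | PZ n => cpair 0 n
  | PS => cpair 1 0
  | PP n i _ => cpair 2 (cpair n i)
  | PC n m g hs => cpair 3 (cpair (codePRF g) (codePRFs hs))
  | PR n g h => cpair 4 (cpair (codePRF g) (codePRF h))
  end
with codePRFs {n m} (hs : PRFs n m) : nat :=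
  match hs with
  | PNil n => cpair 0 n
  | PCons h hs => cpair 1 (cpair (codePRF h) (codePRFs hs))
  end.

Ltac unpair :=
  repeat match goal with
  | H : cpair _ _ = cpair _ _ |- _ => apply cpair_inj in H; destruct H
  end.

(** The code determines the arities too, so injectivity is stated for dependent pairs, and
    [inj_pair2] strips the indices afterwards. The proof field of [PP] is not coded; two such fields
    agree by proof irrelevance. *)
Lemma codePRF_inj :
  (forall n (f : PRF n) n' (f' : PRF n'), codePRF f = codePRF f' -> existT PRF n f = existT PRF n' f') /\
  (forall n m (h : PRFs n m) n' m' (h' : PRFs n' m'), codePRFs h = codePRFs h' ->
     existT (fun p => PRFs (fst p) (snd p)) (n, m) h = existT (fun p => PRFs (fst p) (snd p)) (n', m') h').
Proof.
  apply PRF_PRFs_ind.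
  - intros n n' [] E; simpl in E; unpair; try discriminate; now subst.
  - intros n' [] E; simpl in E; unpair; try discriminate; now subst.
  - intros n i e n' [] E; simpl in E; unpair; try discriminate; subst.
    now rewrite (proof_irrelevance _ e e0).
  - intros n m g IHg hs IHhs n' [] E; simpl in E; unpair; try discriminate.
    apply IHg in H0; apply IHhs in H1.
    pose proof (f_equal (@projT1 _ _) H0); pose proof (f_equal (@projT1 _ _) H1); simpl in *.
    inversion H3; subst. apply inj_pair2 in H0; apply inj_pair2 in H1; now subst.
  - intros n g IHg h IHh n' [] E; simpl in E; unpair; try discriminate.
    apply IHg in H0; apply IHh in H1.
    pose proof (f_equal (@projT1 _ _) H0); simpl in *; subst.
    apply inj_pair2 in H0; apply inj_pair2 in H1; now subst.
  - intros n n' m' [] E; simpl in E; unpair; try discriminate; now subst.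
  - intros n m h IHh hs IHhs n' m' [] E; simpl in E; unpair; try discriminate.
    apply IHh in H0; apply IHhs in H1.
    pose proof (f_equal (@projT1 _ _) H0); pose proof (f_equal (@projT1 _ _) H1); simpl in *.
    inversion H3; subst. apply inj_pair2 in H0; apply inj_pair2 in H1; now subst.
Qed.

Fixpoint codeT (t : term) : nat :=
  match t with
  | Var i => cpair 0 i
  | App f ts => cpair 1 (cpair (codePRF f) (codeTs ts))
  end
with codeTs {n} (ts : terms n) : nat :=
  match ts with
  | TNil => cpair 0 0
  | TCons t ts => cpair 1 (cpair (codeT t) (codeTs ts))
  end.

Lemma codeT_inj :
  (forall t t', codeT t = codeT t' -> t = t') /\
  (forall n (ts : terms n) n' (ts' : terms n'), codeTs ts = codeTs ts' -> existT terms n ts = existT terms n' ts').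
Proof.
  apply term_terms_ind.
  - intros i [] E; simpl in E; unpair; try discriminate; now subst.
  - intros n f ts IH [] E; simpl in E; unpair; try discriminate.
    apply (proj1 codePRF_inj) in H0; apply IH in H1.
    pose proof (f_equal (@projT1 _ _) H0); simpl in *; subst.
    apply inj_pair2 in H0; apply inj_pair2 in H1; now subst.
  - intros n' [] E; simpl in E; unpair; try discriminate; auto.
  - intros n t IHt ts IH n' [] E; simpl in E; unpair; try discriminate.
    apply IHt in H0; apply IH in H1; subst.
    pose proof (f_equal (@projT1 _ _) H1); simpl in *; subst.
    apply inj_pair2 in H1; now subst.
Qed.

Fixpoint codeF (a : form) : nat :=
  match a with
  | FEq s t => cpair 0 (cpair (codeT s) (codeT t))
  | FBot => cpair 1 0
  | FImp a b => cpair 2 (cpair (codeF a) (codeF b))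
  | FAnd a b => cpair 3 (cpair (codeF a) (codeF b))
  | FOr a b => cpair 4 (cpair (codeF a) (codeF b))
  | FAll a => cpair 5 (codeF a)
  | FEx a => cpair 6 (codeF a)
  end.

Lemma codeF_inj a : forall b, codeF a = codeF b -> a = b.
Proof.
  induction a; intros [] E; simpl in E; unpair; try discriminate; auto;
    f_equal; auto; apply (proj1 codeT_inj); auto.
Qed.

(** On a number that codes no formula the choice operator returns an arbitrary formula. This does no
    harm, since the Henkin construction may treat a formula at several stages. *)
Definition enumF (n : nat) : form := epsilon (inhabits FBot) (fun a => codeF a = n).

Lemma enumF_codeF a : enumF (codeF a) = a.
Proof.
  apply codeF_inj. unfold enumF.
  exact (epsilon_spec (inhabits FBot) (fun b => codeF b = codeF a) (ex_intro _ a eq_refl)).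
Qed.

(** * Completeness *)

(** Function symbols take plain lists, which keeps vectors out of the semantics; the axioms will
    constrain [fn] on lists of the right length. Equality is going to be identity. *)
Record Interp : Type := { dom :> Type; fn : forall n, PRF n -> list dom -> dom }.
Arguments fn {i n} f xs.

Fixpoint mev {M : Interp} (rho : nat -> M) (t : term) : M :=
  match t with
  | Var i => rho i
  | App f ts => fn f (mevs rho ts)
  end
with mevs {M : Interp} (rho : nat -> M) {n} (ts : terms n) : list M :=
  match ts with
  | TNil => []
  | TCons t ts => mev rho t :: mevs rho ts
  end.

Fixpoint msat {M : Interp} (rho : nat -> M) (a : form) : Prop :=
  match a with
  | FEq s t => mev rho s = mev rho t
  | FBot => False
  | FImp a b => msat rho a -> msat rho b
  | FAnd a b => msat rho a /\ msat rho b
  | FOr a b => msat rho a \/ msat rho b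
  | FAll a => forall d, msat (scons d rho) a
  | FEx a => exists d, msat (scons d rho) a
  end.

Lemma mev_subst {M : Interp} (rho : nat -> M) s :
  (forall t, mev rho (tsubst s t) = mev (fun i => mev rho (s i)) t) /\
  (forall n (ts : terms n), mevs rho (tssubst s ts) = mevs (fun i => mev rho (s i)) ts).
Proof. apply term_terms_ind; simpl; intros; congruence. Qed.

Lemma mev_upsub {M : Interp} (rho : nat -> M) s d :
  (fun i => mev (scons d rho) (upsub s i)) = scons d (fun i => mev rho (s i)).
Proof.
  extensionality i; destruct i; simpl; auto.
  rewrite (proj1 (trename_tsubst S)), (proj1 (mev_subst _ _)); reflexivity.
Qed.

Lemma msat_subst {M : Interp} a : forall (rho : nat -> M) s,
  msat rho (fsubst s a) <-> msat (fun i => mev rho (s i)) a.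
Proof.
  induction a; intros rho s; simpl; rewrite ?(proj1 (mev_subst rho s)); try reflexivity;
    rewrite ?IHa1, ?IHa2; try reflexivity.
  - split; intros H d; specialize (H d); apply IHa in H || apply IHa; rewrite mev_upsub in *; auto.
  - split; intros [d H]; exists d; apply IHa in H || apply IHa; rewrite mev_upsub in *; auto.
Qed.

Lemma msat_rename {M : Interp} a (rho : nat -> M) xi :
  msat rho (frename xi a) <-> msat (fun i => rho (xi i)) a.
Proof. rewrite frename_fsubst; apply msat_subst. Qed.

Lemma Provable_ax (S : form -> Prop) a : S a -> Provable S a.
Proof. intros H; exists [a]; split; [intros b [<-|[]]; auto|apply P_ax; simpl; auto]. Qed.

Lemma Provable_mono (S S' : form -> Prop) a :
  (forall b, S b -> S' b) -> Provable S a -> Provable S' a.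
Proof. intros H (G & HG & P); exists G; split; auto. Qed.

Lemma Provable_1 (S : form -> Prop) a b :
  (forall G, Prov G a -> Prov G b) -> Provable S a -> Provable S b.
Proof. intros H (G & HG & P); exists G; split; auto. Qed.

Lemma Provable_2 (S : form -> Prop) a b c :
  (forall G, Prov G a -> Prov G b -> Prov G c) -> Provable S a -> Provable S b -> Provable S c.
Proof.
  intros H (G & HG & P) (G' & HG' & P'); exists (G ++ G'); split.
  - intros x Hx; apply in_app_or in Hx; destruct Hx; auto.
  - apply H; [apply (Prov_weaken G)|apply (Prov_weaken G')]; auto using incl_appl, incl_appr, incl_refl.
Qed.

Lemma Provable_discharge (S : form -> Prop) a b :
  Provable (fun z => S z \/ z = a) b -> Provable S (FImp a b).
Proof.
  intros (G & HG & P).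
  assert (exists G', (forall z, In z G' -> S z) /\ incl G (a :: G')) as (G' & H1 & H2).
  { clear P; induction G as [|x G IH].
    - exists []; split; [intros z []|intros z []].
    - destruct IH as (G' & H1 & H2); [intros; apply HG; simpl; auto|].
      destruct (HG x (or_introl eq_refl)) as [Hx| ->].
      + exists (x :: G'); split; [intros z [<-|]; auto|].
        intros z [<-|Hz]; simpl; auto. destruct (H2 z Hz); auto.
      + exists G'; split; auto. intros z [<-|Hz]; [simpl; auto|apply H2; auto]. }
  exists G'; split; auto. apply P_impI; eapply Prov_weaken; eauto.
Qed.

Definition Con (S : form -> Prop) : Prop := ~ Provable S FBot.

(** Freshness of y in terms of substitution: this is the form that combines with [Prov_subst], and
    unlike [ffv] it can single out one variable below others that do occur. *)
Definition nfree (y : nat) (b : form) : Prop :=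
  forall s s' : nat -> term, (forall i, i <> y -> s i = s' i) -> fsubst s b = fsubst s' b.

Lemma nfree_ffv y k b : ffv k b -> k <= y -> nfree y b.
Proof. intros F H s s' E; apply (fsubst_ffv b k); auto. intros i Hi; apply E; lia. Qed.

Lemma Con_witness (S : form -> Prop) b y k :
  (forall z, S z -> nfree y z) -> ffv k (FEx b) -> k <= y -> S (FEx b) -> Con S ->
  Con (fun z => S z \/ z = subst0 (Var y) b).
Proof.
  intros HS F Hk HE C P; apply C; clear C. apply Provable_discharge in P.
  destruct P as (G & HG & P).
  exists (FEx b :: G); split; [intros z [<-|]; auto|].
  eapply P_exE; [apply P_ax; simpl; eauto|].
  (* Sending y to [Var 0] and shifting the rest turns the witness instance back into b and, by
     freshness, the context into its shift. These are the ingredients of [P_exE]. *)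
  apply Prov_subst with (s := fun i => if i =? y then Var 0 else Var (Datatypes.S i)) in P.
  assert (E : map (fsubst (fun i => if i =? y then Var 0 else Var (Datatypes.S i))) G = map shiftF G).
  { apply map_ext_in; intros z Hz. rewrite shiftF_fsubst. apply HS; auto.
    intros i Hi; apply Nat.eqb_neq in Hi; now rewrite Hi. }
  rewrite E in P; clear E.
  change (Prov (map shiftF G) (FImp (fsubst (fun i => if i =? y then Var 0 else Var (Datatypes.S i)) (subst0 (Var y) b)) FBot)) in P.
  assert (E : fsubst (fun i => if i =? y then Var 0 else Var (Datatypes.S i)) (subst0 (Var y) b) = b).
  { unfold subst0; rewrite fsubst_fsubst. rewrite <- (fsubst_Var b) at 2.
    apply (fsubst_ffv b (Datatypes.S k)); auto.
    intros [|i] Hi; simpl; [now rewrite Nat.eqb_refl|].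
    destruct (Nat.eqb_spec i y); auto; lia. }
  rewrite E in P. apply P_impE with (a := b); [|apply P_ax; simpl; auto].
  eapply Prov_weaken; [exact P|]. intros z Hz; simpl; auto.
Qed.

(** * Henkin extension and term model *)

Section Henkin.
Variable T0 : form -> Prop.
Hypothesis T0_con : Con T0.
Hypothesis T0_odd : forall z, T0 z -> forall j, nfree (S (2 * j)) z.

Definition bd (a : form) : nat := epsilon (inhabits 0) (fun k => ffv k a).

Lemma bd_spec a : ffv (bd a) a.
Proof. exact (epsilon_spec (inhabits 0) (fun k => ffv k a) (ffv_exists a)). Qed.

(** The witness of stage n is the odd variable [S (2 * hw n)]. As [hw n] bounds the variables of the
    formulas 0 to n and grows strictly, this variable is fresh for everything added so far, earlier
    witnesses included. *)
Fixpoint hw (n : nat) : nat :=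
  match n with
  | O => bd (enumF 0)
  | S n' => bd (enumF n) + 2 * hw n' + 2
  end.

Fixpoint stage (n : nat) : form -> Prop :=
  match n with
  | O => T0
  | S n' => fun z => stage n' z \/
      (Con (fun x => stage n' x \/ x = enumF n') /\
       (z = enumF n' \/ exists b, enumF n' = FEx b /\ z = subst0 (Var (S (2 * hw n'))) b))
  end.

Lemma hw_bd n : bd (enumF n) <= hw n.
Proof. destruct n; simpl; lia. Qed.

Lemma stage_nfree n : forall z, stage n z -> forall j, hw n <= j -> nfree (S (2 * j)) z.
Proof.
  assert (B : forall n z, z = enumF n \/ (exists b, enumF n = FEx b /\ z = subst0 (Var (S (2 * hw n))) b) ->
          forall j, hw n < j -> nfree (S (2 * j)) z).
  { intros k z [-> | (b & E & ->)] j Hj; pose proof (bd_spec (enumF k)) as F; pose proof (hw_bd k).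
    - eapply nfree_ffv; [exact F|lia].
    - rewrite E in F; simpl in F. intros s s' Es; unfold subst0; rewrite !fsubst_fsubst.
      apply (fsubst_ffv b _ _ _) with (2 := F). rewrite E in H.
      intros [|i] Hi; cbn [scons tsubst]; apply Es; lia. }
  induction n as [|n IH]; intros z H j Hj.
  - apply T0_odd; auto.
  - cbn [hw] in Hj. destruct H as [H|[_ H]].
    + apply IH; auto; lia.
    + apply (B n); auto; lia.
Qed.

Lemma stage_con n : Con (stage n).
Proof.
  induction n as [|n IH]; auto. simpl.
  destruct (classic (Con (fun x => stage n x \/ x = enumF n))) as [C|C].
  - destruct (classic (exists b, enumF n = FEx b)) as [[b E]|NE].
    + assert (C' : Con (fun z => (stage n z \/ z = enumF n) \/ z = subst0 (Var (S (2 * hw n))) b)).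
      { apply Con_witness with (k := bd (enumF n)); auto.
        - intros z [Hz| ->].
          + apply (stage_nfree n); auto.
          + eapply nfree_ffv; [apply bd_spec|]. pose proof (hw_bd n); lia.
        - rewrite <- E; apply bd_spec.
        - pose proof (hw_bd n); lia. }
      intros P; apply C'; revert P; apply Provable_mono.
      intros z [H|[_ [H|(b' & E' & H)]]]; auto.
      rewrite E in E'; inversion E'; subst; auto.
    + intros P; apply C; revert P; apply Provable_mono.
      intros z [H|[_ [H|(b' & E' & H)]]]; auto. exfalso; eauto.
  - intros P; apply IH; revert P; apply Provable_mono.
    intros z [H|[H _]]; auto. contradiction.
Qed.

Definition limit (z : form) : Prop := exists n, stage n z.

Lemma stage_mono n m z : n <= m -> stage n z -> stage m z.
Proof. induction 1; simpl; auto. Qed.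

Lemma limit_con : Con limit.
Proof.
  intros (G & HG & P).
  assert (exists n, forall z, In z G -> stage n z) as [n Hn].
  { clear P; induction G as [|x G IH].
    - exists 0; intros z [].
    - destruct IH as [n Hn]; [intros; apply HG; simpl; auto|].
      destruct (HG x (or_introl eq_refl)) as [m Hm].
      exists (max n m); intros z [<-|Hz]; [apply (stage_mono m)|apply (stage_mono n)]; auto; lia. }
  apply (stage_con n). exists G; auto.
Qed.

Definition Th (a : form) : Prop := Provable limit a.

(** A formula refused at its own stage is inconsistent with that stage, and discharging it proves
    the negation. An accepted existential formula entered together with a witness. *)
Lemma limit_cases a : (limit a /\ (forall b, a = FEx b -> exists t, limit (subst0 t b))) \/ Th (FNot a).
Proof.
  destruct (classic (Con (fun x => stage (codeF a) x \/ x = a))) as [C|C].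
  - left. pose proof (enumF_codeF a) as E. split.
    + exists (S (codeF a)); simpl; right; rewrite E; auto.
    + intros b Hb. eexists; exists (S (codeF a)); simpl; right; rewrite E; eauto.
  - right. apply NNPP in C. apply Provable_discharge in C.
    revert C; apply Provable_mono. intros b Hb; exists (codeF a); auto.
Qed.

Lemma Th_not a : Th (FNot a) <-> ~ Th a.
Proof.
  split.
  - intros H H'. apply limit_con. revert H H'; apply Provable_2; intros; eapply P_impE; eauto.
  - intros H. destruct (limit_cases a) as [[H' _]|]; auto. elim H; apply Provable_ax; auto.
Qed.

Lemma Th_imp a b : Th (FImp a b) <-> (Th a -> Th b).
Proof.
  split.
  - apply Provable_2; intros; eapply P_impE; eauto.
  - intros H. destruct (classic (Th a)) as [Ha|Ha].
    + generalize (H Ha); apply Provable_1; intros G P; apply P_impI.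
      eapply Prov_weaken; [eauto|]; intros z; simpl; auto.
    + apply Th_not in Ha; revert Ha; apply Provable_1; intros G P; apply P_impI.
      apply P_raa. eapply P_impE; [|apply P_ax; right; left; reflexivity].
      eapply Prov_weaken; [eauto|]; intros z; simpl; auto.
Qed.

Lemma Th_and a b : Th (FAnd a b) <-> Th a /\ Th b.
Proof.
  split.
  - intros H; split; revert H; apply Provable_1; intros G P; [eapply P_andE1|eapply P_andE2]; eauto.
  - intros [H H']; revert H H'; apply Provable_2; intros; apply P_andI; auto.
Qed.

Lemma Th_or a b : Th (FOr a b) <-> Th a \/ Th b.
Proof.
  split.
  - intros H. apply NNPP; intros N. apply not_or_and in N as [N1 N2].
    apply Th_not in N1; apply Th_not in N2. apply limit_con.
    assert (H' : Th (FAnd (FNot a) (FNot b))) by (apply Th_and; auto).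
    revert H H'; apply Provable_2; intros G P P'.
    eapply P_orE; [eauto| |]; (eapply P_impE; [|apply P_ax; left; reflexivity]);
      eapply Prov_weaken with (G := G); try (intros z; simpl; auto; fail).
    + eapply P_andE1; eauto.
    + eapply P_andE2; eauto.
  - intros [H|H]; revert H; apply Provable_1; intros G P; [apply P_orI1|apply P_orI2]; auto.
Qed.

Lemma Th_ex a : Th (FEx a) <-> exists t, Th (subst0 t a).
Proof.
  split.
  - intros H. destruct (limit_cases (FEx a)) as [[_ W]|N].
    + destruct (W a eq_refl) as [t Ht]; exists t; apply Provable_ax; auto.
    + apply Th_not in N; contradiction.
  - intros [t H]; revert H; apply Provable_1; intros; eapply P_exI; eauto.
Qed.

Lemma subst0_shift a : subst0 (Var 0) (fsubst (upsub (fun i => Var (S i))) a) = a.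
Proof.
  unfold subst0; rewrite fsubst_fsubst. rewrite <- (fsubst_Var a) at 2. f_equal.
  extensionality i; destruct i; reflexivity.
Qed.

Lemma Th_all a : Th (FAll a) <-> forall t, Th (subst0 t a).
Proof.
  split.
  - intros H t; revert H; apply Provable_1; intros; apply P_allE; auto.
  - intros H. apply NNPP; intros N.
    assert (W : Th (FEx (FNot a))).
    (* Classical duality inside the calculus: assuming that there is no counterexample, [a] is
       proved for a fresh variable and generalised. *)
    { apply Th_not in N. revert N; apply Provable_1; intros G P.
      apply P_raa. eapply P_impE; [eapply Prov_weaken; [exact P|intros z; simpl; auto]|].
      apply P_allI. apply P_raa. simpl.
      eapply P_impE with (a := FEx (fsubst (upsub (fun i => Var (S i))) (FNot a))).
      - apply P_ax; right; left. unfold shiftF; rewrite frename_fsubst; reflexivity.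
      - apply P_exI with (t := Var 0). rewrite subst0_shift. apply P_ax; simpl; auto. }
    apply Th_ex in W as [t W]. apply (Th_not (subst0 t a)) in W. auto.
Qed.

Lemma Th_eq_subst a s t : Th (FEq s t) -> Th (subst0 s a) -> Th (subst0 t a).
Proof. apply Provable_2; intros; eapply P_eqE; eauto. Qed.

Lemma Th_refl t : Th (FEq t t).
Proof. exists []; split; [intros b []|apply P_refl]. Qed.

Lemma subst0_shiftT s t : tsubst (scons s Var) (shiftT t) = t.
Proof.
  unfold shiftT; rewrite (proj1 (trename_tsubst S)), (proj1 (tsubst_tsubst _ _)); apply (proj1 tsubst_Var).
Qed.

Lemma Th_sym s t : Th (FEq s t) -> Th (FEq t s).
Proof.
  intros H. generalize (Th_eq_subst (FEq (Var 0) (shiftT s)) s t H).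
  unfold subst0; simpl; rewrite !subst0_shiftT; intros X; apply X, Th_refl.
Qed.

Lemma Th_trans s t u : Th (FEq s t) -> Th (FEq t u) -> Th (FEq s u).
Proof.
  intros H H'. generalize (Th_eq_subst (FEq (shiftT s) (Var 0)) t u H').
  unfold subst0; simpl; rewrite !subst0_shiftT; auto.
Qed.

(* [cls] picks one representative in each class of provably equal terms, so that the
   term model has Leibniz equality. *)
Definition cls (t : term) : term := epsilon (inhabits t) (fun s => Th (FEq t s)).

Lemma cls_Th t : Th (FEq t (cls t)).
Proof. exact (epsilon_spec (inhabits t) (fun s => Th (FEq t s)) (ex_intro _ t (Th_refl t))). Qed.

Lemma cls_eq s t : cls s = cls t <-> Th (FEq s t).
Proof.
  split; intros H.
  - eapply Th_trans; [apply cls_Th|]. rewrite H. apply Th_sym, cls_Th.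
  - unfold cls. rewrite (proof_irrelevance _ (inhabits s) (inhabits t)). f_equal.
    extensionality u; apply propositional_extensionality; split; intros X.
    + eapply Th_trans; [apply Th_sym|]; eauto.
    + eapply Th_trans; eauto.
Qed.

Lemma cls_cls t : cls (cls t) = cls t.
Proof. apply cls_eq, Th_sym, cls_Th. Qed.

Definition tdom : Type := { t : term | cls t = t }.
Definition tcls (t : term) : tdom := exist _ (cls t) (cls_cls t).

Fixpoint mk_terms (n : nat) (xs : list term) : terms n :=
  match n with
  | O => TNil
  | S n' => TCons (hd zeroT xs) (mk_terms n' (tl xs))
  end.

Definition tmodel : Interp :=
  {| dom := tdom; fn := fun n f xs => tcls (App f (mk_terms n (map (@proj1_sig _ _) xs))) |}.

Fixpoint tlist {n} (ts : terms n) : list term :=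
  match ts with
  | TNil => []
  | TCons t ts => t :: tlist ts
  end.

Lemma mk_terms_tlist n (ts : terms n) : mk_terms n (tlist ts) = ts.
Proof. induction ts; simpl; congruence. Qed.

Lemma tdom_eq (x y : tdom) : proj1_sig x = proj1_sig y -> x = y.
Proof.
  destruct x as [x Hx], y as [y Hy]; simpl; intros ->.
  now rewrite (proof_irrelevance _ Hx Hy).
Qed.

Lemma tssubst_mk_terms s n : forall ts, tssubst s (mk_terms n ts) = mk_terms n (map (tsubst s) ts).
Proof. induction n; intros [|t ts]; simpl; f_equal; auto; apply (IHn []). Qed.

Lemma Th_congr1 n (f : PRF n) ps s t qs : Th (FEq s t) ->
  Th (FEq (App f (mk_terms n (ps ++ s :: qs))) (App f (mk_terms n (ps ++ t :: qs)))).
Proof.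
  intros H.
  assert (E : forall u ts, map (tsubst (scons u Var)) (map shiftT ts) = ts).
  { intros u ts; rewrite map_map. rewrite <- (map_id ts) at 2. apply map_ext; intros; apply subst0_shiftT. }
  generalize (Th_eq_subst (FEq (App f (mk_terms n (map shiftT ps ++ shiftT s :: map shiftT qs)))
                               (App f (mk_terms n (map shiftT ps ++ Var 0 :: map shiftT qs)))) s t H).
  unfold subst0; cbn [fsubst tsubst]; rewrite !tssubst_mk_terms, !map_app; cbn [map tsubst scons].
  rewrite !E, !subst0_shiftT. intros X; apply X, Th_refl.
Qed.

(** The prefix ps collects the arguments already replaced by their representatives, so that the
    arguments are exchanged one at a time. *)
Lemma Th_congr n (f : PRF n) ts : forall ps,
  Th (FEq (App f (mk_terms n (ps ++ ts))) (App f (mk_terms n (ps ++ map cls ts)))).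
Proof.
  induction ts as [|t ts IH]; intros ps; [apply Th_refl|].
  eapply Th_trans; [apply Th_congr1, cls_Th|].
  specialize (IH (ps ++ [cls t])). rewrite <- !app_assoc in IH. exact IH.
Qed.

Lemma tmodel_mev (s : nat -> term) :
  (forall t, mev (fun i => tcls (s i) : tmodel) t = tcls (tsubst s t)) /\
  (forall n (ts : terms n), mevs (fun i => tcls (s i) : tmodel) ts = map tcls (tlist (tssubst s ts))).
Proof.
  apply term_terms_ind; simpl; auto.
  - intros n f ts IH. rewrite IH, map_map. apply tdom_eq; simpl. symmetry; apply cls_eq.
    rewrite <- (mk_terms_tlist n (tssubst s ts)) at 1.
    apply (Th_congr n f _ []).
  - intros n t IHt ts IH; f_equal; auto.
Qed.

Lemma subst0_upsub s t a : subst0 t (fsubst (upsub s) a) = fsubst (scons t s) a.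
Proof.
  unfold subst0; rewrite fsubst_fsubst; f_equal; extensionality i; destruct i; simpl; auto.
  apply subst0_shiftT.
Qed.

Lemma tcls_proj (d : tdom) : tcls (proj1_sig d) = d.
Proof. apply tdom_eq; simpl. now destruct d. Qed.

(** Every element of the term model is the class of a term, so assignments may be taken from
    substitutions s. Carrying s through the induction matches the quantifier cases with [Th_all] and
    [Th_ex]. *)
Lemma truth a : forall s, msat (fun i => tcls (s i) : tmodel) a <-> Th (fsubst s a).
Proof.
  assert (E : forall (s : nat -> term) t,
    (fun i => tcls (scons t s i) : tmodel) = scons (tcls t : tmodel) (fun i => tcls (s i) : tmodel)).
  { intros s t; extensionality i; destruct i; auto. }
  induction a; intros s; simpl.
  - rewrite !(proj1 (tmodel_mev s)), <- cls_eq. split; intros H; [inversion H; auto|apply tdom_eq; auto].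
  - split; [tauto|apply limit_con].
  - rewrite Th_imp, IHa1, IHa2; tauto.
  - rewrite Th_and, IHa1, IHa2; tauto.
  - rewrite Th_or, IHa1, IHa2; tauto.
  - rewrite Th_all; split; intros H d; specialize (IHa (scons d s)) || specialize (IHa (scons (proj1_sig d) s)).
    + specialize (H (tcls d)). rewrite subst0_upsub. apply IHa; rewrite E; auto.
    + rewrite <- (tcls_proj d), <- E. apply IHa. rewrite <- subst0_upsub; auto.
  - rewrite Th_ex; split; intros [d H].
    + exists (proj1_sig d). rewrite subst0_upsub; apply IHa. rewrite E, tcls_proj; auto.
    + exists (tcls d). rewrite <- E; apply IHa. rewrite <- subst0_upsub; auto.
Qed.
End Henkin.

(* Renaming every variable to an even one frees the odd variables for Henkin witnesses,
   without any closedness assumption on [T] or [a]. *)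
Theorem completeness (T : form -> Prop) a :
  (forall (M : Interp) (rho : nat -> M), (forall b, T b -> msat rho b) -> msat rho a) ->
  Provable T a.
Proof.
  intros H. apply NNPP; intros N.
  set (dbl := fsubst (fun i => Var (2 * i))).
  (* Halving the variables undoes the doubling, so a contradiction derived from the doubled formulas
     can be renamed back. *)
  set (hlf := fsubst (fun i => Var (Nat.div2 i))).
  assert (HD : forall b, hlf (dbl b) = b).
  { intros b; unfold hlf, dbl; rewrite fsubst_fsubst. rewrite <- (fsubst_Var b) at 2. f_equal.
    extensionality i. simpl tsubst. f_equal; apply Nat.div2_double. }
  set (T0 := fun z => exists b, (T b \/ b = FNot a) /\ z = dbl b).
  assert (C : Con T0).
  { intros (G & HG & P). apply N.
    apply Prov_subst with (s := fun i => Var (Nat.div2 i)) in P.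
    assert (D : Provable (fun z => T z \/ z = FNot a) FBot).
    { exists (map hlf G); split; auto. intros z Hz. apply in_map_iff in Hz as (y & <- & Hy).
      destruct (HG y Hy) as (b & Hb & ->). rewrite HD; auto. }
    apply Provable_discharge in D. revert D; apply Provable_1. intros G' P'. apply P_raa.
    eapply P_impE; [|apply P_ax; left; reflexivity]. eapply Prov_weaken; [eauto|]; intros z; simpl; auto. }
  assert (O : forall z, T0 z -> forall j, nfree (S (2 * j)) z).
  { intros z (b & _ & ->) j s s' E. unfold dbl; rewrite !fsubst_fsubst. f_equal.
    extensionality i; simpl tsubst; apply E; lia. }
  assert (TR : forall b, T b \/ b = FNot a ->
    msat (fun i => tcls T0 (Var (2 * i)) : tmodel T0) b).
  { intros b Hb. apply truth; auto. apply Provable_ax. exists 0; exists b; auto. }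
  apply (TR (FNot a)); [auto|]. apply H; auto.
Qed.

(** * Models of primitive recursive arithmetic *)

Definition zero {M : Interp} : M := fn (PZ 0) [].
Definition su {M : Interp} (x : M) : M := fn PS [x].

Fixpoint fns {M : Interp} {n m} (hs : PRFs n m) (xs : list M) : list M :=
  match hs with
  | PNil _ => []
  | PCons h hs => fn h xs :: fns hs xs
  end.

Class PRA (M : Interp) : Prop := {
  pra_S1 : forall x : M, su x <> zero;
  pra_S2 : forall x y : M, su x = su y -> x = y;
  pra_Z : forall n (xs : list M), length xs = n -> fn (PZ n) xs = zero;
  pra_P : forall n i H (xs : list M), length xs = n -> fn (PP n i H) xs = nth i xs zero;
  pra_C : forall n m g (hs : PRFs n m) (xs : list M), length xs = n -> fn (PC n m g hs) xs = fn g (fns hs xs);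
  pra_R0 : forall n g h (xs : list M), length xs = n -> fn (PR n g h) (zero :: xs) = fn g xs;
  pra_RS : forall n g h y (xs : list M), length xs = n ->
    fn (PR n g h) (su y :: xs) = fn h (y :: fn (PR n g h) (y :: xs) :: xs);
  pra_ind : forall a (rho : nat -> M), QF a -> msat (scons zero rho) a ->
    (forall y, msat (scons y rho) a -> msat (scons (su y) rho) a) -> forall y, msat (scons y rho) a }.

Definition TIsem (M : Interp) (R : M -> M -> Prop) : Prop :=
  forall a (rho : nat -> M), Delta0 a ->
    (forall x, (forall y, R y x -> msat (scons y rho) a) -> msat (scons x rho) a) ->
    forall x, msat (scons x rho) a.

Fixpoint lenv {A} (xs : list A) (rho : nat -> A) : nat -> A :=
  match xs with [] => rho | x :: xs => scons x (lenv xs rho) end.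

Lemma lenv_app {A} (xs ys : list A) rho : lenv (xs ++ ys) rho = lenv xs (lenv ys rho).
Proof. induction xs; simpl; congruence. Qed.

Lemma map_lenv {A} (xs : list A) rho n : length xs = n -> map (lenv xs rho) (seq 0 n) = xs.
Proof.
  intros <-. induction xs as [|x xs IH]; simpl; auto. f_equal. rewrite <- seq_shift, map_map. auto.
Qed.

Lemma nth_lenv {A} (xs : list A) rho i d : i < length xs -> lenv xs rho i = nth i xs d.
Proof. revert i; induction xs; intros [|i] H; simpl in *; auto; try lia. apply IHxs; lia. Qed.

Lemma msat_nAll {M : Interp} n a : forall rho : nat -> M,
  msat rho (nAll n a) <-> forall xs, length xs = n -> msat (lenv xs rho) a.
Proof.
  induction n as [|n IH]; intros rho; simpl.
  - split; [intros H [|x xs] L; simpl; auto; discriminate|intros H; apply (H []); auto].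
  - split.
    + intros H xs L. destruct (@exists_last _ xs) as (xs' & d & ->); [intros ->; discriminate|].
      rewrite length_app in L; simpl in L. rewrite lenv_app; simpl. apply IH; auto; lia.
    + intros H d. apply IH. intros xs L. specialize (H (xs ++ [d])).
      rewrite lenv_app, length_app in H; apply H; simpl; lia.
Qed.

Lemma mevs_varsT {M : Interp} (rho : nat -> M) n : forall k, mevs rho (varsT k n) = map rho (seq k n).
Proof. induction n; intros k; simpl; f_equal; auto. Qed.

Lemma mevs_appsT {M : Interp} (rho : nat -> M) n m (hs : PRFs n m) ts :
  mevs rho (appsT hs ts) = fns hs (mevs rho ts).
Proof. induction hs; simpl; f_equal; auto. Qed.

Lemma mev_ffv {M : Interp} k (r1 r2 : nat -> M) : (forall i, i < k -> r1 i = r2 i) ->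
  (forall t, tfv k t -> mev r1 t = mev r2 t) /\
  (forall n (ts : terms n), tsfv k ts -> mevs r1 ts = mevs r2 ts).
Proof.
  intros H; apply term_terms_ind; simpl; intros; auto.
  - f_equal; auto.
  - destruct H2; f_equal; auto.
Qed.

Lemma msat_ffv {M : Interp} a : forall k (r1 r2 : nat -> M), (forall i, i < k -> r1 i = r2 i) ->
  ffv k a -> (msat r1 a <-> msat r2 a).
Proof.
  assert (U : forall k (r1 r2 : nat -> M) d, (forall i, i < k -> r1 i = r2 i) ->
              forall i, i < S k -> scons d r1 i = scons d r2 i).
  { intros k r1 r2 d H [|i] Hi; simpl; auto. apply H; lia. }
  induction a; simpl; intros k r1 r2 H F; try tauto;
    try (destruct F; specialize (IHa1 k r1 r2 H); specialize (IHa2 k r1 r2 H); tauto).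
  - destruct F. rewrite !(proj1 (mev_ffv k r1 r2 H)); tauto.
  - split; intros X d; specialize (X d); [rewrite <- (IHa (S k))|rewrite (IHa (S k))]; eauto.
  - split; intros [d X]; exists d; [rewrite <- (IHa (S k))|rewrite (IHa (S k))]; eauto.
Qed.

Section FromAxioms.
Context {M : Interp} (rho : nat -> M).

(** The axioms are closures over finitely many variables, whereas the semantic schemata admit any
    assignment of parameters. The first k values of r are all that a formula with variables below
    [S k] can see besides z. *)
Lemma msat_lenv_params a k (r : nat -> M) : ffv (S k) a -> forall z,
  msat (scons z (lenv (map r (seq 0 k)) rho)) a <-> msat (scons z r) a.
Proof.
  intros Hk z. apply (msat_ffv a (S k)); auto.
  intros [|i] Hi; simpl; auto. rewrite (nth_lenv _ rho i (r 0)).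
  - rewrite (map_nth r (seq 0 k) 0 i), seq_nth; auto; lia.
  - rewrite length_map, length_seq; lia.
Qed.

Lemma PRA_of_axioms : (forall b, PRAax b -> msat rho b) -> PRA M.
Proof.
  intros H.
  assert (A : forall n a, PRAax (nAll n a) -> forall xs, length xs = n -> msat (lenv xs rho) a).
  { intros n a Ha. apply msat_nAll, H, Ha. }
  constructor.
  - intros x E. apply (H _ ax_S1 x). exact E.
  - intros x y E. apply (H _ ax_S2 x y). exact E.
  - intros n xs L. generalize (A _ _ (ax_Z n) xs L); simpl. now rewrite mevs_varsT, map_lenv.
  - intros n i e xs L. generalize (A _ _ (ax_P n i e) xs L); simpl. rewrite mevs_varsT, map_lenv; auto.
    intros ->. apply nth_lenv. apply Nat.ltb_lt in e; lia.
  - intros n m g hs xs L. generalize (A _ _ (ax_C n m g hs) xs L); simpl.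
    now rewrite mevs_appsT, mevs_varsT, map_lenv.
  - intros n g h xs L. generalize (A _ _ (ax_R0 n g h) xs L); simpl.
    rewrite mevs_varsT, map_lenv; auto.
  - intros n g h y xs L. generalize (A _ _ (ax_RS n g h) (y :: xs) ltac:(simpl; congruence)); simpl.
    rewrite mevs_varsT. rewrite <- seq_shift, map_map; simpl. rewrite map_lenv; auto.
  - intros a r Qa H0 HS y. destruct (ffv_exists a) as [k Hk].
    apply (ffv_mono a k (S k)) in Hk; [|lia].
    set (xs := map r (seq 0 k)). pose proof (msat_lenv_params a k r Hk) as E'. fold xs in E'.
    apply E'. apply (A k _ (ax_Ind k a Qa Hk) xs); [unfold xs; now rewrite length_map, length_seq|].
    split.
    + apply msat_subst. replace (fun i => _) with (scons zero (lenv xs rho)); [apply E'; auto|].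
      extensionality i; destruct i; reflexivity.
    + intros d Hd. apply msat_subst. apply E' in Hd. apply HS, E' in Hd.
      replace (fun i => _) with (scons (su d) (lenv xs rho)); auto.
      extensionality i; destruct i; reflexivity.
Qed.

Lemma TIsem_of_axioms Rf (R : M -> M -> Prop) :
  (forall r : nat -> M, msat r (Rf (Var 0) (Var 1)) <-> R (r 0) (r 1)) ->
  (forall b, TIax Rf b -> msat rho b) -> TIsem M R.
Proof.
  intros HR H a r Da HP x. destruct (ffv_exists a) as [k Hk].
  apply (ffv_mono a k (S k)) in Hk; [|lia].
  set (xs := map r (seq 0 k)). pose proof (msat_lenv_params a k r Hk) as E'. fold xs in E'.
  apply E'.
  pose proof (proj1 (msat_nAll _ _ _) (H _ (ax_TI Rf k a Da Hk)) xs) as X.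
  apply X; [unfold xs; now rewrite length_map, length_seq|].
  intros z Hz. apply E', HP. intros y Hy. specialize (Hz y). simpl in Hz.
  rewrite HR in Hz. simpl in Hz. specialize (Hz Hy). apply (proj1 (msat_rename a _ upS)) in Hz. apply E'.
  assert (Eu : (fun i => scons y (scons z (lenv xs rho)) (upS i)) = scons y (lenv xs rho)).
  { extensionality i; destruct i; reflexivity. }
  rewrite <- Eu; exact Hz.
Qed.
End FromAxioms.

(** * The standard model *)

Definition natI : Interp := {| dom := nat; fn := @eval |}.

Lemma fns_nat n m (hs : PRFs n m) (xs : list natI) : fns hs xs = evals hs xs.
Proof. induction hs; simpl; f_equal; auto. Qed.

#[export] Instance PRA_nat : PRA natI.
Proof.
  constructor; simpl; auto; try discriminate.
  - intros; now rewrite <- fns_nat.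
  - intros a r _ H0 HS y; induction y; auto.
Qed.

Lemma teval_mev (rho : nat -> natI) :
  (forall t, teval rho t = mev rho t) /\ (forall n (ts : terms n), tseval rho ts = mevs rho ts).
Proof. apply term_terms_ind; simpl; intros; congruence. Qed.

Lemma sat_msat a : forall rho : nat -> natI, sat rho a <-> msat rho a.
Proof.
  induction a; intros rho; simpl; rewrite ?(proj1 (teval_mev rho)), ?IHa1, ?IHa2; try tauto.
  - split; intros H d; apply IHa, H.
  - split; intros [d H]; exists d; apply IHa, H.
Qed.

(** * Definability and arithmetic in a model *)

(** Induction is available for [QF] formulas and TI for [Delta0] formulas; the closure properties of
    definable predicates are proved once for both. *)
Class FormClass (K : form -> Prop) : Prop := {
  fc_eq : forall s t, K (FEq s t);
  fc_bot : K FBot;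
  fc_imp : forall a b, K a -> K b -> K (FImp a b);
  fc_and : forall a b, K a -> K b -> K (FAnd a b);
  fc_or : forall a b, K a -> K b -> K (FOr a b);
  fc_subst : forall a s, K a -> K (fsubst s a) }.

#[export] Instance QF_class : FormClass QF.
Proof. constructor; try (constructor; auto; fail). intros a s H; induction H; simpl; constructor; auto. Qed.

Lemma tsubst_shiftT s t : tsubst (upsub s) (shiftT t) = shiftT (tsubst s t).
Proof.
  unfold shiftT; rewrite !(proj1 (trename_tsubst S)), !(proj1 (tsubst_tsubst _ _)).
  f_equal; extensionality i; simpl. now rewrite (proj1 (trename_tsubst S)).
Qed.

#[export] Instance Delta0_class : FormClass Delta0.
Proof.
  constructor; try (constructor; auto; fail). intros a s H; revert s.
  induction H; intros s1; simpl; try (constructor; auto; fail);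
    rewrite tsubst_shiftT; fold (succT (Var 0)); [apply d0_ball|apply d0_bex]; auto.
Qed.

(* Even variables read the environment, odd ones the parameters. *)
Definition mix {A} (r p : nat -> A) (i : nat) : A :=
  if Nat.even i then r (Nat.div2 i) else p (Nat.div2 i).

Lemma mix_even {A} (r p : nat -> A) i : mix r p (2 * i) = r i.
Proof. unfold mix. rewrite Nat.even_even, Nat.div2_double; auto. Qed.

Lemma mix_odd {A} (r p : nat -> A) i : mix r p (S (2 * i)) = p i.
Proof. unfold mix. rewrite Nat.even_succ, Nat.odd_even, Nat.div2_succ_double; auto. Qed.

Lemma even_odd_cases i : exists j, i = 2 * j \/ i = S (2 * j).
Proof. exists (Nat.div2 i). pose proof (Nat.div2_odd i). destruct (Nat.odd i); simpl in *; lia. Qed.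

Section Def.
Context {M : Interp} {X : Type}.
Implicit Types e : X -> nat -> M.

(** Definability with parameters p from the model. The variables available at a point x are given by
    e x, either a single element ([E1]) or a whole register assignment ([EV]). *)
Definition DT e (g : X -> M) : Prop :=
  exists t p, forall x, g x = mev (mix (e x) p) t.

Definition DQ (K : form -> Prop) e (P : X -> Prop) : Prop :=
  exists a p, K a /\ forall x, P x <-> msat (mix (e x) p) a.

(** A map into assignments given coordinatewise by terms with common parameters. Definable
    predicates are pulled back along it by substitution ([DQ_comp]). *)
Definition DM e (h : X -> nat -> M) : Prop :=
  exists s p, forall x i, h x i = mev (mix (e x) p) (s i).

(** Two formulas bring separate parameters p and q. Their combination uses the interleaved list
    [mix p q], and these renamings send the odd variables of either formula to its own half. *)
Definition ren_l (i : nat) : term := Var (if Nat.even i then i else S (2 * (2 * Nat.div2 i))).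
Definition ren_r (i : nat) : term := Var (if Nat.even i then i else S (2 * S (2 * Nat.div2 i))).

Lemma mix_ren_l (r p q : nat -> M) : (fun i => mev (mix r (mix p q)) (ren_l i)) = mix r p.
Proof.
  extensionality i. destruct (even_odd_cases i) as [j [-> | ->]]; unfold ren_l; cbn [mev].
  - rewrite Nat.even_even, !mix_even; auto.
  - rewrite Nat.even_succ, Nat.odd_even, Nat.div2_succ_double, !mix_odd, mix_even; auto.
Qed.

Lemma mix_ren_r (r p q : nat -> M) : (fun i => mev (mix r (mix p q)) (ren_r i)) = mix r q.
Proof.
  extensionality i. destruct (even_odd_cases i) as [j [-> | ->]]; unfold ren_r; cbn [mev].
  - rewrite Nat.even_even, !mix_even; auto.
  - rewrite Nat.even_succ, Nat.odd_even, Nat.div2_succ_double, !mix_odd; auto.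
Qed.

Lemma mev_ren_l r p q t : mev (mix r p) t = mev (mix r (mix p q)) (tsubst ren_l t) :> M.
Proof. now rewrite (proj1 (mev_subst _ _)), mix_ren_l. Qed.

Lemma mev_ren_r r p q t : mev (mix r q) t = mev (mix r (mix p q)) (tsubst ren_r t) :> M.
Proof. now rewrite (proj1 (mev_subst _ _)), mix_ren_r. Qed.

Lemma mevs_ren_r r p q n (ts : terms n) :
  mevs (mix r q) ts = mevs (mix r (mix p q)) (tssubst ren_r ts) :> list M.
Proof. now rewrite (proj2 (mev_subst _ _)), mix_ren_r. Qed.

Lemma msat_ren_l (r p q : nat -> M) a : msat (mix r p) a <-> msat (mix r (mix p q)) (fsubst ren_l a).
Proof. now rewrite msat_subst, mix_ren_l. Qed.

Lemma msat_ren_r (r p q : nat -> M) a : msat (mix r q) a <-> msat (mix r (mix p q)) (fsubst ren_r a).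
Proof. now rewrite msat_subst, mix_ren_r. Qed.

Lemma DT_const e (c : M) : DT e (fun _ => c).
Proof. exists (Var 1), (fun _ => c); intros x; reflexivity. Qed.

Lemma DT_var e i (c : M) : DT e (fun x => e x i).
Proof. exists (Var (2 * i)), (fun _ => c); intros x; cbn [mev]. now rewrite mix_even. Qed.

Lemma DT_fn n (f : PRF n) e (gs : list (X -> M)) :
  length gs = n -> Forall (DT e) gs -> DT e (fun x => fn f (map (fun g => g x) gs)).
Proof.
  intros L H.
  assert (exists (ts : terms n) p, forall x, mevs (mix (e x) p) ts = map (fun g => g x) gs) as (ts & p & E).
  { clear f; subst n; induction H as [|g gs [t [p Hg]] _ (ts & q & E)].
    - exists TNil, (fun _ => fn (PZ 0) []); auto.
    - exists (TCons (tsubst ren_l t) (tssubst ren_r ts)), (mix p q); intros x; simpl.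
      rewrite <- mev_ren_l, <- mevs_ren_r, Hg, E; auto. }
  exists (App f ts), p; intros x; simpl; now rewrite E.
Qed.

Lemma DT_ext e g g' : (forall x, g x = g' x) -> DT e g -> DT e g'.
Proof. intros E (t & p & H); exists t, p; intros x; rewrite <- E; auto. Qed.

Lemma DQ_eq K {HK : FormClass K} e g h : DT e g -> DT e h -> DQ K e (fun x => g x = h x).
Proof.
  intros (t & p & Hg) (u & q & Hh).
  exists (FEq (tsubst ren_l t) (tsubst ren_r u)), (mix p q); split; [apply fc_eq|].
  intros x; simpl; rewrite <- mev_ren_l, <- mev_ren_r, Hg, Hh; tauto.
Qed.

Lemma DQ_false K {HK : FormClass K} e (c : M) : DQ K e (fun _ => False).
Proof. exists FBot, (fun _ => c); split; [apply fc_bot|simpl; tauto]. Qed.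

Lemma DQ_imp K {HK : FormClass K} e P Q : DQ K e P -> DQ K e Q -> DQ K e (fun x => P x -> Q x).
Proof.
  intros (a & p & Ka & Ha) (b & q & Kb & Hb).
  exists (FImp (fsubst ren_l a) (fsubst ren_r b)), (mix p q); split; [apply fc_imp; apply fc_subst; auto|].
  intros x; simpl; rewrite <- msat_ren_l, <- msat_ren_r, Ha, Hb; tauto.
Qed.

Lemma DQ_and K {HK : FormClass K} e P Q : DQ K e P -> DQ K e Q -> DQ K e (fun x => P x /\ Q x).
Proof.
  intros (a & p & Ka & Ha) (b & q & Kb & Hb).
  exists (FAnd (fsubst ren_l a) (fsubst ren_r b)), (mix p q); split; [apply fc_and; apply fc_subst; auto|].
  intros x; simpl; rewrite <- msat_ren_l, <- msat_ren_r, Ha, Hb; tauto.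
Qed.

Lemma DQ_or K {HK : FormClass K} e P Q : DQ K e P -> DQ K e Q -> DQ K e (fun x => P x \/ Q x).
Proof.
  intros (a & p & Ka & Ha) (b & q & Kb & Hb).
  exists (FOr (fsubst ren_l a) (fsubst ren_r b)), (mix p q); split; [apply fc_or; apply fc_subst; auto|].
  intros x; simpl; rewrite <- msat_ren_l, <- msat_ren_r, Ha, Hb; tauto.
Qed.

Lemma DQ_ext K e P P' : (forall x, P x <-> P' x) -> DQ K e P -> DQ K e P'.
Proof. intros E (a & p & Ka & H); exists a, p; split; auto; intros x; rewrite <- E; auto. Qed.

Definition join_sub (s : nat -> term) (i : nat) : term :=
  if Nat.even i then tsubst ren_l (s (Nat.div2 i)) else ren_r i.

Lemma mev_join e (h : X -> nat -> M) s p q x : (forall x i, h x i = mev (mix (e x) p) (s i)) ->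
  (fun i => mev (mix (e x) (mix p q)) (join_sub s i)) = mix (h x) q.
Proof.
  intros H. extensionality i. unfold join_sub, mix at 3. destruct (Nat.even i) eqn:Ei.
  - rewrite <- mev_ren_l, H; auto.
  - assert (E := f_equal (fun f => f i) (mix_ren_r (e x) p q)); cbv beta in E. rewrite E.
    unfold mix; now rewrite Ei.
Qed.

Lemma DQ_comp K {HK : FormClass K} e h (Q : (nat -> M) -> Prop) :
  (exists a p, K a /\ forall r, Q r <-> msat (mix r p) a) -> DM e h -> DQ K e (fun x => Q (h x)).
Proof.
  intros (a & q & Ka & Hg) (s & p & Hh). exists (fsubst (join_sub s) a), (mix p q); split; [apply fc_subst; auto|].
  intros x; rewrite msat_subst, (mev_join e h); auto.
Qed.

Lemma DQ_comp1 K {HK : FormClass K} e (g : X -> M) (Q : M -> Prop) :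
  (exists a p, K a /\ forall y, Q y <-> msat (mix (fun _ => y) p) a) -> DT e g -> DQ K e (fun x => Q (g x)).
Proof.
  intros (a & q & Ka & Hg) (t & p & Hh). exists (fsubst (join_sub (fun _ => t)) a), (mix p q).
  split; [apply fc_subst; auto|].
  intros x; rewrite msat_subst, (mev_join e (fun x _ => g x)); auto.
Qed.

Lemma DM_const_fun e (g : X -> M) : DT e g -> DM e (fun x _ => g x).
Proof. intros (t & p & H); exists (fun _ => t), p; auto. Qed.

Definition upd (a : nat -> M) (i : nat) (v : M) : nat -> M := fun j => if j =? i then v else a j.

Lemma DM_upd e h i g : DM e h -> DT e g -> DM e (fun x => upd (h x) i (g x)).
Proof.
  intros (s & p & H) (t & q & Hg).
  exists (fun j => if j =? i then tsubst ren_r t else tsubst ren_l (s j)), (mix p q); intros x j.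
  unfold upd; destruct (j =? i); rewrite <- ?mev_ren_r, <- ?mev_ren_l; auto.
Qed.

Lemma DM_self e (c : M) : DM e e.
Proof. exists (fun i => Var (2 * i)), (fun _ => c); intros x i; cbn [mev]; now rewrite mix_even. Qed.
End Def.

Notation E1 := (fun y (_ : nat) => y).
Notation EV := (fun a : nat -> _ => a).

Definition add {M : Interp} (x y : M) : M := fn addP [x; y].
Definition mul {M : Interp} (x y : M) : M := fn mulP [x; y].
Definition pre {M : Interp} (x : M) : M := fn predP [x].
Definition sub {M : Interp} (x y : M) : M := fn subP [x; y].
Definition sg {M : Interp} (x : M) : M := fn sgP [x].
Definition nsg {M : Interp} (x : M) : M := fn nsgP [x].
Definition eqc {M : Interp} (x y : M) : M := fn eqcP [x; y].

Lemma DT_fn1 {M : Interp} {X} (e : X -> nat -> M) (f : PRF 1) g : DT e g -> DT e (fun x => fn f [g x]).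
Proof. intros H; apply (DT_fn 1 f e [g]); auto. Qed.

Lemma DT_fn2 {M : Interp} {X} (e : X -> nat -> M) (f : PRF 2) g h :
  DT e g -> DT e h -> DT e (fun x => fn f [g x; h x]).
Proof. intros H1 H2; apply (DT_fn 2 f e [g; h]); auto. Qed.

Lemma DT_fn3 {M : Interp} {X} (e : X -> nat -> M) (f : PRF 3) g h l :
  DT e g -> DT e h -> DT e l -> DT e (fun x => fn f [g x; h x; l x]).
Proof. intros H1 H2 H3; apply (DT_fn 3 f e [g; h; l]); auto. Qed.

Lemma DT_id1 {M : Interp} : DT (M:=M) E1 (fun y => y).
Proof. exists (Var 0), (fun _ => fn (PZ 0) []); reflexivity. Qed.

Ltac dstep :=
  match goal with
  | |- DQ ?K _ (fun x => _ = _) => apply (DQ_eq K)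
  | |- DQ ?K _ (fun x => _ /\ _) => apply (DQ_and K)
  | |- DQ ?K _ (fun x => _ \/ _) => apply (DQ_or K)
  | |- DQ ?K _ (fun x => False) => apply (DQ_false K _ zero)
  | |- DQ ?K _ (fun x => ~ _) => apply (DQ_imp K)
  | |- DQ ?K _ (fun x => _ <> _) => apply (DQ_imp K)
  | |- DQ ?K _ (fun x => _ -> _) => apply (DQ_imp K)
  | |- DT _ (fun x => _) => first [ exact (DT_const _ _) | exact DT_id1 | assumption
      | apply (DT_var EV _ zero)
      | match goal with
        | |- DT _ (fun x => fn _ [_]) => apply DT_fn1
        | |- DT _ (fun x => fn _ [_; _]) => apply DT_fn2
        | |- DT _ (fun x => fn _ [_; _; _]) => apply DT_fn3
        | |- DT _ (fun x => su _) => apply DT_fn1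
        | |- DT _ (fun x => pre _) => apply DT_fn1
        | |- DT _ (fun x => sg _) => apply DT_fn1
        | |- DT _ (fun x => nsg _) => apply DT_fn1
        | |- DT _ (fun x => add _ _) => apply DT_fn2
        | |- DT _ (fun x => mul _ _) => apply DT_fn2
        | |- DT _ (fun x => sub _ _) => apply DT_fn2
        | |- DT _ (fun x => eqc _ _) => apply DT_fn2
        end ]
  | |- DT _ (?f ?c) => apply (DT_fn2 _ _ (fun _ => c) (fun x => x) (DT_const _ _) DT_id1)
  | |- DT _ ?f => apply (DT_fn1 _ _ (fun x => x) DT_id1)
  end.
Ltac dtac := repeat dstep.

(** Translates to the format of the schemata, with the distinguished element in variable 0 and the
    parameters above it. Under [E1] all even variables have the same value, so they may be
    merged. *)
Lemma DQ_scons {M : Interp} K {HK : FormClass K} (P : M -> Prop) : DQ K E1 P ->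
  exists a p, K a /\ forall y, P y <-> msat (scons y p) a.
Proof.
  intros (a & p & Ka & H).
  exists (fsubst (fun i => if Nat.even i then Var 0 else Var (S (Nat.div2 i))) a), p.
  split; [apply fc_subst; auto|]. intros y. rewrite H, msat_subst.
  match goal with |- msat ?u _ <-> msat ?v _ => replace v with u; [tauto|] end.
  extensionality i. unfold mix. destruct (Nat.even i); auto.
Qed.

Lemma DQ_exl {M : Interp} K {HK : FormClass K} (A : nat -> M -> Prop) l : (forall j, DQ K E1 (A j)) ->
  DQ K E1 (fun x => exists j, In j l /\ A j x).
Proof.
  intros H. induction l as [|j l IH].
  - eapply DQ_ext; [|apply (DQ_false K E1 zero)]. intros x; split; [tauto|intros (j & [] & _)].
  - eapply DQ_ext; [|apply (DQ_or K E1 _ _ (H j) IH)]. intros x; split.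
    + intros [Hx|(j' & Hj & Hx)]; [exists j|exists j']; simpl; auto.
    + intros (j' & [<-|Hj] & Hx); eauto.
Qed.

(** * Arithmetic in a model of PRA *)

Section Arith.
Context {M : Interp} {HM : PRA M}.
Implicit Types x y z : M.

Lemma ind (P : M -> Prop) : DQ QF E1 P -> P zero -> (forall y, P y -> P (su y)) -> forall y, P y.
Proof.
  intros D H0 HS. destruct (DQ_scons QF P D) as (a & p & Qa & E).
  intros y. apply E. apply pra_ind.
  - auto.
  - apply E; auto.
  - intros z Hz. apply E, HS, E; auto.
Qed.

Lemma fn_c1 n g (f : PRF n) (xs : list M) : length xs = n -> fn (c1 g f) xs = fn g [fn f xs].
Proof. intros L. unfold c1. rewrite pra_C; auto. Qed.

Lemma fn_c2 n g (f h : PRF n) (xs : list M) : length xs = n -> fn (c2 g f h) xs = fn g [fn f xs; fn h xs].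
Proof. intros L. unfold c2. rewrite pra_C; auto. Qed.

Lemma pre_0 : pre (@zero M) = zero.
Proof. unfold pre, predP. rewrite pra_R0, pra_Z; auto. Qed.
Lemma pre_S x : pre (su x) = x.
Proof. unfold pre, predP. rewrite pra_RS; auto. unfold proj; simpl. rewrite pra_P; auto. Qed.
Lemma add_0_l x : add zero x = x.
Proof. unfold add, addP. rewrite pra_R0; auto. unfold proj; simpl. rewrite pra_P; auto. Qed.
Lemma add_S_l x y : add (su x) y = su (add x y).
Proof. unfold add, addP. rewrite pra_RS; auto. unfold c1; rewrite pra_C; auto. simpl. unfold proj; simpl. rewrite pra_P; auto. Qed.
Lemma mul_0_l x : mul zero x = zero.
Proof. unfold mul, mulP. rewrite pra_R0, pra_Z; auto. Qed.
Lemma mul_S_l x y : mul (su x) y = add (mul x y) y.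
Proof. unfold mul, mulP. rewrite pra_RS; auto. unfold c2; rewrite pra_C; auto. simpl. unfold proj; simpl. rewrite !pra_P; auto. Qed.
Lemma sub_0_r x : sub x zero = x.
Proof.
  unfold sub, subP, c2. rewrite pra_C; auto. simpl. unfold proj; simpl. rewrite !pra_P; auto. simpl.
  unfold rsubP; rewrite pra_R0; auto. unfold proj; simpl. rewrite pra_P; auto.
Qed.
Lemma sub_S_r x y : sub x (su y) = pre (sub x y).
Proof.
  unfold sub, subP, c2. rewrite !pra_C; auto. simpl. unfold proj; simpl. rewrite !pra_P; auto. simpl.
  unfold rsubP; rewrite pra_RS; auto. unfold c1; rewrite pra_C; auto. simpl. unfold proj; simpl. rewrite pra_P; auto.
Qed.

Lemma case0 x : x = zero \/ x = su (pre x).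
Proof. revert x; apply ind; [dtac|auto|]. intros y _; right; now rewrite pre_S. Qed.

Lemma casex x : x = zero \/ exists y, x = su y.
Proof. destruct (case0 x); eauto. Qed.

Lemma sub_SS x y : sub (su x) (su y) = sub x y.
Proof.
  revert y; apply ind; [dtac| |].
  - now rewrite sub_S_r, !sub_0_r, pre_S.
  - intros y IH. rewrite sub_S_r, IH, sub_S_r; auto.
Qed.

Lemma sub_0_l x : sub zero x = zero.
Proof. revert x; apply ind; [dtac|apply sub_0_r|]. intros y IH; now rewrite sub_S_r, IH, pre_0. Qed.

Lemma add_0_r x : add x zero = x.
Proof. revert x; apply ind; [dtac|apply add_0_l|]. intros y IH; now rewrite add_S_l, IH. Qed.
Lemma add_S_r x y : add x (su y) = su (add x y).
Proof. revert x; apply ind; [dtac|now rewrite !add_0_l|]. intros z IH; now rewrite !add_S_l, IH. Qed.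
Lemma add_comm x y : add x y = add y x.
Proof. revert x; apply ind; [dtac|now rewrite add_0_l, add_0_r|]. intros z IH; now rewrite add_S_l, add_S_r, IH. Qed.
Lemma add_assoc x y z : add x (add y z) = add (add x y) z.
Proof. revert x; apply ind; [dtac|now rewrite !add_0_l|]. intros w IH; now rewrite !add_S_l, IH. Qed.
Lemma mul_0_r x : mul x zero = zero.
Proof. revert x; apply ind; [dtac|apply mul_0_l|]. intros y IH; now rewrite mul_S_l, IH, add_0_l. Qed.
Lemma mul_S_r x y : mul x (su y) = add (mul x y) x.
Proof.
  revert x; apply ind; [dtac|now rewrite !mul_0_l, add_0_l|].
  intros z IH. rewrite !mul_S_l, IH, !add_S_r, <- !add_assoc. now rewrite (add_comm z y).
Qed.
Lemma mul_comm x y : mul x y = mul y x.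
Proof. revert x; apply ind; [dtac|now rewrite mul_0_l, mul_0_r|]. intros z IH; now rewrite mul_S_l, mul_S_r, IH. Qed.
Lemma mul_add_l x y z : mul (add x y) z = add (mul x z) (mul y z).
Proof.
  revert x; apply ind; [dtac|now rewrite mul_0_l, !add_0_l|].
  intros w IH. rewrite add_S_l, !mul_S_l, IH, <- !add_assoc. now rewrite (add_comm z).
Qed.
Lemma mul_assoc x y z : mul x (mul y z) = mul (mul x y) z.
Proof.
  revert x; apply ind; [dtac|now rewrite !mul_0_l|].
  intros w IH. now rewrite !mul_S_l, IH, mul_add_l.
Qed.
Lemma mul_1_l x : mul (su zero) x = x.
Proof. now rewrite mul_S_l, mul_0_l, add_0_l. Qed.

Lemma Msrt : semi_ring_theory (@zero M) (su zero) add mul eq.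
Proof.
  constructor; auto using add_0_l, add_comm, add_assoc, mul_1_l, mul_0_l, mul_comm, mul_assoc, mul_add_l.
Qed.
Add Ring Mring : Msrt.

Lemma su_add1 x : su x = add x (su zero).
Proof. now rewrite add_S_r, add_0_r. Qed.

Lemma sub_add x y : sub (add x y) x = y.
Proof. revert x; apply ind; [dtac|now rewrite add_0_l, sub_0_r|]. intros z IH; now rewrite add_S_l, sub_SS. Qed.

Lemma sub_add_0 x y : sub x (add x y) = zero.
Proof. revert x; apply ind; [dtac|now rewrite add_0_l, sub_0_l|]. intros z IH; now rewrite add_S_l, sub_SS. Qed.

Lemma add_cancel_l x y z : add x y = add x z -> y = z.
Proof. intros H; rewrite <- (sub_add x y), H; apply sub_add. Qed.

Lemma add_cancel_r x y z : add y x = add z x -> y = z.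
Proof. rewrite !(add_comm _ x); apply add_cancel_l. Qed.

(** Comparability in quantifier-free form: the truncated difference itself is the witness, since
    induction does not cover existential statements. *)
Lemma sub_cases x y : (sub y x = zero /\ x = add y (sub x y)) \/ y = add x (sub y x).
Proof.
  revert x; apply ind; [dtac| |].
  - right. now rewrite sub_0_r, add_0_l.
  - intros x [[H E]|E].
    + left. rewrite sub_S_r, H, pre_0. split; auto.
      rewrite E at 2. rewrite <- add_S_r, sub_add, add_S_r. congruence.
    + destruct (casex (sub y x)) as [Z|[d D]].
      * rewrite Z, add_0_r in E; subst y. left. rewrite sub_S_r, Z, pre_0; split; auto.
        rewrite su_add1 at 2. rewrite sub_add. apply su_add1.
      * right. rewrite sub_S_r, D, pre_S. rewrite E at 1. rewrite D, add_S_l, add_S_r; auto.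
Qed.

Definition le x y : Prop := sub x y = zero.

Lemma le_ex x y : le x y <-> exists d, y = add x d.
Proof.
  unfold le; split.
  - intros H. destruct (sub_cases x y) as [[H' E]|E]; eauto.
    exists zero. rewrite E, H. now rewrite !add_0_r.
  - intros [d ->]; apply sub_add_0.
Qed.

Lemma le_total x y : le x y \/ le y x.
Proof. destruct (sub_cases x y) as [[H' E]|E]; [right|left]; apply le_ex; eauto. Qed.

Lemma add_eq_0 x y : add x y = zero -> x = zero /\ y = zero.
Proof.
  destruct (casex x) as [->|[z ->]].
  - rewrite add_0_l; auto.
  - rewrite add_S_l; intros H; now apply pra_S1 in H.
Qed.

Lemma lt_cases x y : le (su x) y \/ le y x.
Proof.
  destruct (le_total x y) as [H|H]; auto. apply le_ex in H as [d ->].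
  destruct (casex d) as [->|[e ->]].
  - right; apply le_ex; exists zero; ring.
  - left; apply le_ex; exists e. now rewrite add_S_r, add_S_l.
Qed.

Lemma lt_not_le x y : le (su x) y -> le y x -> False.
Proof.
  intros H H'. apply le_ex in H as [d ->]; apply le_ex in H' as [e E].
  apply (pra_S1 (add d e)). apply (add_cancel_l x). rewrite add_0_r. rewrite E at 2.
  rewrite !add_S_l, add_S_r. now rewrite add_assoc.
Qed.

Lemma le_trans x y z : le x y -> le y z -> le x z.
Proof.
  intros H H'. apply le_ex in H as [d ->]; apply le_ex in H' as [e ->]; apply le_ex.
  exists (add d e); ring.
Qed.

Lemma le_refl x : le x x.
Proof. apply le_ex; exists zero; now rewrite add_0_r. Qed.

Lemma le_su x : le x (su x).
Proof. apply le_ex; exists (su zero); apply su_add1. Qed.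

Fixpoint num (n : nat) : M := match n with O => zero | S n => su (num n) end.

Lemma num_add a b : num (a + b) = add (num a) (num b).
Proof. induction a; simpl; [now rewrite add_0_l|now rewrite add_S_l, IHa]. Qed.

Lemma num_mul a b : num (a * b) = mul (num a) (num b).
Proof. induction a; simpl; [now rewrite mul_0_l|rewrite mul_S_l, num_add, IHa; apply add_comm]. Qed.

Lemma num_inj a b : num a = num b -> a = b.
Proof.
  revert b; induction a; intros [|b]; simpl; intros H; auto.
  - symmetry in H; now apply pra_S1 in H.
  - now apply pra_S1 in H.
  - f_equal; apply IHa, pra_S2, H.
Qed.

Lemma lt_num x k : le (su x) (num k) -> exists j, j < k /\ x = num j.
Proof.
  revert x; induction k as [|k IH]; intros x H; simpl in H.
  - exfalso. unfold le in H. rewrite sub_0_r in H. now apply pra_S1 in H.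
  - unfold le in H; rewrite sub_SS in H. destruct (casex x) as [->|[y ->]].
    + exists 0; split; auto; lia.
    + destruct (IH y H) as (j & Hj & ->). exists (S j); split; auto; lia.
Qed.

(** Standard computations come out the same in every model. This evaluates the finite transition
    tables of the automaton on the numerals of a nonstandard model. *)
Lemma fn_num :
  (forall n (f : PRF n) xs, length xs = n -> fn f (map num xs) = num (eval f xs)) /\
  (forall n m (hs : PRFs n m) xs, length xs = n -> fns hs (map num xs) = map num (evals hs xs)).
Proof.
  apply PRF_PRFs_ind.
  - intros n xs L. rewrite pra_Z; auto. now rewrite length_map.
  - intros [|x [|]] L; try discriminate. reflexivity.
  - intros n i e xs L. rewrite pra_P; [|now rewrite length_map]. apply (map_nth num xs 0 i).
  - intros n m g IHg hs IHhs xs L. rewrite pra_C; [|now rewrite length_map]. rewrite IHhs; auto. apply IHg.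
    clear. induction hs; simpl; auto.
  - intros n g IHg h IHh [|y xs] L; try discriminate. injection L as L.
    induction y as [|y IH]; cbn [map num].
    + rewrite pra_R0; [|now rewrite length_map]. rewrite IHg; auto.
    + rewrite pra_RS; [|now rewrite length_map]. cbn [map] in IH. rewrite IH.
      change (num y :: num (eval (PR n g h) (y :: xs)) :: map num xs) with
        (map num (y :: eval (PR n g h) (y :: xs) :: xs)). rewrite IHh; [|simpl; congruence]. reflexivity.
  - intros; reflexivity.
  - intros n m h IHh hs IHhs xs L; simpl. rewrite IHh, IHhs; auto.
Qed.

Lemma nsg_0 : nsg (@zero M) = su zero.
Proof.
  unfold nsg, nsgP, c2. rewrite pra_C; auto. simpl. unfold proj; simpl. rewrite pra_P; auto. simpl.
  unfold c1. rewrite pra_C; auto. simpl. rewrite pra_Z; auto. apply sub_0_r.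
Qed.
Lemma nsg_S x : nsg (su x) = zero.
Proof.
  unfold nsg, nsgP, c2. rewrite pra_C; auto. simpl. unfold proj; simpl. rewrite pra_P; auto. simpl.
  unfold c1. rewrite pra_C; auto. simpl. rewrite pra_Z; auto.
  change (sub (su zero) (su x) = zero). rewrite sub_SS. apply sub_0_l.
Qed.
Lemma sg_0 : sg (@zero M) = zero.
Proof.
  unfold sg, sgP, c1. rewrite pra_C; auto. simpl. change (nsg (nsg (@zero M)) = zero).
  rewrite nsg_0. apply nsg_S.
Qed.
Lemma sg_S x : sg (su x) = su zero.
Proof.
  unfold sg, sgP, c1. rewrite pra_C; auto. simpl. change (nsg (nsg (su x)) = su zero).
  rewrite nsg_S. apply nsg_0.
Qed.

Lemma constP_val n c (xs : list M) : length xs = n -> fn (constP n c) xs = num c.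
Proof.
  intros L. induction c; simpl; [apply pra_Z; auto|].
  unfold c1. rewrite pra_C; auto. simpl. rewrite IHc. reflexivity.
Qed.

Lemma iteP_val n (c a b : PRF n) (xs : list M) : length xs = n ->
  (fn c xs = zero -> fn (iteP c a b) xs = fn b xs) /\
  (fn c xs <> zero -> fn (iteP c a b) xs = fn a xs).
Proof.
  intros L. unfold iteP, c2, c1. rewrite pra_C; auto. simpl. rewrite !pra_C; auto. simpl.
  rewrite !pra_C; auto. simpl.
  change ((fn c xs = zero -> add (mul (sg (fn c xs)) (fn a xs)) (mul (nsg (fn c xs)) (fn b xs)) = fn b xs) /\
    (fn c xs <> zero -> add (mul (sg (fn c xs)) (fn a xs)) (mul (nsg (fn c xs)) (fn b xs)) = fn a xs)).
  split; intros H.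
  - rewrite H, sg_0, nsg_0. ring.
  - destruct (casex (fn c xs)) as [|[y ->]]; [contradiction|]. rewrite sg_S, nsg_S. ring.
Qed.
End Arith.

(** * Bounded quantifiers *)

(** Transfinite induction for the complement of B, which is progressive when each element of B has
    an R-smaller one in B. *)
Lemma TI_descent {M : Interp} R : TIsem M R ->
  forall B : M -> Prop, DQ Delta0 E1 B -> (forall z, B z -> exists z', R z' z /\ B z') -> forall z, ~ B z.
Proof.
  intros TI B D HB. destruct (DQ_scons Delta0 B D) as (a & p & Da & E).
  intros z Hz. cut (msat (scons z p) (FNot a)); [simpl; rewrite <- E; auto|]. clear Hz; revert z.
  apply TI; [apply d0_imp; [auto|constructor]|].
  intros x Hx. simpl in *. rewrite <- E. intros Bx. destruct (HB x Bx) as (y & Ry & By).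
  apply (Hx y Ry). apply E, By.
Qed.

Lemma mev_shiftT {M : Interp} (d : M) rho t : mev (scons d rho) (shiftT t) = mev rho t.
Proof. unfold shiftT. rewrite (proj1 (trename_tsubst S)), (proj1 (mev_subst _ _)). reflexivity. Qed.

Lemma DQ_bex {M : Interp} (P : (nat -> M) -> Prop) g :
  DQ Delta0 EV P -> DT EV g -> DQ Delta0 EV (fun a => exists y, le (su y) (g a) /\ P (scons y a)).
Proof.
  intros (a & q & Da & H) (t & p & Ht).
  (* Below the quantifier, [Var 0] is the bound element and all variables of the outer [mix] are
     shifted by one. The parameters of [a] are the right half of [mix p q]. *)
  set (s := fun i => if Nat.even i then match Nat.div2 i with O => Var 0 | S j => Var (S (2 * j)) end
                     else Var (S (S (2 * S (2 * Nat.div2 i))))).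
  exists (FEx (FAnd (Lt (Var 0) (shiftT (tsubst ren_l t))) (fsubst s a))), (mix p q); split.
  - apply d0_bex, fc_subst; auto.
  - intros r. simpl. setoid_rewrite mev_shiftT. setoid_rewrite <- mev_ren_l. rewrite <- Ht.
    setoid_rewrite msat_subst.
    assert (E : forall d, (fun i => mev (scons d (mix r (mix p q))) (s i)) = mix (scons d r) q).
    { intros d; extensionality i. destruct (even_odd_cases i) as [j [-> | ->]]; unfold s.
      - rewrite Nat.even_even, Nat.div2_double, mix_even. destruct j as [|j]; cbn [mev scons]; auto. now rewrite mix_even.
      - rewrite Nat.even_succ, Nat.odd_even, Nat.div2_succ_double. cbn [mev scons]. now rewrite !mix_odd. }
    split; intros [d [H1 H2]]; exists d; split; auto.
    + rewrite E; apply H; auto.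
    + rewrite E in H2; apply H; auto.
Qed.

(** Serves to quantify over the contents of all registers at once. Variable j carries the bound;
    each quantifier moves it up by one place, so the induction proceeds with [S j]. *)
Lemma DQ_bexs {M : Interp} m : forall (F : (nat -> M) -> Prop) j, DQ Delta0 EV F ->
  DQ Delta0 EV (fun a => exists l, length l = m /\ Forall (fun y => le (su y) (su (a j))) l /\ F (lenv l a)).
Proof.
  induction m as [|m IH]; intros F j HF.
  - eapply DQ_ext; [|exact HF]. intros a; split.
    + intros H; exists []; auto.
    + intros (l & L & _ & H); destruct l; [auto|discriminate].
  - assert (D : DT EV (fun a : nat -> M => su (a j))) by dtac.
    eapply DQ_ext; [|exact (DQ_bex _ _ (IH F (S j) HF) D)].
    intros a; split.
    + intros (y & Hy & l & L & Hl & H). exists (l ++ [y]). rewrite length_app, lenv_app; simpl.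
      repeat split; auto; [lia|]. apply Forall_app; auto.
    + intros (l & L & Hl & H). destruct (@exists_last _ l) as (l' & d & ->); [intros ->; discriminate|].
      rewrite length_app in L; simpl in L. rewrite lenv_app in H; simpl in H.
      apply Forall_app in Hl as [Hl Hd]. inversion Hd; subst.
      exists d; split; auto. exists l'; repeat split; auto; lia.
Qed.

(** * Bounded quantifiers as primitive recursive sums and products *)

Fixpoint projs (N i n : nat) : PRFs N n :=
  match n with O => PNil N | S n' => PCons (proj N i) (projs N (S i) n') end.

Section Model.
Context {M : Interp} {HM : PRA M}.

Lemma proj_val n i (xs : list M) : length xs = n -> i < n -> fn (proj n i) xs = nth i xs zero.
Proof.
  intros L H. unfold proj. generalize (eq_refl (i <? n)).
  generalize (i <? n) at 2 3. intros [|] e; [apply pra_P; auto|]. apply Nat.ltb_ge in e; lia.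
Qed.

Lemma projs_val (ys : list M) n : forall i xs, length (xs ++ ys) = n -> i = length xs ->
  fns (projs n i (length ys)) (xs ++ ys) = ys.
Proof.
  induction ys as [|y ys IH]; intros i xs L ->; simpl; auto. f_equal.
  - rewrite proj_val; auto; [|rewrite length_app in L; simpl in L; lia].
    rewrite app_nth2; auto. now rewrite Nat.sub_diag.
  - specialize (IH (length (xs ++ [y])) (xs ++ [y])). rewrite <- app_assoc in IH. simpl in IH.
    rewrite (length_app xs [y]) in IH. cbn [length] in IH. rewrite Nat.add_1_r in IH. apply IH; auto.
Qed.
End Model.

(** With zero for truth, a sum over all v below y is zero when all its terms are, a product when one
    of its factors is; these functions therefore replace the bounded quantifiers. *)
Definition sumB (n : nat) (f : PRF (S n)) : PRF (S n) :=
  PR n (PZ n) (c2 addP (proj (S (S n)) 1) (PC (S (S n)) (S n) f (PCons (proj (S (S n)) 0) (projs (S (S n)) 2 n)))).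
Definition prodB (n : nat) (f : PRF (S n)) : PRF (S n) :=
  PR n (constP n 1) (c2 mulP (proj (S (S n)) 1) (PC (S (S n)) (S n) f (PCons (proj (S (S n)) 0) (projs (S (S n)) 2 n)))).

Section Bounded.
Context {M : Interp} {HM : PRA M}.
Implicit Types xs : list M.
Add Ring Mring3 : (@Msrt M HM).

Lemma step_args n (f : PRF (S n)) y z xs : length xs = n ->
  fn (PC (S (S n)) (S n) f (PCons (proj (S (S n)) 0) (projs (S (S n)) 2 n))) (y :: z :: xs) = fn f (y :: xs).
Proof.
  intros L. rewrite pra_C; [|simpl; lia]. simpl. rewrite proj_val; [|simpl; lia|lia]. simpl. subst n.
  f_equal; f_equal. apply (projs_val xs (S (S (length xs))) 2 [y; z]); auto.
Qed.

Lemma sumB_0 n f xs : length xs = n -> fn (sumB n f) (zero :: xs) = zero.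
Proof. intros L; unfold sumB. rewrite pra_R0, pra_Z; auto. Qed.

Lemma sumB_S n f y xs : length xs = n ->
  fn (sumB n f) (su y :: xs) = add (fn (sumB n f) (y :: xs)) (fn f (y :: xs)).
Proof.
  intros L; unfold sumB at 1. rewrite pra_RS; auto. fold (sumB n f). unfold c2. rewrite pra_C; [|simpl; lia].
  simpl. rewrite proj_val; [|simpl; lia|lia]. simpl. rewrite step_args; auto.
Qed.

Lemma prodB_0 n f xs : length xs = n -> fn (prodB n f) (zero :: xs) = su zero.
Proof. intros L; unfold prodB. rewrite pra_R0, constP_val; auto. Qed.

Lemma prodB_S n f y xs : length xs = n ->
  fn (prodB n f) (su y :: xs) = mul (fn (prodB n f) (y :: xs)) (fn f (y :: xs)).
Proof.
  intros L; unfold prodB at 1. rewrite pra_RS; auto. fold (prodB n f). unfold c2. rewrite pra_C; [|simpl; lia].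
  simpl. rewrite proj_val; [|simpl; lia|lia]. simpl. rewrite step_args; auto.
Qed.

Lemma mul_eq_0 (x y : M) : mul x y = zero <-> x = zero \/ y = zero.
Proof.
  split.
  - intros H. destruct (casex x) as [|[u ->]]; auto. destruct (casex y) as [|[v ->]]; auto.
    exfalso. rewrite mul_S_l, add_S_r in H. now apply pra_S1 in H.
  - intros [-> | ->]; [apply mul_0_l|apply mul_0_r].
Qed.

Lemma DT_cons_list n (f : PRF (S n)) xs : length xs = n -> DT E1 (fun y => fn f (y :: xs)).
Proof.
  intros L.
  eapply DT_ext; [|apply (DT_fn (S n) f E1 ((fun y => y) :: map (fun c _ => c) xs))].
  - intros y. simpl. now rewrite map_map, map_id.
  - simpl; now rewrite length_map, L.
  - constructor; [apply DT_id1|]. apply Forall_forall. intros g Hg. apply in_map_iff in Hg as (c & <- & _). apply DT_const.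
Qed.

Lemma le_su_cases (v y : M) : le (su v) (su y) -> le (su v) y \/ v = y.
Proof.
  unfold le. rewrite sub_SS. intros H. apply le_ex in H as [d ->]. destruct (casex d) as [->|[u ->]].
  - right; ring.
  - left. rewrite add_S_r. fold (le (su v) (su (add v u))). apply le_ex. exists u. now rewrite add_S_l.
Qed.

Lemma not_lt_0 (v : M) : ~ le (su v) zero.
Proof. unfold le. rewrite sub_0_r. apply pra_S1. Qed.

Lemma sumB_zero n f y xs : length xs = n ->
  (fn (sumB n f) (y :: xs) = zero <-> forall v, le (su v) y -> fn f (v :: xs) = zero).
Proof.
  intros L. split.
  - intros H v Hv. revert y Hv H.
    apply (ind (fun y => le (su v) y -> fn (sumB n f) (y :: xs) = zero -> fn f (v :: xs) = zero)).
    + unfold le. dtac. apply DT_cons_list; auto.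
    + intros H; now apply not_lt_0 in H.
    + intros y IH Hv. rewrite sumB_S; auto. intros H. apply add_eq_0 in H as [H1 H2].
      apply le_su_cases in Hv as [Hv | ->]; auto.
  - intros H. assert (G : forall z, le z y -> fn (sumB n f) (z :: xs) = zero).
    { apply (ind (fun z => le z y -> fn (sumB n f) (z :: xs) = zero)).
      - unfold le. dtac. apply DT_cons_list; auto.
      - intros _; apply sumB_0; auto.
      - intros z IH Hz. rewrite sumB_S; auto. rewrite IH, H, add_0_l; auto.
        eapply le_trans; [apply le_su|exact Hz]. }
    apply G, le_refl.
Qed.

Lemma prodB_zero n f y xs : length xs = n ->
  (fn (prodB n f) (y :: xs) = zero <-> exists v, le (su v) y /\ fn f (v :: xs) = zero).
Proof.
  intros L. split.
  (* The existence of a zero factor is no quantifier-free property, so the induction shows instead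
     that without one every partial product is nonzero. *)
  - intros H. apply NNPP; intros N.
    assert (G : forall z, le z y -> fn (prodB n f) (z :: xs) <> zero).
    { apply (ind (fun z => le z y -> fn (prodB n f) (z :: xs) <> zero)).
      - unfold le. dtac. apply DT_cons_list; auto.
      - intros _; rewrite prodB_0; auto. apply pra_S1.
      - intros z IH Hz. rewrite prodB_S; auto. rewrite mul_eq_0. intros [E|E].
        + revert E; apply IH. eapply le_trans; [apply le_su|exact Hz].
        + eauto. }
    apply (G y (le_refl y) H).
  - intros (v & Hv & Hf). revert y Hv.
    apply (ind (fun y => le (su v) y -> fn (prodB n f) (y :: xs) = zero)).
    + unfold le. dtac. apply DT_cons_list; auto.
    + intros H; now apply not_lt_0 in H.
    + intros y IH Hv. rewrite prodB_S; auto. apply mul_eq_0.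
      apply le_su_cases in Hv as [Hv | ->]; auto.
Qed.

Lemma nsg_zero (x : M) : nsg x = zero <-> x <> zero.
Proof.
  destruct (casex x) as [->|[u ->]].
  - rewrite nsg_0. split; [intros H; now apply pra_S1 in H|tauto].
  - rewrite nsg_S. split; auto. intros _; apply pra_S1.
Qed.

Lemma sub_sub_zero (x y : M) : add (sub x y) (sub y x) = zero <-> x = y.
Proof.
  split.
  - intros H. apply add_eq_0 in H as [H1 H2]. destruct (sub_cases x y) as [[H E]|E]; rewrite E.
    + rewrite H1. ring.
    + rewrite H2. ring.
  - intros ->. rewrite <- (add_0_r y) at 2 3. rewrite sub_add_0, sub_add. ring.
Qed.
End Bounded.

Lemma tfv_shift k : (forall t, tfv (S k) (trename S t) -> tfv k t) /\
  (forall n (ts : terms n), tsfv (S k) (tsrename S ts) -> tsfv k ts).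
Proof. apply term_terms_ind; simpl; intros; auto; try lia. intuition. Qed.

Lemma term_PRF n :
  (forall t, tfv n t -> exists f : PRF n, forall (M : Interp) (HM : PRA M) (rho : nat -> M) xs,
     length xs = n -> fn f xs = mev (lenv xs rho) t) /\
  (forall m (ts : terms m), tsfv n ts -> exists hs : PRFs n m, forall (M : Interp) (HM : PRA M) (rho : nat -> M) xs,
     length xs = n -> fns hs xs = mevs (lenv xs rho) ts).
Proof.
  apply term_terms_ind; simpl.
  - intros i Hi. exists (proj n i). intros M HM rho xs L. rewrite proj_val; auto.
    symmetry; apply nth_lenv; lia.
  - intros m f ts IH F. destruct (IH F) as [hs H]. exists (PC n m f hs). intros M HM rho xs L.
    rewrite pra_C; auto. f_equal; auto.
  - intros _. exists (PNil n); auto.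
  - intros m t IHt ts IHts [F1 F2]. destruct (IHt F1) as [h Hh], (IHts F2) as [hs Hhs].
    exists (PCons h hs). intros M HM rho xs L. simpl. f_equal; auto.
Qed.

(** Truth is coded by zero: conjunction becomes addition, disjunction multiplication, and
    implication multiplication by the negated sign of the premise. The function is chosen before the
    model, so one [f] serves the standard model and all others. *)
Lemma Delta0_PRF a : Delta0 a -> forall n, ffv n a ->
  exists f : PRF n, forall (M : Interp) (HM : PRA M) (rho : nat -> M) xs,
    length xs = n -> (fn f xs = zero <-> msat (lenv xs rho) a).
Proof.
  assert (B : forall n (f : PRF n) (g : PRF (S n)) (M : Interp) (HM : PRA M) (xs : list M), length xs = n ->
     fn (PC n (S n) g (PCons f (projs n 0 n))) xs = fn g (fn f xs :: xs)).
  { intros n f g M HM xs L. rewrite pra_C; auto. simpl. subst n. f_equal; f_equal. apply (projs_val xs (length xs) 0 []); auto. }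
  induction 1 as [s t| |a b _ IHa _ IHb|a b _ IHa _ IHb|a b _ IHa _ IHb|t a _ IHa|t a _ IHa]; intros n F.
  - destruct F as [F1 F2]. destruct (proj1 (term_PRF n) s F1) as [f Hf], (proj1 (term_PRF n) t F2) as [g Hg].
    exists (c2 addP (c2 subP f g) (c2 subP g f)). intros M HM rho xs L. rewrite !fn_c2; auto.
    simpl. rewrite <- Hf, <- Hg; auto. apply sub_sub_zero.
  - exists (constP n 1). intros M HM rho xs L. rewrite constP_val; auto. simpl. split; [apply pra_S1|tauto].
  - destruct F as [F1 F2]. destruct (IHa n F1) as [f Hf], (IHb n F2) as [g Hg].
    exists (c2 mulP (c1 nsgP f) g). intros M HM rho xs L. rewrite fn_c2, fn_c1; auto. simpl.
    rewrite <- Hf, <- Hg; auto. change (mul (nsg (fn f xs)) (fn g xs) = zero <-> (fn f xs = zero -> fn g xs = zero)).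
    rewrite mul_eq_0, nsg_zero. tauto.
  - destruct F as [F1 F2]. destruct (IHa n F1) as [f Hf], (IHb n F2) as [g Hg].
    exists (c2 addP f g). intros M HM rho xs L. rewrite fn_c2; auto. simpl.
    rewrite <- Hf, <- Hg; auto. change (add (fn f xs) (fn g xs) = zero <-> (fn f xs = zero /\ fn g xs = zero)).
    split; [apply add_eq_0|intros [-> ->]; apply add_0_l].
  - destruct F as [F1 F2]. destruct (IHa n F1) as [f Hf], (IHb n F2) as [g Hg].
    exists (c2 mulP f g). intros M HM rho xs L. rewrite fn_c2; auto. simpl.
    rewrite <- Hf, <- Hg; auto. apply mul_eq_0.
  - destruct F as [[[_ [F _]] _] F2]. apply tfv_shift in F.
    destruct (proj1 (term_PRF n) t F) as [f Hf], (IHa (S n) F2) as [g Hg].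
    exists (PC n (S n) (sumB n g) (PCons f (projs n 0 n))). intros M HM rho xs L. rewrite B; auto.
    rewrite sumB_zero; auto. simpl. setoid_rewrite mev_shiftT. rewrite <- Hf; auto.
    split; intros H v Hv; apply (Hg M HM rho (v :: xs)); try (simpl; congruence); apply H, Hv.
  - destruct F as [[[_ [F _]] _] F2]. apply tfv_shift in F.
    destruct (proj1 (term_PRF n) t F) as [f Hf], (IHa (S n) F2) as [g Hg].
    exists (PC n (S n) (prodB n g) (PCons f (projs n 0 n))). intros M HM rho xs L. rewrite B; auto.
    rewrite prodB_zero; auto. simpl. setoid_rewrite mev_shiftT. rewrite <- Hf; auto.
    split; intros [v [Hv H]]; exists v; (split; [exact Hv|]); apply (Hg M HM rho (v :: xs)); auto; simpl; congruence.
Qed.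

(** * Division with remainder by a standard number *)

Definition modk {M : Interp} (k : nat) (x : M) : M := fn (modkP k) [x].
Definition divk {M : Interp} (k : nat) (x : M) : M := fn (divkP k) [x].

Section Euclid.
Context {M : Interp} {HM : PRA M}.
Add Ring Mring5 : (@Msrt M HM).
Implicit Types x y : M.

Lemma eqcP_val x y : eqc x y = nsg (add (sub x y) (sub y x)).
Proof.
  unfold eqc, eqcP, c1, c2. rewrite pra_C; auto. simpl. rewrite !pra_C; auto. simpl.
  rewrite !pra_C; auto. simpl. rewrite !proj_val; auto.
Qed.

Lemma eqc_eq x y : x = y -> eqc x y = su zero.
Proof. intros H. rewrite eqcP_val, (proj2 (sub_sub_zero x y) H). apply nsg_0. Qed.

Lemma eqc_neq x y : x <> y -> eqc x y = zero.
Proof.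
  intros H. rewrite eqcP_val. destruct (casex (add (sub x y) (sub y x))) as [E|[u E]].
  - elim H. now apply sub_sub_zero.
  - rewrite E. apply nsg_S.
Qed.

Lemma modk_0 k : modk k (@zero M) = zero.
Proof. unfold modk, modkP. rewrite pra_R0, pra_Z; auto. Qed.

Lemma divk_0 k : divk k (@zero M) = zero.
Proof. unfold divk, divkP. rewrite pra_R0, pra_Z; auto. Qed.

Lemma modk_S k y : modk k (su y) = mul (nsg (eqc (su (modk k y)) (num k))) (su (modk k y)).
Proof.
  unfold modk at 1, modkP. rewrite pra_RS; auto. fold (modkP k). unfold c1, c2. rewrite pra_C; auto. simpl.
  rewrite !pra_C; auto. simpl. rewrite !pra_C; auto. simpl. rewrite !pra_C; auto. simpl.
  rewrite proj_val, constP_val; auto.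
Qed.

Lemma divk_S k y : divk k (su y) = add (divk k y) (eqc (su (modk k y)) (num k)).
Proof.
  unfold divk at 1, divkP. rewrite pra_RS; auto. fold (divkP k). unfold c1, c2. rewrite pra_C; auto. simpl.
  rewrite !pra_C; auto. simpl. rewrite !pra_C; auto. simpl. rewrite !pra_C; auto. simpl.
  rewrite !proj_val, constP_val; auto.
Qed.

Lemma num_lt j k : j < k -> le (su (num j)) (@num M k).
Proof.
  intros H. apply le_ex. exists (num (k - S j)). change (su (num j)) with (@num M (S j)).
  rewrite <- num_add. f_equal; lia.
Qed.

Lemma le_antisym x y : le x y -> le y x -> x = y.
Proof. intros H1 H2. apply sub_sub_zero. unfold le in *. rewrite H1, H2. apply add_0_l. Qed.

Lemma modk_divk k y : 0 < k ->
  le (su (modk k y)) (num k) /\ y = add (modk k y) (mul (num k) (divk k y)).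
Proof.
  intros Hk. revert y.
  apply (ind (fun y => le (su (modk k y)) (num k) /\ y = add (modk k y) (mul (num k) (divk k y)))).
  - unfold le, modk, divk. dtac.
  - rewrite modk_0, divk_0. split; [apply (num_lt 0); auto|ring].
  - intros y [H1 H2]. rewrite modk_S, divk_S.
    destruct (classic (su (modk k y) = num k)) as [E|E].
    + rewrite eqc_eq by exact E. change (su (@zero M)) with (@num M 1) at 1. simpl num at 1.
      rewrite nsg_S, mul_0_l. split; [apply (num_lt 0); auto|].
      rewrite H2 at 1. rewrite <- add_S_l, E. ring.
    + rewrite eqc_neq by exact E. rewrite nsg_0. rewrite mul_1_l, add_0_r. split.
      * destruct (lt_cases (su (modk k y)) (num k)) as [L|L]; auto. elim E. apply le_antisym; auto.
      * rewrite add_S_l. now rewrite <- H2.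
Qed.

(** Remainders are standard numerals, whereas quotients are arbitrary elements. If the quotients
    differed, the remainder on the side of the smaller one would be at least k. *)
Lemma euclid_unique k j j' D D' : j < k -> j' < k ->
  add (num j) (mul (num k) D) = add (num j') (mul (num k) D') -> j = j' /\ D = D' :> M.
Proof.
  assert (A : forall j j' D d, j < k -> j' < k ->
    add (num j) (mul (num k) D) = add (num j') (mul (num k) (add D d)) -> d = @zero M).
  { intros j1 j2 E d L1 L2 H. destruct (casex d) as [|[e ->]]; auto. exfalso.
    apply (lt_not_le (num j1) (@num M k)); [now apply num_lt|]. apply le_ex.
    exists (add (num j2) (mul (num k) e)). apply (add_cancel_r (mul (num k) E)).
    rewrite H, (su_add1 e). ring. }
  intros L L' H.
  assert (ED : D = D').
  { destruct (le_total D D') as [T|T]; apply le_ex in T as [d ->].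
    - rewrite (A j j' D d); auto. ring.
    - rewrite (A j' j D' d); auto. ring. }
  split; auto. subst D'. apply (@num_inj M HM). eapply add_cancel_r; eauto.
Qed.

Lemma div_ex k y : 0 < k -> exists j D, j < k /\ y = add (num j) (mul (num k) D).
Proof.
  intros Hk. destruct (modk_divk k y Hk) as [H1 H2]. apply lt_num in H1 as (j & Hj & E).
  exists j, (divk k y). split; auto. now rewrite <- E.
Qed.

Lemma modk_divk_val k j (D : M) : j < k ->
  modk k (add (num j) (mul (num k) D)) = num j /\ divk k (add (num j) (mul (num k) D)) = D.
Proof.
  intros Hj. set (y := add (num j) (mul (num k) D)).
  destruct (modk_divk k y) as [H1 H2]; [lia|]. apply lt_num in H1 as (j' & Hj' & E).
  rewrite E in *. unfold y in H2 at 1. apply euclid_unique in H2 as [-> <-]; auto.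
Qed.
End Euclid.

(** * Register machines encoded by linear maps *)

(** [Loop i c] stands for: as long as register i is positive, decrease it and run c. Loops consume
    their counters; when c leaves register i alone, this is the loop of the LOOP language. *)
Inductive cmd : Type :=
| Skip : cmd
| Inc : nat -> cmd
| Seq : cmd -> cmd -> cmd
| Loop : nat -> cmd -> cmd.

(* [OLin true p e] is the move W' = p W + e and [OLin false p e] the move W = p W' + e. *)
Inductive op : Type :=
| OLin : bool -> nat -> nat -> op
| ORst : op.

Fixpoint size (c : cmd) : nat :=
  match c with
  | Skip => 0
  | Inc _ => 1
  | Seq c1 c2 => size c1 + size c2
  | Loop _ c => size c + 3
  end.

Fixpoint used (c : cmd) : nat :=
  match c with
  | Skip => 0
  | Inc i => S i
  | Seq c1 c2 => max (used c1) (used c2)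
  | Loop i c => max (S i) (used c)
  end.

Definition powP (c : nat) : PRF 1 := PR 0 (constP 0 1) (c2 mulP (constP 2 c) (proj 2 1)).
Definition pow {M : Interp} (c : nat) (x : M) : M := fn (powP c) [x].

Definition move s d := Loop s (Inc d).
Definition clear s := Loop s Skip.
(** Reading a register destroys it, so its content goes to d and t at once and is then moved back
    from t. *)
Definition copy s d t := Seq (Loop s (Seq (Inc d) (Inc t))) (move t s).

Fixpoint clears (t k : nat) : cmd :=
  match k with O => Skip | S k => Seq (clear t) (clears (S t) k) end.

(* [comp f I o t] adds the value of [f] on the registers [I] to register [o]; the registers
   from [t] on are scratch, zero before and after. *)
Fixpoint comp {n} (f : PRF n) (I : list nat) (o t : nat) : cmd :=
  match f with
  | PZ _ => Skip
  | PS => Seq (copy (hd 0 I) o t) (Inc o)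
  | PP _ i _ => copy (nth i I 0) o t
  | PC _ k g hs => Seq (comps hs I t (t + k)) (Seq (comp g (seq t k) o (t + k)) (clears t k))
  | PR _ g h =>
      Seq (copy (hd 0 I) (t + 1) (t + 4))
     (Seq (comp g (tl I) (t + 2) (t + 4))
     (Seq (Loop (t + 1)
            (Seq (comp h (t :: t + 2 :: tl I) (t + 3) (t + 4))
            (Seq (clear (t + 2)) (Seq (move (t + 3) (t + 2)) (Inc t)))))
     (Seq (move (t + 2) o) (clear t))))
  end
with comps {n k} (hs : PRFs n k) (I : list nat) (d t : nat) : cmd :=
  match hs with
  | PNil _ => Skip
  | PCons h hs => Seq (comp h I d t) (comps hs I (S d) t)
  end.

Section Coding.
Variables (m : nat) (b md : nat -> nat).

(** Multiplying W + 1 by [b i] sends W to [b i * W + (b i - 1)], whence the offset; a decrement is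
    the same relation read backwards. The test has no offset because a zero register makes W + 1
    congruent to 1 modulo [md i]. *)
Definition oInc i := OLin true (b i) (b i - 1).
Definition oDec i := OLin false (b i) (b i - 1).
Definition oTest i := OLin false (md i) 0.
Definition oUntest i := OLin true (md i) 0.
Definition oId := OLin true 1 0.

(* A loop occupies its head [e], its body from [e + 1], the jump back, and a state between
   the two halves of the zero test (W = md i * W', then W' = md i * W). *)
Fixpoint rl (c : cmd) (e s s' : nat) : option op :=
  match c with
  | Skip => None
  | Inc i => if s =? e then if s' =? e + 1 then Some (oInc i) else None else None
  | Seq c1 c2 => if s <? e + size c1 then rl c1 e s s' else rl c2 (e + size c1) s s'
  | Loop i c =>
      if s =? e then
        if s' =? e + 1 then Some (oDec i)
        else if s' =? e + size c + 2 then Some (oTest i) else None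
      else if s <? e + 1 + size c then rl c (e + 1) s s'
      else if s =? e + 1 + size c then if s' =? e then Some oId else None
      else if s =? e + size c + 2 then if s' =? e + size c + 3 then Some (oUntest i) else None
      else None
  end.

Definition emb (r : nat -> nat -> option op) (c : cmd) (e : nat) : Prop :=
  forall s s', e <= s -> s < e + size c -> r s s' = rl c e s s'.

Lemma emb_seq r c1 c2 e : emb r (Seq c1 c2) e -> emb r c1 e /\ emb r c2 (e + size c1).
Proof.
  intros H; split; intros s s' H1 H2; simpl in *; rewrite H by (simpl; lia); simpl.
  - destruct (Nat.ltb_spec s (e + size c1)); auto; lia.
  - destruct (Nat.ltb_spec s (e + size c1)); auto; lia.
Qed.

Lemma emb_loop r i c e : emb r (Loop i c) e -> emb r c (e + 1).
Proof.
  intros H s s' H1 H2; simpl in *; rewrite H by (simpl; lia); simpl.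
  destruct (Nat.eqb_spec s e); [lia|]. destruct (Nat.ltb_spec s (e + 1 + size c)); auto; lia.
Qed.

Lemma emb_head r i c e s' : emb r (Loop i c) e -> r e s' =
  if s' =? e + 1 then Some (oDec i) else if s' =? e + size c + 2 then Some (oTest i) else None.
Proof. intros H. rewrite H by (simpl; lia). simpl. now rewrite Nat.eqb_refl. Qed.

Lemma emb_back r i c e s' : emb r (Loop i c) e ->
  r (e + 1 + size c) s' = if s' =? e then Some oId else None.
Proof.
  intros H. rewrite H by (simpl; lia). simpl. destruct (Nat.eqb_spec (e + 1 + size c) e); [lia|].
  now rewrite Nat.ltb_irrefl, Nat.eqb_refl.
Qed.

Lemma emb_mid r i c e s' : emb r (Loop i c) e ->
  r (e + size c + 2) s' = if s' =? e + size c + 3 then Some (oUntest i) else None.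
Proof.
  intros H. rewrite H by (simpl; lia). simpl. destruct (Nat.eqb_spec (e + size c + 2) e); [lia|].
  destruct (Nat.ltb_spec (e + size c + 2) (e + 1 + size c)); [lia|].
  destruct (Nat.eqb_spec (e + size c + 2) (e + 1 + size c)); [lia|]. now rewrite Nat.eqb_refl.
Qed.

(** [ORst] ignores W: it empties all registers except register 0, which receives an arbitrary x. *)
Definition oprel {M : Interp} (o : op) (W W' : M) : Prop :=
  match o with
  | OLin true p e => W' = add (mul (num p) W) (num e)
  | OLin false p e => W = add (mul (num p) W') (num e)
  | ORst => exists x, su W' = pow (b 0) x
  end.

Definition Step {M : Interp} (r : nat -> nat -> option op) (s : nat) (W : M) (s' : nat) (W' : M) : Prop :=
  exists o, r s s' = Some o /\ oprel o W W'.

Fixpoint prodr {M : Interp} (n : nat) (a : nat -> M) : M :=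
  match n with O => su zero | S n => mul (prodr n a) (pow (b n) (a n)) end.

Hypothesis md_gt : forall i, i < m -> 1 < md i.
Hypothesis b_self : forall i, i < m -> exists g, b i = md i * S g.
Hypothesis b_other : forall i j, i < m -> j < m -> i <> j -> exists h, b j = 1 + md i * h.

Lemma b_pos i : i < m -> exists u, b i = S u.
Proof.
  intros H. destruct (b_self i H) as [g Hg]. pose proof (md_gt i H). exists (b i - 1). nia.
Qed.

Section Model.
Context {M : Interp} {HM : PRA M}.
Add Ring Mring4 : (@Msrt M HM).
Implicit Types (a : nat -> M) (x y W : M).

Lemma pow_0 c : pow c (@zero M) = su zero.
Proof. unfold pow, powP. rewrite pra_R0, constP_val; auto. Qed.

Lemma pow_S c (x : M) : pow c (su x) = mul (num c) (pow c x).
Proof.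
  unfold pow, powP. rewrite pra_RS; auto. unfold c2. rewrite pra_C; auto. simpl.
  rewrite constP_val, proj_val; auto.
Qed.

Lemma pow_pos c (x : M) : exists w, pow (S c) x = su w.
Proof.
  enough (pow (S c) x <> zero) by (destruct (casex (pow (S c) x)); [contradiction|auto]).
  revert x; apply (ind (fun x => pow (S c) x <> zero)).
  - unfold pow. dtac.
  - rewrite pow_0. apply pra_S1.
  - intros y IH. rewrite pow_S, mul_eq_0. intros [H|H]; auto. now apply pra_S1 in H.
Qed.

Lemma prodr_pos n a : n <= m -> exists w, prodr n a = su w.
Proof.
  induction n as [|n IH]; intros L; simpl; eauto.
  destruct IH as [w ->]; [lia|]. destruct (b_pos n) as [u Hu]; [lia|]. rewrite Hu.
  destruct (pow_pos u (a n)) as [v ->]. rewrite mul_S_l, add_S_r. eauto.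
Qed.

Lemma prodr_ext n a a' : (forall j, j < n -> a j = a' j) -> prodr n a = prodr n a'.
Proof. induction n; simpl; intros H; auto. rewrite IHn, (H n); auto. Qed.

Lemma upd_same a i v : upd a i v i = v.
Proof. unfold upd. now rewrite Nat.eqb_refl. Qed.

Lemma upd_other a i v j : j <> i -> upd a i v j = a j.
Proof. unfold upd. intros H; apply Nat.eqb_neq in H; now rewrite H. Qed.

Lemma upd_self a i : upd a i (a i) = a.
Proof. extensionality j; unfold upd; destruct (Nat.eqb_spec j i); congruence. Qed.

Lemma upd_upd a i u v : upd (upd a i u) i v = upd a i v.
Proof. extensionality j; unfold upd; destruct (j =? i); auto. Qed.

Lemma prodr_inc n a i : i < n -> prodr n (upd a i (su (a i))) = mul (num (b i)) (prodr n a).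
Proof.
  induction n as [|n IH]; intros L; [lia|]. simpl. destruct (Nat.eq_dec i n) as [->|N].
  - rewrite upd_same, pow_S. rewrite (prodr_ext n _ a); [ring|].
    intros j Hj. apply upd_other; lia.
  - rewrite IH by lia. rewrite upd_other by lia. ring.
Qed.

Definition cong1 (c : nat) (x : M) : Prop := exists u, x = add (mul (num c) u) (su zero).

Lemma cong1_mul c x y : cong1 c x -> cong1 c y -> cong1 c (mul x y).
Proof. intros [u ->] [v ->]. exists (add (mul (num c) (mul u v)) (add u v)). ring. Qed.

(** Replaces the existential quantifier of [cong1] by an equation, so that induction on an exponent
    becomes possible. *)
Lemma cong1_modk c x : 1 < c -> (cong1 c x <-> modk c x = su zero).
Proof.
  intros Hc. split.
  - intros [u ->]. rewrite add_comm. apply (modk_divk_val c 1 u Hc).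
  - intros H. destruct (modk_divk c x) as [_ E]; [lia|]. rewrite H in E. exists (divk c x).
    rewrite E at 1. apply add_comm.
Qed.

Lemma cong1_pow c h x : 1 < c -> cong1 c (pow (1 + c * h) x).
Proof.
  intros Hc. rewrite cong1_modk by exact Hc. revert x.
  apply (ind (fun x => modk c (pow (1 + c * h) x) = su zero)).
  - unfold modk, pow. dtac.
  - rewrite pow_0. rewrite <- cong1_modk by exact Hc. exists zero. ring.
  - intros x IH. apply cong1_modk in IH; auto. rewrite <- cong1_modk by exact Hc. rewrite pow_S.
    apply cong1_mul; auto. exists (num h). rewrite num_add, num_mul. simpl. ring.
Qed.

Lemma prodr_cong1 n a i : i < m -> n <= m -> a i = zero -> cong1 (md i) (prodr n a).
Proof.
  intros Hi Hn Ha. induction n as [|n IH]; simpl.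
  - exists zero. ring.
  - apply cong1_mul; [apply IH; lia|]. destruct (Nat.eq_dec i n) as [->|N].
    + rewrite Ha, pow_0. exists zero. ring.
    + destruct (b_other i n) as [h ->]; try lia. apply cong1_pow, md_gt; auto.
Qed.

Lemma oprel_inc i a W W' : i < m -> su W = prodr m a -> su W' = prodr m (upd a i (su (a i))) ->
  oprel (oInc i) W W'.
Proof.
  intros Hi H H'. rewrite prodr_inc in H' by exact Hi. rewrite <- H in H'.
  destruct (b_pos i Hi) as [u Hu]. simpl. rewrite Hu in *. simpl. rewrite Nat.sub_0_r.
  apply pra_S2. rewrite H'. simpl. rewrite (su_add1 W), (su_add1 (num u)), (su_add1 (add _ _)). ring.
Qed.

Lemma oprel_dec i a x W W' : i < m -> a i = su x -> su W = prodr m a -> su W' = prodr m (upd a i x) ->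
  oprel (oDec i) W W'.
Proof.
  intros Hi E H H'.
  assert (X : oprel (oInc i) W' W).
  { apply (oprel_inc i (upd a i x)); auto. rewrite upd_same, upd_upd, <- E, upd_self; auto. }
  exact X.
Qed.

Lemma oprel_test i a W : i < m -> a i = zero -> su W = prodr m a ->
  exists U, oprel (oTest i) W U /\ oprel (oUntest i) U W.
Proof.
  intros Hi E H. destruct (prodr_cong1 m a i Hi (Nat.le_refl m) E) as [u Hu].
  rewrite <- H, <- su_add1 in Hu. apply pra_S2 in Hu. exists u. simpl.
  rewrite add_0_r. auto.
Qed.

Lemma b_ge2 i : i < m -> exists u, b i = S (S u).
Proof.
  intros H. destruct (b_self i H) as [g Hg]. pose proof (md_gt i H). exists (b i - 2). nia.
Qed.

Lemma pow_ge u x : le (su x) (pow (S (S u)) x).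
Proof.
  revert x. apply (ind (fun x => le (su x) (pow (S (S u)) x))).
  - unfold le, pow. dtac.
  - rewrite pow_0. apply le_refl.
  - intros x IH. apply le_ex in IH as [d E]. rewrite pow_S, E. apply le_ex.
    exists (add (add d (add x d)) (mul (num u) (add (su x) d))). simpl num.
    rewrite !mul_S_l, !(su_add1 (su x)), (su_add1 x). ring.
Qed.

Lemma le_mul_l x y : y <> zero -> le x (mul x y).
Proof.
  intros H. destruct (casex y) as [|[w ->]]; [contradiction|]. apply le_ex. exists (mul x w).
  rewrite mul_S_r. apply add_comm.
Qed.

(** Every base is at least 2, so no register exceeds W. This bounds the quantifiers over register
    contents and makes assertions Delta0. *)
Lemma prodr_ge n a i : i < n -> n <= m -> le (su (a i)) (prodr n a).
Proof.
  induction n as [|n IH]; intros Hi Hn; [lia|]. simpl. destruct (Nat.eq_dec i n) as [->|N].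
  - destruct (prodr_pos n a) as [w Hw]; [lia|]. destruct (b_ge2 n) as [u Hu]; [lia|].
    eapply le_trans; [apply (pow_ge u)|]. rewrite <- Hu, mul_comm. apply le_mul_l.
    rewrite Hw. apply pra_S1.
  - eapply le_trans; [apply IH; lia|]. apply le_mul_l. destruct (b_ge2 n) as [u Hu]; [lia|]. rewrite Hu.
    destruct (pow_pos (S u) (a n)) as [v Hv]. rewrite Hv. apply pra_S1.
Qed.

Definition Fin a : Prop := forall j, m <= j -> a j = zero.

Definition Cfg (s : nat) (Q : (nat -> M) -> Prop) : nat -> M -> Prop :=
  fun s' W => s' = s /\ exists a, Fin a /\ su W = prodr m a /\ Q a.

Notation DA Q := (DQ Delta0 EV Q).

Definition trunc a : nat -> M := fun j => if j <? m then a j else zero.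

Lemma DM_trunc : DM EV trunc.
Proof.
  exists (fun j => if j <? m then Var (2 * j) else zeroT), (fun _ => zero). intros a j. unfold trunc.
  destruct (j <? m); cbn [mev]; auto. now rewrite mix_even.
Qed.

Lemma DT_prodr n (h : (nat -> M) -> nat -> M) : (forall j, DT EV (fun a => h a j)) -> DT EV (fun a => prodr n (h a)).
Proof.
  intros H. induction n as [|n IH]; simpl; dtac. apply DT_fn1. apply H.
Qed.

Lemma DQ_Cfg s Q s' : DA Q -> DQ Delta0 E1 (Cfg s Q s').
Proof.
  intros HQ.
  (* Under the m quantifiers the registers occupy the variables below m, and W sits in variable m.
     [trunc] sets the registers beyond to zero, as [Fin] demands. *)
  set (F := fun a : nat -> M => su (a m) = prodr m (trunc a) /\ Q (trunc a)).
  assert (HF : DA F).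
  { unfold F. apply DQ_and; [apply _| |].
    - apply DQ_eq; [apply _|dtac|]. apply DT_prodr. intros j. unfold trunc. destruct (j <? m); dtac.
    - apply (DQ_comp Delta0 EV trunc Q HQ DM_trunc). }
  pose proof (DQ_bexs m F 0 HF) as G.
  pose proof (DQ_comp Delta0 E1 (fun y _ => y) _ G (DM_const_fun E1 (fun y => y) DT_id1)) as G'.
  destruct (Nat.eq_dec s' s) as [->|N].
  - eapply DQ_ext; [|exact G']. intros W. unfold Cfg, F. split.
    + intros (l & L & _ & H1 & H2). split; auto. exists (trunc (lenv l (fun _ => W))). split.
      * intros j Hj. unfold trunc. destruct (Nat.ltb_spec j m); auto; lia.
      * split; auto. rewrite <- H1. f_equal. clear -L. subst m. induction l; simpl; auto.
    + intros (_ & a & Fa & H1 & H2). exists (map a (seq 0 m)).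
      assert (E : trunc (lenv (map a (seq 0 m)) (fun _ => W)) = a).
      { extensionality j. unfold trunc. destruct (Nat.ltb_spec j m).
        - rewrite (nth_lenv _ _ _ (a 0)) by (rewrite length_map, length_seq; auto).
          rewrite (map_nth a (seq 0 m) 0 j), seq_nth; auto.
        - symmetry; apply Fa; auto. }
      rewrite E. rewrite length_map, length_seq. repeat split; auto.
      * apply Forall_forall. intros y Hy. apply in_map_iff in Hy as (j & <- & Hj). apply in_seq in Hj.
        rewrite H1. apply prodr_ge; auto; lia.
      * rewrite <- H1. f_equal.
        assert (L : length (map a (seq 0 m)) = m) by (rewrite length_map, length_seq; auto).
        revert L. generalize (map a (seq 0 m)). clear. intros l <-. induction l; simpl; auto.
  - eapply DQ_ext; [|apply (DQ_false Delta0 E1 zero)]. intros W; unfold Cfg; tauto.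
Qed.

(** * Hoare logic for the machine inside a model *)

Variable r : nat -> nat -> option op.

(* From every configuration of [X] the machine either runs forever inside a definable set or
   reaches [E]; loops are composed without induction on their number of iterations. *)
Definition Leads (X E : nat -> M -> Prop) : Prop :=
  exists B : nat -> M -> Prop, (forall s, DQ Delta0 E1 (B s)) /\
    (forall s W, X s W -> B s W \/ E s W) /\
    (forall s W, B s W -> exists s' W', Step r s W s' W' /\ (B s' W' \/ E s' W')).

Lemma Leads_refl X E : (forall s W, X s W -> E s W) -> Leads X E.
Proof.
  intros H. exists (fun _ _ => False). split; [intros; apply (DQ_false Delta0 E1 zero)|]. split; [auto|tauto].
Qed.

Lemma Leads_trans X Y Z : Leads X Y -> Leads Y Z -> Leads X Z.
Proof.
  intros (B1 & D1 & I1 & S1) (B2 & D2 & I2 & S2).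
  exists (fun s W => B1 s W \/ B2 s W). split; [|split].
  - intros s; apply DQ_or; auto; apply _.
  - intros s W H. destruct (I1 s W H) as [|H']; auto. destruct (I2 s W H'); auto.
  - intros s W [H|H].
    + destruct (S1 s W H) as (s' & W' & St & [H'|H']); exists s', W'; split; auto.
      destruct (I2 s' W' H'); auto.
    + destruct (S2 s W H) as (s' & W' & St & [H'|H']); exists s', W'; split; auto.
Qed.

Lemma Leads_incl X X' E : (forall s W, X' s W -> X s W) -> Leads X E -> Leads X' E.
Proof. intros H (B & D & I & St); exists B; auto. Qed.

Lemma Leads_step X E : (forall s, DQ Delta0 E1 (X s)) ->
  (forall s W, X s W -> exists s' W', Step r s W s' W' /\ E s' W') -> Leads X E.
Proof.
  intros D H. exists X. split; auto. split; auto. intros s W HX.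
  destruct (H s W HX) as (s' & W' & St & He); eauto 6.
Qed.

Lemma prodr_pre a : exists W, su W = prodr m a.
Proof. destruct (prodr_pos m a (Nat.le_refl m)) as [w Hw]; eauto. Qed.

Lemma Fin_upd a i v : i < m -> Fin a -> Fin (upd a i v).
Proof. intros Hi F j Hj. rewrite upd_other by lia. auto. Qed.

Lemma Leads_inc i e Q : i < m -> emb r (Inc i) e -> DA (fun a => Q (upd a i (su (a i)))) ->
  Leads (Cfg e (fun a => Q (upd a i (su (a i))))) (Cfg (e + 1) Q).
Proof.
  intros Hi He D. apply Leads_step; [intros; apply DQ_Cfg; auto|].
  intros s W (-> & a & Fa & HW & Ha). destruct (prodr_pre (upd a i (su (a i)))) as [W' HW'].
  exists (e + 1), W'. split.
  - exists (oInc i). split; [|eapply oprel_inc; eauto].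
    rewrite He by (simpl; lia). simpl. now rewrite !Nat.eqb_refl.
  - split; auto. eexists; split; [|split; eauto]. apply Fin_upd; auto.
Qed.

(** The set for the loop is the set for the body together with the configurations at the head, at
    the jump back and inside the zero test. Each has a successor in the set or at the exit, so the
    possibly nonstandard number of rounds does not enter. *)
Lemma Leads_loop i c e I : i < m -> emb r (Loop i c) e -> DA I ->
  Leads (Cfg (e + 1) (fun a => exists x, I (upd a i (su x)) /\ a i = x)) (Cfg (e + 1 + size c) I) ->
  Leads (Cfg e I) (Cfg (e + size c + 3) (fun a => I a /\ a i = zero)).
Proof.
  intros Hi He DI (B & DB & IB & SB).
  assert (DI0 : DA (fun a => I a /\ a i = zero)) by (apply DQ_and; [apply _|auto|dtac]).
  (* Between the two halves of the test, W is described through [md i * W], the number of the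
     configuration to which the second half returns. *)
  set (mid := fun s (W : M) => s = e + size c + 2 /\
     exists V, add (mul (num (md i)) W) zero = V /\ Cfg (e + size c + 3) (fun a => I a /\ a i = zero) (e + size c + 3) V).
  assert (Dmid : forall s, DQ Delta0 E1 (mid s)).
  { intros s. destruct (Nat.eq_dec s (e + size c + 2)) as [->|N].
    - assert (G : DQ Delta0 E1 (fun W : M => Cfg (e + size c + 3) (fun a => I a /\ a i = zero) (e + size c + 3)
          (add (mul (num (md i)) W) zero))).
      { apply (DQ_comp1 Delta0 E1 (fun W => add (mul (num (md i)) W) zero) _ (DQ_Cfg _ _ _ DI0)). dtac. }
      eapply DQ_ext; [|exact G]. intros W; unfold mid; split; eauto. intros (_ & V & <- & H); auto.
    - eapply DQ_ext; [|apply (DQ_false Delta0 E1 zero)]. intros W; unfold mid; tauto. }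
  set (bk := Cfg (e + 1 + size c) I).
  exists (fun s W => B s W \/ Cfg e I s W \/ mid s W \/ bk s W). split; [|split].
  - intros s. repeat (apply DQ_or; [apply _| |]); auto; apply DQ_Cfg; auto.
  - auto.
  - intros s W [H|[H|[H|H]]].
    + destruct (SB s W H) as (s' & W' & St & [H'|H']); exists s', W'; split; auto.
    + destruct H as (-> & a & Fa & HW & Ha). destruct (casex (a i)) as [Z|[x X]].
      * destruct (oprel_test i a W Hi Z HW) as (U & H1 & H2). exists (e + size c + 2), U. split.
        -- exists (oTest i). split; auto. rewrite (emb_head _ _ _ _ _ He).
           destruct (Nat.eqb_spec (e + size c + 2) (e + 1)); [lia|]. now rewrite Nat.eqb_refl.
        -- left. right; right; left. split; auto. exists W. split; [symmetry; exact H2|].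
           split; auto. exists a. auto.
      * destruct (prodr_pre (upd a i x)) as [W' HW']. exists (e + 1), W'. split.
        -- exists (oDec i). split; [|eapply oprel_dec; eauto].
           rewrite (emb_head _ _ _ _ _ He). now rewrite Nat.eqb_refl.
        -- assert (HX : Cfg (e + 1) (fun a => exists x, I (upd a i (su x)) /\ a i = x) (e + 1) W').
           { split; auto. exists (upd a i x). split; [apply Fin_upd; auto|]. split; auto.
             exists x. rewrite upd_upd, <- X, upd_self, upd_same. auto. }
           destruct (IB _ _ HX); auto 6.
    + destruct H as (-> & V & <- & HV). exists (e + size c + 3). eexists; split; [|right; exact HV].
      exists (oUntest i). split; [|reflexivity]. rewrite (emb_mid _ _ _ _ _ He). now rewrite Nat.eqb_refl.
    + destruct H as (-> & H). exists e, W. split.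
      * exists oId. split; [|simpl; rewrite add_0_r, mul_1_l; auto]. rewrite (emb_back _ _ _ _ _ He). now rewrite Nat.eqb_refl.
      * left; right; left. split; auto.
Qed.

Lemma Leads_mono X E E' : (forall s W, E s W -> E' s W) -> Leads X E -> Leads X E'.
Proof. intros H L. eapply Leads_trans; [exact L|apply Leads_refl, H]. Qed.

Lemma Cfg_mono s (P Q : (nat -> M) -> Prop) : (forall a, Fin a -> P a -> Q a) ->
  forall s' W, Cfg s P s' W -> Cfg s Q s' W.
Proof. intros H s' W (E & a & F & HW & Ha). split; auto. exists a; auto. Qed.

Lemma DM_id : DM EV (fun a : nat -> M => a).
Proof. apply (DM_self EV zero). Qed.

Lemma DM_comp t1 t2 : DM EV t1 -> DM EV t2 -> DM EV (fun a : nat -> M => t2 (t1 a)).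
Proof.
  intros (s1 & p & H1) (s2 & q & H2). exists (fun i => tsubst (join_sub s1) (s2 i)), (mix p q).
  intros a i. rewrite H2, (proj1 (mev_subst _ _)), (mev_join EV t1); auto.
Qed.

Lemma DA_true : DA (fun _ : nat -> M => True).
Proof. eapply DQ_ext; [|apply (DQ_eq Delta0 EV (fun _ => zero) (fun _ => zero)); dtac]. tauto. Qed.

(* Under [P], the program [c] turns the register contents [a] into [t a]. *)
Record Eff (c : cmd) (P : (nat -> M) -> Prop) (t : (nat -> M) -> nat -> M) : Prop := {
  eff_pre : DA P;
  eff_map : DM EV t;
  eff_leads : forall e, emb r c e -> forall Q, DA Q ->
    Leads (Cfg e (fun a => P a /\ Q (t a))) (Cfg (e + size c) Q) }.

Lemma Eff_weaken c (P P' : (nat -> M) -> Prop) t t' : DA P' -> DM EV t' -> Eff c P t ->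
  (forall a, Fin a -> P' a -> P a /\ t a = t' a) -> Eff c P' t'.
Proof.
  intros D T [_ _ H] HE; constructor; auto. intros e He Q HQ.
  eapply Leads_incl; [|apply (H e He Q HQ)].
  apply Cfg_mono. intros a Fa [H1 H2]. destruct (HE a Fa H1) as [H3 H4]. now rewrite H4.
Qed.

Lemma Eff_skip : Eff Skip (fun _ => True) (fun a => a).
Proof.
  constructor; [apply DA_true|apply DM_id|].
  intros e He Q HQ. simpl. rewrite Nat.add_0_r. apply Leads_refl, Cfg_mono. tauto.
Qed.

Lemma Eff_inc i : i < m -> Eff (Inc i) (fun _ => True) (fun a => upd a i (su (a i))).
Proof.
  intros Hi.
  assert (D : DM EV (fun a : nat -> M => upd a i (su (a i)))) by (apply DM_upd; [apply DM_id|dtac]).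
  constructor; [apply DA_true|auto|].
  intros e He Q HQ. eapply Leads_incl; [|apply (Leads_inc i e Q Hi He)].
  - apply Cfg_mono; tauto.
  - apply (DQ_comp Delta0 EV (fun a => upd a i (su (a i))) Q HQ D).
Qed.

Lemma Eff_seq c1 c2 P1 P2 t1 t2 : Eff c1 P1 t1 -> Eff c2 P2 t2 ->
  Eff (Seq c1 c2) (fun a => P1 a /\ P2 (t1 a)) (fun a => t2 (t1 a)).
Proof.
  intros [D1 T1 H1] [D2 T2 H2]; constructor.
  - apply DQ_and; [apply _|auto|]. apply (DQ_comp Delta0 EV t1 P2 D2 T1).
  - apply DM_comp; auto.
  - intros e He Q HQ. apply emb_seq in He as [He1 He2]. simpl size. rewrite Nat.add_assoc.
    eapply Leads_trans; [|apply (H2 _ He2 Q HQ)].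
    eapply Leads_incl; [|apply (H1 _ He1 (fun a => P2 a /\ Q (t2 a)))].
    + apply Cfg_mono; tauto.
    + apply DQ_and; [apply _|auto|]. apply (DQ_comp Delta0 EV t2 Q HQ T2).
Qed.

(** The map t is the effect of all remaining rounds: it is the identity once the counter is zero and
    takes the same value before and after a round. So P together with the postcondition pulled back
    along t is a loop invariant, without any induction on the counter. *)
Lemma Eff_loop i c P t Pb tb : i < m -> DA P -> DM EV t -> Eff c Pb tb ->
  (forall a, Fin a -> P a -> a i = zero -> t a = a) ->
  (forall a, Fin a -> P (upd a i (su (a i))) ->
     Pb a /\ P (tb a) /\ t (tb a) = t (upd a i (su (a i)))) ->
  Eff (Loop i c) P t.
Proof.
  intros Hi DP Dt [_ _ HB] H0 HS; constructor; auto. intros e He Q HQ.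
  assert (DI : DA (fun a => P a /\ Q (t a))).
  { apply DQ_and; [apply _|auto|]. apply (DQ_comp Delta0 EV t Q HQ Dt). }
  assert (Eb : emb r c (e + 1)) by (eapply emb_loop; eauto).
  eapply Leads_mono; [|apply (Leads_loop i c e _ Hi He DI)].
  - simpl size. rewrite Nat.add_assoc. apply Cfg_mono. intros a Fa [[H1 H2] H3]. rewrite H0 in H2; auto.
  - eapply Leads_incl; [|apply (HB (e + 1) Eb _ DI)].
    apply Cfg_mono. intros a Fa (x & [H1 H2] & <-). destruct (HS a Fa H1) as (H3 & H4 & H5).
    rewrite H5. auto.
Qed.

(** * Effects of the basic programs and of compiled functions *)

Ltac updt :=
  unfold upd; repeat match goal with
    | |- context [Nat.eqb ?u ?v] => destruct (Nat.eqb_spec u v); try lia; try subst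
    end; auto.

Lemma Eff_move s d : s <> d -> s < m -> d < m ->
  Eff (move s d) (fun _ => True) (fun a => upd (upd a d (add (a d) (a s))) s zero).
Proof.
  intros N Hs Hd. eapply Eff_loop; [auto|apply DA_true| |apply Eff_inc; auto| |]; auto.
  - apply DM_upd; [apply DM_upd; [apply DM_id|]|]; dtac.
  - intros a _ _ H. extensionality j. updt. rewrite H. ring.
  - intros a _ _. repeat split; auto. extensionality j. updt.
    now rewrite add_S_l, add_S_r.
Qed.

Lemma Eff_clear s : s < m -> Eff (clear s) (fun _ => True) (fun a => upd a s zero).
Proof.
  intros Hs. eapply Eff_loop; [auto|apply DA_true| |apply Eff_skip| |]; auto.
  - apply DM_upd; [apply DM_id|]; dtac.
  - intros a _ _ H. extensionality j. updt.
  - intros a _ _. repeat split; auto. extensionality j. updt.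
Qed.

Lemma Eff_copy s d t : s <> d -> s <> t -> d <> t -> s < m -> d < m -> t < m ->
  Eff (copy s d t) (fun a => a t = zero) (fun a => upd a d (add (a d) (a s))).
Proof.
  intros N1 N2 N3 Hs Hd Ht.
  set (t1 := fun a : nat -> M => upd (upd (upd a d (add (a d) (a s))) t (add (a t) (a s))) s zero).
  assert (E1 : Eff (Loop s (Seq (Inc d) (Inc t))) (fun _ => True) t1).
  { eapply Eff_loop; [auto|apply DA_true| |apply Eff_seq; [apply (Eff_inc d)|apply (Eff_inc t)]; auto| |].
    - apply DM_upd; [apply DM_upd; [apply DM_upd; [apply DM_id|]|]|]; dtac.
    - intros a _ _ H. extensionality j. unfold t1. updt; rewrite H; ring.
    - intros a _ _. repeat split; auto. extensionality j. unfold t1. updt; now rewrite add_S_l, add_S_r. }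
  eapply Eff_weaken; [dtac| |apply (Eff_seq _ _ _ _ _ _ E1 (Eff_move t s ltac:(auto) Ht Hs))|].
  - apply DM_upd; [apply DM_id|]; dtac.
  - intros a _ H. split; [auto|]. extensionality j. unfold t1. updt. rewrite H. ring.
Qed.

(** A finite conjunction, hence definable; under [Fin] it says that all registers from t on are
    zero. *)
Definition Zs (t : nat) (a : nat -> M) : Prop := forall j, In j (seq t (m - t)) -> a j = zero.

Lemma Zs_iff t a : Fin a -> (Zs t a <-> forall j, t <= j -> a j = zero).
Proof.
  intros F. split.
  - intros H j Hj. destruct (Nat.le_gt_cases m j); [auto|]. apply H, in_seq; lia.
  - intros H j Hj. apply in_seq in Hj. apply H; lia.
Qed.

Ltac zeros HZ :=
  match type of HZ with Zs ?t ?a =>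
    let H := fresh in
    assert (H : forall j, t <= j -> a j = zero) by
      (refine (proj1 (Zs_iff t a _) HZ); first [assumption | apply Fin_upd; [lia | assumption]]);
    clear HZ; rename H into HZ
  end.

Lemma DA_Zs t : DA (Zs t).
Proof.
  unfold Zs. induction (seq t (m - t)) as [|x l IH].
  - eapply DQ_ext; [|apply DA_true]. intros a; split; [intros _ j []|auto].
  - eapply DQ_ext; [|apply (DQ_and Delta0 EV (fun a => a x = zero) _ ltac:(dtac) IH)].
    intros a; split; [intros [H1 H2] j [<-|Hj]; auto|intros H; split; [apply H; simpl; auto|intros j Hj; apply H; simpl; auto]].
Qed.

Lemma DT_regs n (f : PRF n) (l : list nat) : length l = n -> DT EV (fun a : nat -> M => fn f (map a l)).
Proof.
  intros L. eapply DT_ext; [|apply (DT_fn n f EV (map (fun i (a : nat -> M) => a i) l))].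
  - intros a. simpl. now rewrite map_map.
  - now rewrite length_map.
  - apply Forall_forall. intros g Hg. apply in_map_iff in Hg as (c & <- & _). dtac.
Qed.

Lemma DT_regs1 n (f : PRF (S n)) g (l : list nat) : DT EV g -> length l = n ->
  DT EV (fun a : nat -> M => fn f (g a :: map a l)).
Proof.
  intros Hg L. eapply DT_ext; [|apply (DT_fn (S n) f EV (g :: map (fun i (a : nat -> M) => a i) l))].
  - intros a. simpl. now rewrite map_map.
  - simpl; now rewrite length_map, L.
  - constructor; auto. apply Forall_forall. intros h Hh. apply in_map_iff in Hh as (c & <- & _). dtac.
Qed.

Lemma map_upd a i v (l : list nat) : ~ In i l -> map (upd a i v) l = map a l.
Proof. intros H. apply map_ext_in. intros j Hj. apply upd_other. intros ->; auto. Qed.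

Fixpoint setl (d : nat) (vs : list M) (a : nat -> M) : nat -> M :=
  match vs with [] => a | v :: vs => setl (S d) vs (upd a d v) end.

Lemma setl_out vs : forall d a j, j < d \/ d + length vs <= j -> setl d vs a j = a j.
Proof.
  induction vs as [|v vs IH]; intros d a j H; simpl in *; auto.
  rewrite IH by lia. apply upd_other; lia.
Qed.

Lemma setl_in vs : forall d a i, i < length vs -> setl d vs a (d + i) = nth i vs zero.
Proof.
  induction vs as [|v vs IH]; intros d a [|i] H; simpl in *; try lia.
  - rewrite Nat.add_0_r, setl_out by lia. apply upd_same.
  - rewrite Nat.add_succ_r, <- Nat.add_succ_l. apply IH; lia.
Qed.

Lemma map_setl vs d a : map (setl d vs a) (seq d (length vs)) = vs.
Proof.
  apply nth_ext with (d := zero) (d' := zero); rewrite length_map, length_seq; auto.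
  intros i Hi. rewrite nth_indep with (d' := setl d vs a 0) by (rewrite length_map, length_seq; auto).
  rewrite map_nth, seq_nth by auto. apply setl_in; auto.
Qed.

Lemma DM_setl n k (hs : PRFs n k) (l : list nat) : length l = n -> forall d t, DM EV t ->
  DM EV (fun a : nat -> M => setl d (fns hs (map a l)) (t a)).
Proof.
  induction hs as [|n k h hs IH]; intros L d t Ht; simpl; auto.
  apply (IH L (S d) (fun a => upd (t a) d (fn h (map a l)))). apply DM_upd; auto. apply DT_regs; auto.
Qed.

Lemma DM_setl0 k : forall d t, DM EV t -> DM EV (fun a : nat -> M => setl d (repeat zero k) (t a)).
Proof.
  induction k as [|k IH]; intros d t Ht; simpl; auto.
  apply (IH (S d) (fun a => upd (t a) d zero)). apply DM_upd; auto. dtac.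
Qed.

Lemma Eff_clears k : forall t, used (clears t k) <= m ->
  Eff (clears t k) (fun _ => True) (fun a => setl t (repeat zero k) a).
Proof.
  induction k as [|k IH]; intros t U; simpl in *.
  - apply Eff_skip.
  - eapply Eff_weaken; [apply DA_true| |apply Eff_seq; [apply Eff_clear|apply (IH (S t))]|]; try lia.
    + apply (DM_setl0 k (S t) (fun a => upd a t zero)). apply DM_upd; [apply DM_id|dtac].
    + auto.
Qed.

Lemma comp_spec :
  (forall n (f : PRF n) l o t, length l = n -> (forall i, In i l -> i < t) -> o < t -> ~ In o l ->
     used (comp f l o t) <= m ->
     Eff (comp f l o t) (Zs t) (fun a => upd a o (add (a o) (fn f (map a l))))) /\
  (forall n k (hs : PRFs n k) l d t, length l = n -> (forall i, In i l -> i < d) -> d + k <= t ->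
     used (comps hs l d t) <= m ->
     Eff (comps hs l d t) (Zs d) (fun a => setl d (fns hs (map a l)) a)).
Proof.
  assert (DR : forall n (f : PRF n) l o, length l = n ->
    DM EV (fun a : nat -> M => upd a o (add (a o) (fn f (map a l))))).
  { intros n f l o L. apply DM_upd; [apply DM_id|]. apply DT_fn2; [dtac|apply DT_regs; auto]. }
  apply PRF_PRFs_ind.
  - intros n l o t L _ _ _ _. eapply Eff_weaken; [apply DA_Zs|apply DR; auto| |].
    + apply Eff_skip.
    + intros a _ _. split; auto. rewrite pra_Z by now rewrite length_map. rewrite add_0_r, upd_self; auto.
  - intros [|x [|]] o t L Hl Ho Hn U; try discriminate. simpl in U.
    assert (x < t) by (apply Hl; simpl; auto). simpl in Hn.
    eapply Eff_weaken; [apply DA_Zs|apply DR; auto|apply Eff_seq; [apply Eff_copy|apply Eff_inc]|];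
      try (simpl; lia).
    intros a F HZ. cbv beta. zeros HZ. simpl. repeat split; auto.
    extensionality j. updt. change (fn PS [a x]) with (su (a x)). now rewrite add_S_r.
  - intros n i e l o t L Hl Ho Hn U.
    assert (Hi : i < length l) by (rewrite L; apply Nat.ltb_lt; auto).
    assert (Hin : In (nth i l 0) l) by (apply nth_In; auto).
    assert (nth i l 0 < t) by auto. assert (nth i l 0 <> o) by (intros <-; auto). simpl in U |- *.
    eapply Eff_weaken; [apply DA_Zs|apply DR; auto|apply Eff_copy|]; try lia.
    intros a F HZ. zeros HZ. split; auto.
    rewrite pra_P by now rewrite length_map. rewrite nth_indep with (d' := a 0) by now rewrite length_map.
    now rewrite map_nth.
  - intros n k g IHg hs IHhs l o t L Hl Ho Hn U. simpl in U |- *.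
    assert (Lh : forall a, length (fns hs (map a l)) = k).
    { intros a. generalize (map a l). clear. intros xs. induction hs; simpl; auto. }
    eapply Eff_weaken; [apply DA_Zs|apply DR; auto| |].
    + apply Eff_seq; [apply (IHhs l t (t + k)); auto; lia|].
      apply Eff_seq; [apply (IHg (seq t k) o (t + k))|apply Eff_clears; lia]; try lia.
      * apply length_seq.
      * intros i Hi; apply in_seq in Hi; lia.
      * intros Hi; apply in_seq in Hi; lia.
    (* [a1] is the state once the inner values stand in t, ..., t + k - 1. It differs from a only
       there, so the output register receives g of these values and the final clearing restores the
       scratch space. *)
    + intros a F HZ. cbv beta. set (a1 := setl t (fns hs (map a l)) a).
      assert (E1 : map a1 (seq t k) = fns hs (map a l)).
      { unfold a1. replace (seq t k) with (seq t (length (fns hs (map a l)))) by now rewrite Lh. apply map_setl. }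
      assert (E2 : forall j, ~ (t <= j < t + k) -> a1 j = a j).
      { intros j Hj. unfold a1. apply setl_out. rewrite Lh; lia. }
      split; [split; [auto|split; [|auto]]|].
      * intros j Hj. rewrite E2 by (apply in_seq in Hj; lia). zeros HZ.
        apply HZ. apply in_seq in Hj; lia.
      * rewrite E1, pra_C by now rewrite length_map. extensionality j.
        destruct (classic (t <= j < t + k)) as [Hj|Hj].
        -- replace j with (t + (j - t)) at 1 by lia. rewrite setl_in by (rewrite repeat_length; lia).
           rewrite nth_repeat. rewrite upd_other by lia. zeros HZ. symmetry; apply HZ; lia.
        -- rewrite setl_out by (rewrite repeat_length; lia). unfold upd. rewrite !E2 by lia. auto.
  - intros n g IHg h IHh [|y l] o t L Hl Ho Hn U; [discriminate|]. injection L as L.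
    simpl in U. cbn [comp hd tl].
    assert (Hy : y < t) by (apply Hl; simpl; auto).
    assert (Hx : forall i, In i l -> i < t) by (intros; apply Hl; simpl; auto).
    assert (Hyo : y <> o) by (intros ->; apply Hn; simpl; auto).
    assert (NI : forall j, t <= j -> ~ In j l) by (intros j Hj Hi; apply Hx in Hi; lia).
    (* Layout of a recursion: t counts the rounds done, t + 1 those to come, t + 2 holds the value
       at t, t + 3 receives the next value, and scratch begins at t + 4. [LP] is the invariant; [LT]
       jumps to the end, where t has grown by the content of t + 1. *)
    set (LP := fun a : nat -> M => Zs (t + 3) a /\ a (t + 2) = fn (PR n g h) (a t :: map a l)).
    set (LT := fun a : nat -> M => upd (upd (upd a t (add (a t) (a (t + 1))))
                 (t + 2) (fn (PR n g h) (add (a t) (a (t + 1)) :: map a l))) (t + 1) zero).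
    assert (DLP : DA LP).
    { apply DQ_and; [apply _|apply DA_Zs|]. apply DQ_eq; [apply _|dtac|]. apply DT_regs1; auto. dtac. }
    assert (DLT : DM EV LT).
    { apply DM_upd; [apply DM_upd; [apply DM_upd; [apply DM_id|dtac]|]|dtac]. apply DT_regs1; auto. dtac. }
    assert (EL : Eff (Loop (t + 1) (Seq (comp h (t :: t + 2 :: l) (t + 3) (t + 4))
            (Seq (clear (t + 2)) (Seq (move (t + 3) (t + 2)) (Inc t))))) LP LT).
    { eapply Eff_loop; [lia|auto|auto| | |].
      - apply Eff_seq; [apply (IHh (t :: t + 2 :: l))|
          apply Eff_seq; [apply Eff_clear|apply Eff_seq; [apply Eff_move|apply Eff_inc]]]; try lia.
        + simpl; congruence.
        + simpl. intros i [<-|[<-|Hi]]; try lia. apply Hx in Hi; lia.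
        + simpl. intros [|[|Hi]]; try lia. apply Hx in Hi; lia.
      - intros a F [_ Ha] H1. unfold LT. rewrite H1, add_0_r, <- Ha.
        extensionality j. updt.
      - intros a F [HZ Ha]. cbv beta. zeros HZ.
        rewrite !upd_other in Ha by lia. rewrite map_upd in Ha by (apply NI; lia).
        assert (HZ' : forall j, t + 3 <= j -> a j = zero).
        { intros j Hj. rewrite <- (HZ j Hj). rewrite upd_other by lia. auto. }
        set (v := fn h (a t :: a (t + 2) :: map a l)).
        cbn [map]. fold v.
        assert (Hv : v = fn (PR n g h) (su (a t) :: map a l)).
        { rewrite pra_RS by now rewrite length_map. unfold v. now rewrite Ha. }
        (* One round amounts to storing the next value in t + 2 and raising t; the detour through t
           + 3 leaves nothing behind. *)
        match goal with |- _ /\ LP ?x /\ _ => assert (EB : x = upd (upd a (t + 2) v) t (su (a t))) end.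
        { extensionality j. updt; rewrite ?HZ' by lia; rewrite ?add_0_l; auto. }
        rewrite EB. split; [|split].
        + split; auto. intros j Hj. apply in_seq in Hj. apply HZ'; lia.
        + split.
          * intros j Hj. apply in_seq in Hj. rewrite !upd_other by lia. apply HZ'; lia.
          * rewrite upd_other, !upd_same by lia. rewrite !map_upd by (apply NI; lia). exact Hv.
        + unfold LT. rewrite !map_upd by (apply NI; lia).
          extensionality j. updt; rewrite ?add_S_l, ?add_S_r; auto. }
    eapply Eff_weaken; [apply DA_Zs|apply DR; simpl; congruence| |].
    + apply Eff_seq; [apply (Eff_copy y (t + 1) (t + 4)); lia|].
      apply Eff_seq; [apply (IHg l (t + 2) (t + 4)); auto; try lia; try (intros i Hi; apply Hx in Hi; lia); apply NI; lia|].
      apply Eff_seq; [apply EL|]. apply Eff_seq; [apply Eff_move; lia|apply Eff_clear; lia].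
    + intros a F HZ. zeros HZ. cbv beta. cbn [map].
      set (v := fn (PR n g h) (a y :: map a l)).
      assert (E0 : fn g (map a l) = fn (PR n g h) (zero :: map a l)).
      { rewrite pra_R0; auto. now rewrite length_map. }
      rewrite !map_upd by (apply NI; lia).
      match goal with |- (_ /\ _ /\ LP ?x /\ _) /\ _ =>
        assert (EB : x = upd (upd a (t + 1) (a y)) (t + 2) (fn g (map a l))) end.
      { extensionality j. updt; rewrite ?HZ by lia; rewrite ?add_0_l; auto. }
      rewrite EB. clear EB. split; [split; [|split; [|split]]|]; auto.
      * apply HZ; lia.
      * intros j Hj. apply in_seq in Hj. rewrite upd_other by lia. apply HZ; lia.
      * split; auto. intros j Hj. apply in_seq in Hj. rewrite !upd_other by lia. apply HZ; lia.
        rewrite upd_same, !upd_other by lia. rewrite !map_upd by (apply NI; lia).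
        rewrite HZ by lia. exact E0.
      * unfold LT. rewrite !map_upd by (apply NI; lia).
        extensionality j. updt; rewrite ?(HZ t), ?(HZ (t + 1)), ?(HZ (t + 2)) by lia; rewrite ?add_0_l; auto.
  - intros n l d t L Hl Ht U. simpl. eapply Eff_weaken; [apply DA_Zs|apply DM_id| |].
    + apply Eff_skip.
    + auto.
  - intros n k h IHh hs IHhs l d t L Hl Ht U. simpl in U |- *.
    assert (NI : ~ In d l) by (intros Hi; apply Hl in Hi; lia).
    eapply Eff_weaken; [apply DA_Zs| |apply Eff_seq; [apply (IHh l d t)|apply (IHhs l (S d) t)]|]; auto; try lia.
    + apply (DM_setl n k hs l L (S d) (fun a => upd a d (fn h (map a l)))). apply DM_upd; [apply DM_id|]. apply DT_regs; auto.
    + intros i Hi; apply Hl in Hi; lia.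
    + intros i Hi; apply Hl in Hi; lia.
    + intros a F HZ. zeros HZ. split; [split|].
      * intros j Hj. apply in_seq in Hj. apply HZ; lia.
      * intros j Hj. apply in_seq in Hj. rewrite upd_other by lia. apply HZ; lia.
      * rewrite map_upd by auto. rewrite HZ, add_0_l by lia. auto.
Qed.

End Model.
End Coding.

(** * Well-foundedness *)

Fixpoint mods (c : cmd) : list nat :=
  match c with
  | Skip => []
  | Inc i => [i]
  | Seq c1 c2 => mods c1 ++ mods c2
  | Loop i c => i :: mods c
  end.

(** Excludes bodies that could refill their own counter, which would give while loops. *)
Fixpoint wfc (c : cmd) : Prop :=
  match c with
  | Skip | Inc _ => True
  | Seq c1 c2 => wfc c1 /\ wfc c2
  | Loop i c => ~ In i (mods c) /\ wfc c
  end.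

Lemma mods_clears k : forall t j, In j (mods (clears t k)) -> t <= j.
Proof.
  induction k as [|k IH]; intros t j; simpl; [tauto|].
  intros [<-|H]; auto. apply IH in H; lia.
Qed.

(** Supplies the disjointness for [wfc_comp]: compiled code touches its arguments (which [copy]
    consumes and restores), its output and its scratch registers, so a loop counter outside these is
    safe. *)
Lemma mods_comp :
  (forall n (f : PRF n) l o t, length l = n -> forall j, In j (mods (comp f l o t)) -> In j l \/ j = o \/ t <= j) /\
  (forall n k (hs : PRFs n k) l d t, length l = n -> d + k <= t -> forall j, In j (mods (comps hs l d t)) -> In j l \/ d <= j).
Proof.
  apply PRF_PRFs_ind.
  - simpl; tauto.
  - intros [|x [|]] o t L j; try discriminate. simpl. intuition lia.
  - intros n i e l o t L j. simpl.
    assert (In (nth i l 0) l) by (apply nth_In; rewrite L; apply Nat.ltb_lt; auto).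
    intros H'. repeat destruct H' as [<-|H']; auto; tauto.
  - intros n k g IHg hs IHhs l o t L j. simpl. rewrite !in_app_iff. intros [H|[H|H]].
    + destruct (IHhs l t (t + k) L ltac:(lia) j H); auto.
    + destruct (IHg (seq t k) o (t + k) (length_seq _ _) j H) as [H1|[H1|H1]]; auto; [|lia].
      apply in_seq in H1; lia.
    + apply mods_clears in H; lia.
  - intros n g IHg h IHh [|y l] o t L j; [discriminate|]. injection L as L. simpl.
    rewrite !in_app_iff. simpl. rewrite !in_app_iff. simpl.
    intros H. repeat match type of H with _ \/ _ => destruct H as [H|H] end; try subst j; auto; try lia; try tauto.
    + destruct (IHg _ _ _ L j H) as [H1|[H1|H1]]; auto; lia.
    + destruct (IHh (t :: t + 2 :: l) _ _ (f_equal (fun z => S (S z)) L) j H) as [[H1|[H1|H1]]|[H1|H1]]; auto; lia.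
  - simpl; tauto.
  - intros n k h IHh hs IHhs l d t L Hd j. simpl. rewrite in_app_iff. intros [H|H].
    + destruct (IHh _ _ _ L j H) as [H1|[H1|H1]]; auto; lia.
    + destruct (IHhs l (S d) t L ltac:(lia) j H); auto; lia.
Qed.

Lemma wfc_clears k : forall t, wfc (clears t k).
Proof. induction k; simpl; auto. Qed.

Lemma wfc_comp :
  (forall n (f : PRF n) l o t, length l = n -> (forall i, In i l -> i < t) -> o < t -> ~ In o l -> wfc (comp f l o t)) /\
  (forall n k (hs : PRFs n k) l d t, length l = n -> (forall i, In i l -> i < d) -> d + k <= t -> wfc (comps hs l d t)).
Proof.
  apply PRF_PRFs_ind.
  - simpl; auto.
  - intros [|x [|]] o t L Hl Ho Hn; try discriminate. simpl in *. assert (x < t) by auto. intuition lia.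
  - intros n i e l o t L Hl Ho Hn. simpl.
    assert (In (nth i l 0) l) by (apply nth_In; rewrite L; apply Nat.ltb_lt; auto).
    assert (nth i l 0 < t) by auto. assert (nth i l 0 <> o) by (intros <-; auto). intuition lia.
  - intros n k g IHg hs IHhs l o t L Hl Ho Hn. simpl. split; [|split].
    + apply IHhs; auto.
    + apply IHg; [apply length_seq| | |]; try lia; rewrite ?in_seq; [|lia].
      intros i Hi; apply in_seq in Hi; lia.
    + apply wfc_clears.
  - intros n g IHg h IHh [|y l] o t L Hl Ho Hn; [discriminate|]. injection L as L. simpl.
    assert (y < t) by (apply Hl; simpl; auto).
    assert (Hx : forall i, In i l -> i < t) by (intros; apply Hl; simpl; auto).
    assert (y <> o) by (intros ->; apply Hn; simpl; auto).
    assert (L2 : length (t :: t + 2 :: l) = S (S n)) by (simpl; congruence).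
    repeat split; try (simpl; intuition lia).
    + apply IHg; auto; try lia.
      * intros i Hi; apply Hx in Hi; lia.
      * intros Hi; apply Hx in Hi; lia.
    + rewrite !in_app_iff; simpl. intros HH.
      repeat match type of HH with _ \/ _ => destruct HH as [HH|HH] end; try lia; try tauto.
      destruct (proj1 mods_comp _ h (t :: t + 2 :: l) _ _ L2 _ HH) as [[H1|[H1|H1]]|[H1|H1]]; try lia.
      apply Hx in H1; lia.
    + apply IHh; auto; try lia.
      * simpl. intros i [<-|[<-|Hi]]; try lia. apply Hx in Hi; lia.
      * simpl. intros [Hi|[Hi|Hi]]; try lia. apply Hx in Hi; lia.
  - simpl; auto.
  - intros n k h IHh hs IHhs l d t L Hl Hd. simpl. split.
    + apply IHh; auto; try lia.
      * intros i Hi; apply Hl in Hi; lia.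
      * intros Hi; apply Hl in Hi; lia.
    + apply IHhs; auto; try lia. intros i Hi; apply Hl in Hi; lia.
Qed.

Lemma add_nat (x y : nat) : @add natI x y = x + y.
Proof. induction x; [reflexivity|]. change (@add natI (S x) y) with (S (@add natI x y)). now rewrite IHx. Qed.

Lemma mul_nat (x y : nat) : @mul natI x y = x * y.
Proof.
  induction x; [reflexivity|]. change (@mul natI (S x) y) with (@add natI (@mul natI x y) y).
  rewrite add_nat, IHx. simpl; lia.
Qed.

Lemma num_nat n : @num natI n = n.
Proof. induction n; simpl; auto. Qed.

Lemma pow_nat c (x : nat) : @pow natI c x = c ^ x.
Proof.
  induction x; [apply (@pow_0 natI _ c)|].
  change (S x) with (@su natI x). rewrite (@pow_S natI _), mul_nat, num_nat, IHx. reflexivity.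
Qed.

(** The factor [1 + d * h] is coprime to d. In the step, the quotient left by the induction
    hypothesis turns out to be divisible by one more d. *)
Lemma pow_divide_coprime d h n : forall N, Nat.divide (d ^ n) ((1 + d * h) * N) -> Nat.divide (d ^ n) N.
Proof.
  induction n as [|n IH]; intros N H; [exists N; simpl; lia|].
  destruct (Nat.eq_dec d 0) as [->|D]; [simpl in *; rewrite Nat.add_0_r in H; auto|].
  destruct (IH N) as [q Hq].
  { destruct H as [z Hz]. exists (z * d). rewrite Hz. simpl. ring. }
  subst N. destruct H as [z Hz]. rewrite Nat.pow_succ_r' in *.
  assert (E : q + d * (h * q) = d * z).
  { apply Nat.mul_cancel_r with (p := d ^ n); [apply Nat.pow_nonzero; auto|].
    transitivity ((1 + d * h) * (q * d ^ n)); [ring|]. rewrite Hz; ring. }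
  destruct (Nat.divide_add_cancel_r d (d * (h * q)) q) as [u Hu].
  - apply Nat.divide_factor_l.
  - exists z. lia.
  - exists u. rewrite Hu. ring.
Qed.

(** * Termination from arbitrary configurations *)

Section Termination.
Variables (m : nat) (b md : nat -> nat).
Hypothesis md_gt : forall i, i < m -> 1 < md i.
Hypothesis b_self : forall i, i < m -> exists g, b i = md i * S g.
Hypothesis b_other : forall i j, i < m -> j < m -> i <> j -> exists h, b j = 1 + md i * h.

Definition NStep (r : nat -> nat -> option op) (p' p : nat * nat) : Prop :=
  @Step b natI r (fst p) (snd p) (fst p') (snd p').

Lemma oprel_nat up p e (W W' : nat) : @oprel b natI (OLin up p e) W W' ->
  if up then W' = p * W + e else W = p * W' + e.
Proof. destruct up; cbn [oprel]; intros ->; now rewrite add_nat, mul_nat, !num_nat. Qed.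

Lemma b_pos1 i : i < m -> 1 < b i.
Proof. intros H. destruct (b_self i H) as [g Hg]. pose proof (md_gt i H). nia. Qed.

(** The equivalence covers increments and decrements of the registers in l alike, the two being
    inverse to each other. *)
Definition stable (Phi : nat -> Prop) (l : list nat) : Prop :=
  forall j, In j l -> forall W, Phi W <-> Phi (b j * W + (b j - 1)).

Lemma mods_used c j : In j (mods c) -> j < used c.
Proof.
  induction c; simpl; try tauto; [intuition lia| |intros [<-|H]; [lia|apply IHc in H; lia]].
  rewrite in_app_iff. intros [H|H]; [apply IHc1 in H|apply IHc2 in H]; lia.
Qed.

Lemma stable_ndiv l i n : i < m -> (forall j, In j l -> j < m /\ j <> i) ->
  stable (fun W => ~ Nat.divide (md i ^ n) (W + 1)) l.
Proof.
  intros Hi Hl j Hj W. destruct (Hl j Hj) as [H1 H2]. destruct (b_other i j) as [h Hh]; auto.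
  pose proof (b_pos1 j H1).
  replace (b j * W + (b j - 1) + 1) with (b j * (W + 1)) by (rewrite Nat.mul_add_distr_l; lia). rewrite Hh.
  split; intros H3 H4; apply H3.
  - apply pow_divide_coprime in H4; auto.
  - apply Nat.divide_mul_r; auto.
Qed.

Variable r : nat -> nat -> option op.

(** Phi is a property that the program cannot change, and accessibility is assumed only at exits
    where it holds. For the body of a loop, Phi is strengthened by a bound on the exponent of [md i]
    in W + 1: the body keeps the bound ([stable_ndiv]), and each entry into the body lowers it. *)
Lemma acc_entry c : forall e (Phi : nat -> Prop), emb b md r c e -> wfc c -> used c <= m -> stable Phi (mods c) ->
  (forall W, Phi W -> Acc (NStep r) (e + size c, W)) -> forall W, Phi W -> Acc (NStep r) (e, W).
Proof.
  induction c as [|i|c1 IH1 c2 IH2|i c IH]; intros e Phi He Hw Hu Hs HA W HW.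
  - simpl in HA. rewrite Nat.add_0_r in HA; auto.
  - constructor. intros [s' W'] (o & Ho & Hr). simpl in Ho. cbn [fst snd] in Hr. rewrite He in Ho by (simpl; lia). simpl in Ho.
    rewrite Nat.eqb_refl in Ho. destruct (Nat.eqb_spec s' (e + 1)) as [->|]; [|discriminate].
    inversion Ho; subst o. apply oprel_nat in Hr. subst W'. apply HA.
    apply (proj1 (Hs i (or_introl eq_refl) W)); auto.
  - apply emb_seq in He as [He1 He2]. destruct Hw as [Hw1 Hw2]. simpl in Hu.
    assert (S1 : stable Phi (mods c1)) by (intros j Hj; apply Hs; simpl; apply in_app_iff; auto).
    assert (S2 : stable Phi (mods c2)) by (intros j Hj; apply Hs; simpl; apply in_app_iff; auto).
    apply (IH1 e Phi); auto; [lia|]. intros V HV. apply (IH2 _ Phi); auto; [lia|].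
    intros U HU. rewrite <- Nat.add_assoc. apply HA; auto.
  - destruct Hw as [Hn Hw]. simpl in Hu. assert (Hi : i < m) by lia.
    pose proof (emb_loop _ _ _ _ _ _ He) as Hb.
    (* Here n is a strict bound on the exponent; it cannot be zero, as 1 divides everything. *)
    assert (G : forall n W, Phi W -> ~ Nat.divide (md i ^ n) (W + 1) -> Acc (NStep r) (e, W)).
    { induction n as [|n IHn]; intros V HV HD; [elim HD; exists (V + 1); simpl; lia|].
      constructor. intros [s' W'] (o & Ho & Hr). cbn [fst snd] in Ho, Hr. rewrite (emb_head _ _ _ _ _ _ _ He) in Ho.
      destruct (Nat.eqb_spec s' (e + 1)) as [->|].
      - inversion Ho; subst o. apply oprel_nat in Hr. subst V.
        apply (IH (e + 1) (fun W => Phi W /\ ~ Nat.divide (md i ^ n) (W + 1))); auto; [lia| | |].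
        + assert (Hm : forall j, In j (mods c) -> j < m /\ j <> i).
          { intros j Hj. split; [apply mods_used in Hj; lia|]. intros ->; auto. }
          intros j Hj V. pose proof (stable_ndiv (mods c) i n Hi Hm j Hj V).
          pose proof (Hs j (or_intror Hj) V). tauto.
        + intros V [HV1 HV2]. constructor. intros [s' W''] (o & Ho' & Hr). cbn [fst snd] in Ho', Hr.
          rewrite (emb_back _ _ _ _ _ _ _ He) in Ho'. destruct (Nat.eqb_spec s' e) as [->|]; [|discriminate].
          inversion Ho'; subst o. apply oprel_nat in Hr.
          replace W'' with V by lia. auto.
        + split; [apply (proj2 (Hs i (or_introl eq_refl) W')); auto|]. intros [q Hq]. apply HD.
          destruct (b_self i Hi) as [g Hg]. pose proof (b_pos1 i Hi).
          exists (S g * q). rewrite Nat.pow_succ_r'.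
          replace (b i * W' + (b i - 1) + 1) with (b i * (W' + 1)) by (rewrite Nat.mul_add_distr_l; lia). rewrite Hq, Hg. ring.
      - destruct (Nat.eqb_spec s' (e + size c + 2)) as [->|]; [|discriminate]. inversion Ho; subst o.
        apply oprel_nat in Hr. rewrite Nat.add_0_r in Hr.
        constructor. intros [s'' W''] (o & Ho' & Hr'). cbn [fst snd] in Ho', Hr'.
        rewrite (emb_mid _ _ _ _ _ _ _ He) in Ho'. destruct (Nat.eqb_spec s'' (e + size c + 3)) as [->|]; [|discriminate].
        inversion Ho'; subst o. apply oprel_nat in Hr'. rewrite Nat.add_0_r in Hr'.
        subst. rewrite <- Nat.add_assoc. apply HA; auto. }
    (* A first bound on the exponent: [md i] to the power W + 1 exceeds W + 1. *)
    apply (G (W + 1)); auto. intros HD. apply Nat.divide_pos_le in HD; [|lia].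
    pose proof (Nat.pow_gt_lin_r (md i) (W + 1) (md_gt i Hi)). lia.
Qed.

(** A run may also start in the interior of a loop body. It can leave the body only by the jump back
    to the head, where [acc_entry] with the trivial property applies. *)
Lemma acc_all c : forall e, emb b md r c e -> wfc c -> used c <= m ->
  (forall W, Acc (NStep r) (e + size c, W)) -> forall s, e <= s < e + size c -> forall W, Acc (NStep r) (s, W).
Proof.
  induction c as [|i|c1 IH1 c2 IH2|i c IH]; intros e He Hw Hu HA s Hs W.
  - simpl in Hs; lia.
  - simpl in Hs. replace s with e by lia.
    apply (acc_entry (Inc i) e (fun _ => True)); auto. intros j _ V; tauto.
  - destruct (emb_seq _ _ _ _ _ _ He) as [He1 He2]. destruct Hw as [Hw1 Hw2]. simpl in Hu, Hs, HA.
    assert (H2 : forall s, e + size c1 <= s < e + size c1 + size c2 -> forall W, Acc (NStep r) (s, W)).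
    { intros s1 Hs1 V. apply (IH2 (e + size c1)); auto; try lia. intros U. rewrite <- Nat.add_assoc; auto. }
    destruct (Nat.lt_ge_cases s (e + size c1)).
    + apply (IH1 e); auto; try lia. intros V. destruct (size c2) as [|k] eqn:Ek.
      * rewrite Nat.add_0_r in HA; auto.
      * apply H2; lia.
    + apply H2; lia.
  - assert (Hhead : forall W, Acc (NStep r) (e, W)).
    { intros V. apply (acc_entry (Loop i c) e (fun _ => True)); auto. intros j _ U; tauto. }
    destruct Hw as [Hn Hw]. simpl in Hu, Hs. pose proof (emb_loop _ _ _ _ _ _ He) as Hb.
    assert (Hback : forall W, Acc (NStep r) (e + 1 + size c, W)).
    { intros V. constructor. intros [s' W'] (o & Ho & _). cbn [fst] in Ho. rewrite (emb_back _ _ _ _ _ _ _ He) in Ho. destruct (Nat.eqb_spec s' e) as [->|]; [auto|discriminate]. }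
    destruct (Nat.eq_dec s e) as [->|]; [auto|].
    destruct (Nat.lt_ge_cases s (e + 1 + size c)); [apply (IH (e + 1)); auto; lia|].
    destruct (Nat.eq_dec s (e + 1 + size c)) as [->|]; [auto|].
    replace s with (e + size c + 2) by lia.
    constructor. intros [s' W'] (o & Ho & _). cbn [fst] in Ho. rewrite (emb_mid _ _ _ _ _ _ _ He) in Ho. destruct (Nat.eqb_spec s' (e + size c + 3)) as [->|]; [|discriminate].
    simpl in HA. rewrite Nat.add_assoc in HA. auto.
Qed.
End Termination.

Ltac rl_cases :=
  repeat match goal with
  | H : context [Nat.eqb ?u ?v] |- _ => destruct (Nat.eqb_spec u v)
  | H : context [Nat.ltb ?u ?v] |- _ => destruct (Nat.ltb_spec u v)
  | H : None = Some _ |- _ => discriminate H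
  | H : Some _ = Some _ |- _ => injection H as H; subst
  end.

(** * The machine with its reset *)

Section Machine.
Variables (m : nat) (b md : nat -> nat).
Hypothesis md_gt : forall i, i < m -> 1 < md i.
Hypothesis b_self : forall i, i < m -> exists g, b i = md i * S g.
Hypothesis b_other : forall i j, i < m -> j < m -> i <> j -> exists h, b j = 1 + md i * h.

(** The decrement of register 1 at the exit of c doubles as the test that the output is nonzero; the
    extra state after it performs the reset. *)
Definition mach (c : cmd) (s s' : nat) : option op :=
  if s <? size c then rl b md c 0 s s'
  else if s =? size c then if s' =? size c + 1 then Some (oDec b 1) else None
  else if s =? size c + 1 then if s' =? 0 then Some ORst else None
  else None.

Lemma rl_range c : forall e s s' o, rl b md c e s s' = Some o ->
  e <= s < e + size c /\ s' <= e + size c.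
Proof.
  induction c; intros e s s' o H; simpl in H |- *; rl_cases; try lia;
    (apply IHc1 in H || apply IHc2 in H || apply IHc in H); lia.
Qed.

Lemma mach_range c s s' o : mach c s s' = Some o -> s <= size c + 1 /\ s' <= size c + 1.
Proof. unfold mach. intros H. rl_cases; try lia. apply rl_range in H; lia. Qed.

Lemma emb_mach c : emb b md (mach c) c 0.
Proof. intros s s' _ H. unfold mach. destruct (Nat.ltb_spec s (size c)); auto; lia. Qed.

Lemma oprel_up_det p e W W1 W2 : @oprel b natI (OLin true p e) W W1 -> @oprel b natI (OLin true p e) W W2 -> W1 = W2.
Proof. intros H1 H2. apply oprel_nat in H1, H2. congruence. Qed.

Lemma oprel_down_det p e W W1 W2 : 0 < p ->
  @oprel b natI (OLin false p e) W W1 -> @oprel b natI (OLin false p e) W W2 -> W1 = W2.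
Proof. intros Hp H1 H2. apply oprel_nat in H1, H2. apply (Nat.mul_cancel_l _ _ p); lia. Qed.

(** A decrement requires [md i] to divide W + 1, a successful test requires it to divide W. *)
Lemma dec_test_excl i W W1 W2 : i < m ->
  @oprel b natI (oDec b i) W W1 -> @oprel b natI (oTest md i) W W2 -> False.
Proof.
  intros Hi H1 H2. apply oprel_nat in H1, H2. destruct (b_self i Hi) as [g Hg]. pose proof (md_gt i Hi).
  assert (Hb : 0 < b i) by nia.
  assert (E : W + 1 = md i * (S g * (W1 + 1))) by (rewrite Nat.mul_assoc, <- Hg, Nat.mul_add_distr_l; lia).
  set (x := S g * (W1 + 1)) in *. destruct (Nat.le_gt_cases x W2) as [L|L].
  - apply (Nat.mul_le_mono_l _ _ (md i)) in L. lia.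
  - apply (Nat.mul_le_mono_l _ _ (md i)) in L. rewrite Nat.mul_succ_r in L. lia.
Qed.

(** [Leads] provides one successor inside a set; determinism makes it the only one, so that the set
    confines the actual run. *)
Lemma step_det c : used c <= m -> forall e s W s1 W1 s2 W2,
  @Step b natI (rl b md c e) s W s1 W1 -> @Step b natI (rl b md c e) s W s2 W2 -> s1 = s2 /\ W1 = W2.
Proof.
  induction c as [|i|c1 IH1 c2 IH2|i c IH]; intros Hu e s W s1 W1 s2 W2 (o1 & H1 & R1) (o2 & H2 & R2); simpl in *.
  - discriminate.
  - rl_cases. split; auto. eapply oprel_up_det; eauto.
  - destruct (Nat.ltb_spec s (e + size c1)).
    + apply (IH1 ltac:(lia) e s W); [exists o1|exists o2]; auto.
    + apply (IH2 ltac:(lia) (e + size c1) s W); [exists o1|exists o2]; auto.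
  - assert (Hi : i < m) by lia. pose proof (md_gt i Hi). pose proof (b_pos1 m b md md_gt b_self i Hi).
    rl_cases; try lia; try (exfalso; eapply dec_test_excl; eauto; fail);
      try (split; [reflexivity|]; (eapply oprel_up_det; eassumption) ||
             (eapply oprel_down_det; [|eassumption|eassumption]; lia)).
    apply (IH ltac:(lia) (e + 1) s W); [exists o1|exists o2]; auto.
Qed.

Lemma prodr_single {M : Interp} {HM : PRA M} n (x : M) : prodr b (S n) (upd (fun _ => zero) 0 x) = pow (b 0) x.
Proof.
  induction n as [|n IH].
  - simpl. apply mul_1_l.
  - change (mul (prodr b (S n) (upd (fun _ => zero) 0 x)) (pow (b (S n)) zero) = pow (b 0) x).
    rewrite IH, pow_0, mul_comm. apply mul_1_l.
Qed.

Variable f : PRF 1.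
Let c := comp f [0] 1 2.
Hypothesis used_c : used c <= m.
Hypothesis m_ge2 : 2 <= m.

Lemma wfc_c : wfc c.
Proof. apply wfc_comp; simpl; auto; intuition lia. Qed.

Lemma run_c {M : Interp} {HM : PRA M} r (Q : (nat -> M) -> Prop) : emb b md r c 0 -> DQ Delta0 EV Q ->
  Leads b r (Cfg m b 0 (fun a => (forall j, 2 <= j -> a j = zero) /\ Q (upd a 1 (add (a 1) (fn f [a 0])))))
      (Cfg m b (size c) Q).
Proof.
  intros He HQ.
  assert (E : Eff m b md r c (Zs m 2) (fun a : nat -> M => upd a 1 (add (a 1) (fn f (map a [0]))))).
  { apply (proj1 (comp_spec m b md md_gt b_self b_other r)); simpl; auto; intuition lia. }
  destruct E as [_ _ E]. specialize (E 0 He Q HQ). eapply Leads_incl; [|exact E].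
  apply Cfg_mono. intros a Fa [H1 H2]. split; auto. apply Zs_iff; auto.
Qed.

Lemma DQ_out {M : Interp} : DQ Delta0 EV (fun a : nat -> M => a 1 = zero).
Proof. dtac. Qed.

(** Without the reset everything is accessible ([A0]). An honest run ends with output zero, where
    the decrement is blocked by [dec_test_excl] ([A1]). Resets lead to honest starts ([A2]), hence
    the two extra states are accessible ([A3], [A4]), and with them all configurations. *)
Theorem mach_wf : (forall x, eval f [x] = 0) -> forall p, Acc (NStep b (mach c)) p.
Proof.
  intros Hf.
  pose proof (run_c (M := natI) (rl b md c 0) (fun a => a 1 = zero) ltac:(intros s s' _ _; auto) DQ_out) as (B & _ & IB & SB).
  assert (A0 : forall p, Acc (NStep b (rl b md c 0)) p).
  { assert (Out : forall s W, size c <= s -> Acc (NStep b (rl b md c 0)) (s, W)).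
    { intros s W Hs. constructor. intros [s' W'] (o & Ho & _). apply rl_range in Ho. simpl in Ho; lia. }
    intros [s W]. destruct (Nat.lt_ge_cases s (size c)); auto.
    apply (acc_all m b md md_gt b_self b_other (rl b md c 0) c 0); auto using wfc_c; [intros ? ? _ _; auto|lia]. }
  assert (A1 : forall p, (B (fst p) (snd p) \/ Cfg m b (size c) (fun a : nat -> natI => a 1 = zero) (fst p) (snd p)) ->
                 Acc (NStep b (mach c)) p).
  (* Accessibility without the reset is the induction measure: at states below [size c] both
     relations have the same successors. *)
  { intros p. induction (A0 p) as [[s W] _ IH]. simpl. intros [H|H].
    - destruct (SB s W H) as (s1 & W1 & St & H1).
      assert (Hs : s < size c) by (destruct St as (o & Ho & _); apply rl_range in Ho; lia).
      constructor. intros [s2 W2] (o & Ho & Hr). cbn [fst snd] in Ho, Hr. rewrite emb_mach in Ho by (simpl; lia).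
      destruct (step_det c used_c 0 s W s1 W1 s2 W2 St) as [<- <-]; [exists o; auto|].
      apply (IH (s1, W1)); auto.
    - destruct H as (-> & a & Fa & HW & Ha). constructor. intros [s2 W2] (o & Ho & Hr). cbn [fst snd] in Ho, Hr.
      exfalso. unfold mach in Ho. rewrite Nat.ltb_irrefl, Nat.eqb_refl in Ho.
      destruct (s2 =? size c + 1); [|discriminate]. inversion Ho; subst o.
      destruct (oprel_test m b md md_gt b_other 1 a W ltac:(lia) Ha HW) as (U & HU & _).
      eapply (dec_test_excl 1); eauto. }
  assert (A2 : forall x W : natI, su W = pow (b 0) x -> Acc (NStep b (mach c)) (0, W)).
  { intros x W H. apply A1. simpl. apply IB. split; auto. exists (upd (fun _ => zero) 0 x). split; [|split; [|split]].
    - intros j Hj. rewrite upd_other by lia. auto.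
    - rewrite H. destruct m as [|m']; [lia|]. symmetry; apply (@prodr_single natI _).
    - intros j Hj. rewrite upd_other by lia. auto.
    - rewrite upd_same. rewrite upd_other by lia. rewrite upd_same. rewrite add_nat. simpl. rewrite Hf. reflexivity. }
  assert (A3 : forall W, Acc (NStep b (mach c)) (size c + 1, W)).
  { intros W. constructor. intros [s W'] (o & Ho & Hr). cbn [fst snd] in Ho, Hr. unfold mach in Ho.
    destruct (Nat.ltb_spec (size c + 1) (size c)); [lia|].
    destruct (Nat.eqb_spec (size c + 1) (size c)); [lia|]. rewrite Nat.eqb_refl in Ho.
    destruct (Nat.eqb_spec s 0) as [->|]; [|discriminate]. inversion Ho; subst o. destruct Hr as [x Hx]. eauto. }
  assert (A4 : forall W, Acc (NStep b (mach c)) (size c, W)).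
  { intros W. constructor. intros [s W'] (o & Ho & Hr). cbn [fst snd] in Ho, Hr. unfold mach in Ho.
    rewrite Nat.ltb_irrefl, Nat.eqb_refl in Ho.
    destruct (Nat.eqb_spec s (size c + 1)) as [->|]; [auto|discriminate]. }
  intros [s W]. destruct (Nat.lt_ge_cases s (size c)).
  - apply (acc_all m b md md_gt b_self b_other (mach c) c 0); auto using wfc_c, emb_mach; lia.
  - constructor. intros [s' W'] (o & Ho & Hr). cbn [fst snd] in Ho, Hr.
    destruct (mach_range _ _ _ _ Ho) as [Hs Hs'].
    destruct (Nat.eq_dec s' (size c)) as [->|]; [auto|].
    destruct (Nat.eq_dec s' (size c + 1)) as [->|]; [auto|].
    apply (acc_all m b md md_gt b_self b_other (mach c) c 0); auto using wfc_c, emb_mach; lia.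
Qed.

(* If [f] took a nonzero value at [x], the configurations on the path through the reset
   would form a nonempty definable set without minimal element. *)
Theorem mach_loop {M : Interp} {HM : PRA M} (x : M) : fn f [x] <> zero ->
  exists B : nat -> M -> Prop, (forall s, DQ Delta0 E1 (B s)) /\ (exists s W, B s W) /\
    (forall s W, B s W -> exists s' W', Step b (mach c) s W s' W' /\ B s' W').
Proof.
  intros Hx.
  (* Register 0 still holds the input when the program ends, so the reset can choose the same value
     again. Positivity of the output is stated as the equation that [oprel_dec] uses. *)
  set (Q := fun a : nat -> M => a 1 = su (pre (a 1)) /\ fn f [a 0] <> zero).
  assert (DQQ : DQ Delta0 EV Q) by (unfold Q; dtac).
  destruct (run_c (mach c) Q (emb_mach c) DQQ) as (B & DB & IB & SB).
  set (Q1 := fun a : nat -> M => fn f [a 0] <> zero).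
  assert (DQ1 : DQ Delta0 EV Q1) by (unfold Q1; dtac).
  exists (fun s W => B s W \/ Cfg m b (size c) Q s W \/ Cfg m b (size c + 1) Q1 s W).
  assert (St : forall y W : M, fn f [y] <> zero -> su W = pow (b 0) y -> B 0 W \/ Cfg m b (size c) Q 0 W).
  { intros y W Hy HW. apply IB. split; auto. exists (upd (fun _ => zero) 0 y). split; [|split; [|split]].
    - intros j Hj. rewrite upd_other by lia. auto.
    - rewrite HW. destruct m as [|m']; [lia|]. symmetry; apply prodr_single.
    - intros j Hj. rewrite upd_other by lia. auto.
    - unfold Q. rewrite !upd_same. rewrite (upd_other _ 1) by lia. rewrite upd_same.
      rewrite upd_other by lia. rewrite add_0_l. split; auto.
      destruct (case0 (fn f [y])); [contradiction|auto]. }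
  assert (Wx : forall y : M, exists W, su W = pow (b 0) y).
  { intros y. destruct (b_self 0) as [g Hg]; [lia|]. pose proof (md_gt 0 ltac:(lia)).
    destruct (b 0) as [|u] eqn:Eb; [nia|]. destruct (pow_pos u y) as [w Hw]. eauto. }
  split; [|split].
  - intros s. repeat (apply DQ_or; [apply _| |]); auto.
    + eapply DQ_Cfg; eauto.
    + eapply DQ_Cfg; eauto.
  - destruct (Wx x) as [W HW]. exists 0, W. destruct (St x W Hx HW); auto.
  - intros s W [H|[H|H]].
    + destruct (SB s W H) as (s' & W' & S' & [H'|H']); exists s', W'; split; auto.
    + destruct H as (-> & a & Fa & HW & Ha1 & Ha2).
      destruct (prodr_pre m b md md_gt b_self (upd a 1 (pre (a 1)))) as [W' HW'].
      exists (size c + 1), W'. split.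
      * exists (oDec b 1). split.
        -- unfold mach. now rewrite Nat.ltb_irrefl, !Nat.eqb_refl.
        -- eapply oprel_dec; eauto.
      * right; right. split; auto. exists (upd a 1 (pre (a 1))). split; [|split; auto].
        -- intros j Hj. rewrite upd_other by lia. auto.
    + destruct H as (-> & a & Fa & HW & Ha). destruct (Wx (a 0)) as [W' HW'].
      exists 0, W'. split.
      * exists ORst. split; [|simpl; eauto]. unfold mach.
        destruct (Nat.ltb_spec (size c + 1) (size c)); [lia|].
        destruct (Nat.eqb_spec (size c + 1) (size c)); [lia|]. now rewrite !Nat.eqb_refl.
      * destruct (St (a 0) W' Ha HW'); auto.
Qed.
End Machine.

(** * The automaton *)

(** Here [S (syl n)] is Sylvester's sequence 2, 3, 7, 43, ...: each term is one more than the
    product of the earlier ones, which makes the terms pairwise coprime. *)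
Fixpoint syl (n : nat) : nat := match n with O => 1 | S n => syl n * S (syl n) end.

Lemma syl_pos n : 0 < syl n.
Proof. induction n; simpl; nia. Qed.

Lemma syl_divide i j : i < j -> Nat.divide (S (syl i)) (syl j).
Proof.
  induction 1 as [|j H IH]; simpl.
  - apply Nat.divide_factor_r.
  - apply Nat.divide_mul_l; auto.
Qed.

Lemma gcd_1_intro a c : (forall g, Nat.divide g a -> Nat.divide g c -> g = 1) -> Nat.gcd a c = 1.
Proof. intros H; apply H; [apply Nat.gcd_divide_l|apply Nat.gcd_divide_r]. Qed.

Lemma syl_coprime i j : i <> j -> Nat.gcd (S (syl i)) (S (syl j)) = 1.
Proof.
  assert (A : forall i j, i < j -> Nat.gcd (S (syl i)) (S (syl j)) = 1).
  { clear. intros i j H. apply gcd_1_intro. intros g H1 H2. apply Nat.divide_1_r.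
    apply (Nat.divide_add_cancel_r g (syl j) 1).
    - eapply Nat.divide_trans; [exact H1|apply syl_divide; auto].
    - now rewrite Nat.add_1_r. }
  intros H. destruct (Nat.lt_gt_cases i j) as [[L|L] _]; auto.
  rewrite Nat.gcd_comm; auto.
Qed.

Fixpoint prod_except (i n : nat) : nat :=
  match n with O => 1 | S n => (if n =? i then 1 else S (syl n)) * prod_except i n end.

Lemma prod_except_divide i j n : j < n -> j <> i -> Nat.divide (S (syl j)) (prod_except i n).
Proof.
  induction n as [|n IH]; intros H N; [lia|]. cbn [prod_except].
  destruct (Nat.eq_dec j n) as [->|].
  - apply Nat.eqb_neq in N; rewrite N. apply Nat.divide_factor_l.
  - apply Nat.divide_mul_r, IH; auto; lia.
Qed.

Lemma prod_except_coprime i n : Nat.gcd (S (syl i)) (prod_except i n) = 1.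
Proof.
  induction n as [|n IH]; cbn [prod_except]; [apply gcd_1_intro; intros g _ H; now apply Nat.divide_1_r|].
  destruct (Nat.eqb_spec n i) as [->|N]; [now rewrite Nat.mul_1_l|].
  apply gcd_1_intro. intros g H1 H2. rewrite <- IH. apply Nat.divide_antisym.
  - apply Nat.gcd_greatest; auto. apply Nat.gauss with (m := S (syl n)); auto.
    apply gcd_1_intro. intros h H3 H4. apply Nat.divide_1_r. rewrite <- (syl_coprime i n) by auto.
    apply Nat.gcd_greatest; auto. exact (Nat.divide_trans _ _ _ H3 H1).
  - rewrite IH. apply Nat.divide_1_l.
Qed.

(** The lower bound L makes room for the program states among the letters, of which there will be
    [b 0]. *)
Lemma crt_exists m L : exists b md : nat -> nat,
  (forall i, i < m -> 1 < md i) /\ (forall i, i < m -> exists g, b i = md i * S g) /\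
  (forall i j, i < m -> j < m -> i <> j -> exists h, b j = 1 + md i * h) /\ (forall i, L <= b i).
Proof.
  assert (E : forall i, exists x, (exists g, x = S (syl i) * S g) /\
    (forall j, j < m -> j <> i -> exists h, x = 1 + S (syl j) * h) /\ L <= x).
  { intros i. destruct (Nat.gcd_bezout_pos (S (syl i)) (prod_except i m)) as (a & v & E); [lia|].
    rewrite prod_except_coprime in E.
    assert (Hp : 0 < prod_except i m).
    { clear. induction m; cbn [prod_except]; [lia|]. destruct (_ =? i); nia. }
    (* By Bezout, a inverts the modulus of i modulo the product of the others, so the first summand
       is 1 modulo each of these. The second summand is zero modulo all of them and lifts the number
       above L. *)
    exists (S (syl i) * (a + S L * prod_except i m)). split; [|split].
    - exists (a + S L * prod_except i m - 1). f_equal. nia.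
    - intros j Hj N. destruct (prod_except_divide i j m Hj N) as [w Hw]. rewrite Hw in *.
      exists (v * w + S (syl i) * (S L * w)). rewrite Nat.mul_add_distr_l, (Nat.mul_comm _ a), E. ring.
    - nia. }
  exists (fun i => proj1_sig (constructive_indefinite_description _ (E i))), (fun i => S (syl i)).
  split; [|split; [|split]]; intros i.
  - intros _. pose proof (syl_pos i); lia.
  - intros _. apply (proj2_sig (constructive_indefinite_description _ (E i))).
  - intros j Hi Hj N. apply (proj2_sig (constructive_indefinite_description _ (E j))); auto.
  - apply (proj2_sig (constructive_indefinite_description _ (E i))).
Qed.

(* [ALin up p e] means that the unread parts U, V of the two words, taken in the order given
   by [up], must satisfy V = p U + e. *)
Inductive ast : Type :=
| AInit : ast
| ADead : ast
| ARst : ast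
| ALin : bool -> nat -> nat -> ast.

Definition enc (st : ast) : nat :=
  match st with
  | AInit => 0
  | ADead => 1
  | ARst => 2
  | ALin up p e => 3 + cpair (b2n up) (cpair p e)
  end.

Definition dec (q : nat) : ast :=
  match q with
  | 0 => AInit
  | 1 => ADead
  | 2 => ARst
  | S (S (S x)) => ALin (fst (of_nat x) =? 1) (fst (of_nat (snd (of_nat x)))) (snd (of_nat (snd (of_nat x))))
  end.

Lemma dec_enc st : dec (enc st) = st.
Proof.
  destruct st as [| | |up p e]; auto. cbn [enc Nat.add dec]. unfold cpair.
  rewrite !cancel_of_to. cbn [fst snd]. rewrite !cancel_of_to. destruct up; reflexivity.
Qed.

(* The letter [k] is the padding symbol and stands for an exhausted word. *)
Definition dval (k l : nat) : nat := if l =? k then 0 else S l.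

Section Automaton.
Variables (r : nat -> nat -> option op) (k pmax : nat).

(** In [relR u v] the word u is the successor, so the first pair of letters is read as [r b a]. The
    later letters are bijective digits, least significant first: if p times one digit plus the carry
    is [S s], the other digit must be [s mod k + 1], that is the letter [s mod k], with new carry
    [s / k]; if it is zero, the other word must be over. [ARst] lets u continue with letters k - 2
    only. *)
Definition astep (st : ast) (a b : nat) : ast :=
  match st with
  | AInit => match r b a with
             | None => ADead
             | Some (OLin up p e) => ALin up p e
             | Some ORst => ARst
             end
  | ADead => ADead
  | ARst => if a =? k then ARst else if a =? k - 2 then ARst else ADead
  | ALin up p e =>
      let small := if up then b else a in
      let big := if up then a else b in
      match p * dval k small + e with
      | O => if big =? k then ALin up p 0 else ADead
      | S s => if big =? s mod k then ALin up p (s / k) else ADead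
      end
  end.

(** Initial offsets are at most pmax, and carries never exceed [2 * pmax] because k is at least 2
    ([lin_bound]); this range of states is therefore large enough. *)
Definition nstates : nat :=
  3 + list_max (flat_map (fun p => flat_map (fun e => [enc (ALin true p e); enc (ALin false p e)])
       (seq 0 (S (2 * pmax)))) (seq 0 (S pmax))).

(** Sending everything out of range to 1, the dead state, makes the closure of the state set
    immediate. *)
Definition dstep (q a b : nat) : nat :=
  let q' := enc (astep (dec q) a b) in if q' <? nstates then q' else 1.

Definition accept (q : nat) : bool :=
  match dec q with ALin _ _ 0 | ARst => true | _ => false end.

(** All words belong to the universe; a word that is no configuration is related to nothing. *)
Definition aut : AutPres :=
  {| alph := k; NA := 1; qA0 := 0; dA := fun _ _ => 0; fA := fun _ => true;
     NR := nstates; qR0 := 0; dR := dstep; fR := accept |}.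

Lemma enc_lt up p e : p <= pmax -> e <= 2 * pmax -> enc (ALin up p e) < nstates.
Proof.
  intros Hp He. unfold nstates.
  match goal with |- _ < 3 + list_max ?l => assert (H : enc (ALin up p e) <= list_max l);
    [pose proof (proj1 (list_max_le l _) (Nat.le_refl _)) as F | lia] end.
  rewrite Forall_forall in F. apply F.
  apply in_flat_map. exists p. split; [apply in_seq; lia|].
  apply in_flat_map. exists e. split; [apply in_seq; lia|]. destruct up; simpl; auto.
Qed.

Lemma dstep_lt q a b : dstep q a b < nstates.
Proof. unfold dstep. destruct (Nat.ltb_spec (enc (astep (dec q) a b)) nstates); auto. unfold nstates; lia. Qed.

Lemma aut_valid : 1 <= k -> valid aut.
Proof. intros Hk. unfold valid; simpl. repeat split; auto using dstep_lt; unfold nstates; lia. Qed.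

Fixpoint val (w : list nat) : nat := match w with [] => 0 | a :: w => S a + k * val w end.

Definition run (q : nat) (l : list (nat * nat)) : nat := fold_left (fun q p => dstep q (fst p) (snd p)) l q.

Lemma conv_cons u v : u <> [] \/ v <> [] -> conv k u v = (hd k u, hd k v) :: conv k (tl u) (tl v).
Proof.
  intros H. destruct u as [|a u], v as [|b v]; unfold conv, pad; simpl; auto.
  - destruct H; contradiction.
  - rewrite Nat.sub_0_r; auto.
  - rewrite Nat.max_0_r, Nat.sub_0_r; auto.
Qed.

Lemma dec_dstep q a b : dec (dstep q a b) = astep (dec q) a b \/ dec (dstep q a b) = ADead.
Proof. unfold dstep. destruct (_ <? nstates); auto. rewrite dec_enc; auto. Qed.

Lemma run_dead l : forall q, dec q = ADead -> accept (run q l) = false.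
Proof.
  induction l as [|[a b] l IH]; intros q H; simpl.
  - unfold accept; now rewrite H.
  - apply IH. destruct (dec_dstep q a b) as [E|E]; rewrite E; auto. now rewrite H.
Qed.

Lemma run_cons q a b l : accept (run q ((a, b) :: l)) = true ->
  exists q', dec q' = astep (dec q) a b /\ accept (run q' l) = true.
Proof.
  simpl. intros H. destruct (dec_dstep q a b) as [E|E]; eauto.
  rewrite run_dead in H; auto; discriminate.
Qed.

Lemma val_hd u : Forall (fun a => a < k) u -> val u = dval k (hd k u) + k * val (tl u).
Proof.
  intros H; destruct u as [|a u]; simpl.
  - unfold dval. rewrite Nat.eqb_refl; lia.
  - inversion H; subst. unfold dval. destruct (Nat.eqb_spec a k); lia.
Qed.

Lemma Forall_tl (P : nat -> Prop) u : Forall P u -> Forall P (tl u).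
Proof. intros H; destruct H; simpl; auto. Qed.

Hypothesis k_ge2 : 2 <= k.

Lemma length_tl (u : list nat) n : length u <= S n -> length (tl u) <= n.
Proof. destruct u; simpl; lia. Qed.

(** Induction on a common bound for both lengths, as the words are shortened together and either may
    run out first. *)
Lemma run_lin n : forall q up p e u v, dec q = ALin up p e ->
  length u <= n -> length v <= n -> Forall (fun a => a < k) u -> Forall (fun a => a < k) v ->
  accept (run q (conv k u v)) = true ->
  if up then val u = p * val v + e else val v = p * val u + e.
Proof.
  induction n as [|n IH]; intros q up p e u v Hq Lu Lv Fu Fv H.
  - destruct u; [|simpl in Lu; lia]. destruct v; [|simpl in Lv; lia]. simpl in H.
    unfold accept in H. rewrite Hq in H. destruct e; [|discriminate]. simpl. destruct up; lia.
  - destruct (classic (u <> [] \/ v <> [])) as [N|N].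
    + rewrite conv_cons in H by auto. apply run_cons in H as (q' & Hq' & H).
      rewrite Hq in Hq'. cbn [astep] in Hq'.
      assert (G : forall e', dec q' = ALin up p e' ->
        if up then val (tl u) = p * val (tl v) + e' else val (tl v) = p * val (tl u) + e').
      { intros e' He'. apply (IH q'); auto using length_tl, Forall_tl. }
      pose proof (val_hd u Fu) as Vu. pose proof (val_hd v Fv) as Vv.
      destruct (p * dval k (if up then hd k v else hd k u) + e) as [|s] eqn:Es.
      * destruct (Nat.eqb_spec (if up then hd k u else hd k v) k) as [Eb|].
        -- specialize (G 0 Hq'). rewrite Vu, Vv. destruct up; rewrite Eb, G; unfold dval at 1; rewrite Nat.eqb_refl; nia.
        -- rewrite run_dead in H; auto; discriminate.
      * destruct (Nat.eqb_spec (if up then hd k u else hd k v) (s mod k)) as [Eb|].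
        -- specialize (G _ Hq'). assert (Hm : s mod k < k) by (apply Nat.mod_upper_bound; lia).
           assert (Hd : dval k (s mod k) = S (s mod k)).
           { unfold dval. destruct (Nat.eqb_spec (s mod k) k); auto; lia. }
           pose proof (Nat.div_mod_eq s k) as Dm. rewrite Vu, Vv.
           destruct up; rewrite Eb, G, Hd; nia.
        -- rewrite run_dead in H; auto; discriminate.
    + apply not_or_and in N as [N1 N2]. apply NNPP in N1, N2. subst.
      apply (IH q); auto; simpl; lia.
Qed.

Lemma run_rst n : forall q u v, dec q = ARst ->
  length u <= n -> length v <= n -> Forall (fun a => a < k) u ->
  accept (run q (conv k u v)) = true -> exists x, S (val u) = k ^ x.
Proof.
  induction n as [|n IH]; intros q u v Hq Lu Lv Fu H.
  - destruct u; [|simpl in Lu; lia]. exists 0; auto.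
  - destruct u as [|a u]; [exists 0; auto|].
    rewrite conv_cons in H by (left; discriminate). apply run_cons in H as (q' & Hq' & H).
    rewrite Hq in Hq'. cbn [astep hd tl] in *. inversion Fu; subst.
    destruct (Nat.eqb_spec a k); [lia|]. destruct (Nat.eqb_spec a (k - 2)).
    + destruct (IH q' u (tl v)) as [x Hx]; auto using length_tl; [simpl in Lu; lia|].
      exists (S x). simpl. rewrite <- Hx. nia.
    + rewrite run_dead in H; auto; discriminate.
Qed.
Variable b : nat -> nat.
Hypothesis b_0 : b 0 = k.
Hypothesis r_lt : forall s s' o, r s s' = Some o -> s < k /\ s' < k.

(** Well-foundedness uses this inclusion of [relR] in the step relation, over the standard numbers.
    Provability uses the opposite inclusion, in every model of PRA ([Step_relcode]). *)
Lemma relR_step u v : relR aut u v -> exists s' u' s v', u = s' :: u' /\ v = s :: v' /\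
  @Step b natI r s (val v') s' (val u').
Proof.
  intros ((Fu & _) & (Fv & _) & H). simpl in Fu, Fv. change (accept (run 0 (conv k u v)) = true) in H.
  destruct u as [|s' u'].
  - exfalso. destruct v as [|s v'].
    + simpl in H. discriminate.
    + rewrite conv_cons in H by (right; discriminate). apply run_cons in H as (q' & Hq' & H).
      cbn [dec astep hd] in Hq'. destruct (r s k) eqn:E; [apply r_lt in E; lia|].
      rewrite run_dead in H; auto; discriminate.
  - rewrite conv_cons in H by (left; discriminate). apply run_cons in H as (q' & Hq' & H).
    cbn [dec astep hd tl] in *. destruct v as [|s v'].
    + exfalso. cbn [hd] in Hq'. destruct (r k s') eqn:E; [apply r_lt in E; lia|].
      rewrite run_dead in H; auto; discriminate.
    + cbn [hd tl] in *. exists s', u', s, v'. split; auto. split; auto.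
      inversion Fu; inversion Fv; subst.
      destruct (r s s') as [[up p e|]|] eqn:E.
      * exists (OLin up p e). split; auto. unfold oprel.
        pose proof (run_lin (length u' + length v') q' up p e u' v' Hq' ltac:(lia) ltac:(lia)
                      ltac:(assumption) ltac:(assumption) H) as X.
        destruct up; now rewrite add_nat, mul_nat, !num_nat.
      * exists ORst. split; auto.
        destruct (run_rst (length u' + length v') q' u' v' Hq' ltac:(lia) ltac:(lia) ltac:(assumption) H) as [x Hx].
        exists x. rewrite pow_nat. rewrite b_0. exact Hx.
      * rewrite run_dead in H; auto; discriminate.
Qed.

Lemma aut_wf : (forall p, Acc (NStep b r) p) -> wf_pres aut.
Proof.
  intros HA.
  assert (A : forall p s v, p = (s, val v) -> Acc (relR aut) (s :: v)).
  { intros p. induction (HA p) as [p _ IH]. intros s v ->. constructor. intros u Hu.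
    destruct (relR_step _ _ Hu) as (s' & u' & s1 & v1 & -> & E & St). inversion E; subst.
    eapply IH; [|reflexivity]. exact St. }
  assert (A' : forall w, Acc (relR aut) w).
  { intros [|s v]; [|eapply A; reflexivity]. constructor. intros u Hu.
    destruct (relR_step _ _ Hu) as (s' & u' & s1 & v1 & -> & E & St). discriminate. }
  intros S _ [w Hw]. induction (A' w) as [w _ IH].
  destruct (classic (exists u, S u /\ relR aut u w)) as [(u & Hu & Ru)|N].
  - eauto.
  - exists w. split; auto. intros u Hu Ru. apply N; eauto.
Qed.

End Automaton.

(** * Standard values of the transition tables *)

Lemma eval_addP x y : eval addP [x; y] = x + y.
Proof. apply add_nat. Qed.

Lemma eval_mulP x y : eval mulP [x; y] = x * y.
Proof. apply mul_nat. Qed.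

Lemma eval_eqcP x y : eval eqcP [x; y] = if x =? y then 1 else 0.
Proof.
  destruct (Nat.eqb_spec x y) as [H|H].
  - exact (@eqc_eq natI _ x y H).
  - exact (@eqc_neq natI _ x y H).
Qed.

Lemma eval_constP n c xs : length xs = n -> eval (constP n c) xs = c.
Proof. intros L. etransitivity; [exact (@constP_val natI _ n c xs L)|apply num_nat]. Qed.

Lemma eval_sumP n (l : list (PRF n)) xs : eval (sumP l) xs = list_sum (map (fun g => eval g xs) l).
Proof.
  induction l as [|g l IH]; simpl; auto. unfold sumP in IH. rewrite <- IH. apply eval_addP.
Qed.

Lemma list_sum_flat_map {A B} (g : B -> nat) (h : A -> list B) l :
  list_sum (map g (flat_map h l)) = list_sum (map (fun x => list_sum (map g (h x))) l).
Proof. induction l; simpl; auto. rewrite map_app, list_sum_app, IHl; auto. Qed.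

Lemma list_sum_zero {A} (g : A -> nat) l : (forall x, In x l -> g x = 0) -> list_sum (map g l) = 0.
Proof. induction l; simpl; intros H; auto. rewrite H, IHl; auto. Qed.

Lemma list_sum_single (g : nat -> nat) N : forall x0, x0 < N ->
  (forall x, x <> x0 -> g x = 0) -> list_sum (map g (seq 0 N)) = g x0.
Proof.
  induction N as [|N IH]; intros x0 L H; [lia|]. rewrite seq_S, map_app, list_sum_app. simpl.
  destruct (Nat.eq_dec x0 N) as [->|].
  - rewrite list_sum_zero; [lia|]. intros x Hx. apply in_seq in Hx. apply H; lia.
  - rewrite (IH x0) by (auto; lia). rewrite (H N) by auto. lia.
Qed.

Lemma eval_c2 n f (g h : PRF n) xs : eval (c2 f g h) xs = eval f [eval g xs; eval h xs].
Proof. reflexivity. Qed.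

Lemma eval_tab1 N f q : q < N -> eval (tab1 N f) [q] = f q.
Proof.
  intros H. unfold tab1. rewrite eval_sumP, map_map.
  rewrite (list_sum_single _ N q H).
  - rewrite !eval_c2, eval_mulP, eval_eqcP, !eval_constP by auto. simpl. rewrite Nat.eqb_refl. lia.
  - intros x N'. rewrite !eval_c2, eval_mulP, eval_eqcP, !eval_constP by auto. simpl.
    destruct (Nat.eqb_spec q x); auto; congruence.
Qed.

Lemma eval_tab2_0 N A xs : eval (tab2 N A (fun _ _ => 0)) xs = 0.
Proof.
  unfold tab2. rewrite eval_sumP, list_sum_flat_map. apply list_sum_zero. intros q _.
  rewrite map_map. apply list_sum_zero. intros a _. rewrite !eval_c2, eval_mulP. simpl. lia.
Qed.

Lemma eval_tab3 N A f q a c : q < N -> a < A -> c < A -> eval (tab3 N A f) [q; a; c] = f q a c.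
Proof.
  intros Hq Ha Hc. unfold tab3. rewrite eval_sumP, list_sum_flat_map.
  assert (T : forall x y z, eval (c2 mulP (c2 mulP (c2 eqcP (proj 3 0) (constP 3 x))
                       (c2 mulP (c2 eqcP (proj 3 1) (constP 3 y)) (c2 eqcP (proj 3 2) (constP 3 z))))
              (constP 3 (f x y z))) [q; a; c] =
        (if q =? x then 1 else 0) * ((if a =? y then 1 else 0) * (if c =? z then 1 else 0)) * f x y z).
  { intros x y z. rewrite !eval_c2, !eval_mulP, !eval_eqcP, !eval_constP by auto. reflexivity. }
  rewrite (list_sum_single _ N q Hq).
  - rewrite list_sum_flat_map. rewrite (list_sum_single _ A a Ha).
    + rewrite map_map, (list_sum_single _ A c Hc).
      * rewrite T, !Nat.eqb_refl. lia.
      * intros z N'. rewrite T. destruct (Nat.eqb_spec c z); [congruence|lia].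
    + intros y N'. rewrite map_map. apply list_sum_zero. intros z _.
      rewrite T. destruct (Nat.eqb_spec a y); [congruence|lia].
  - intros x N'. rewrite list_sum_flat_map. apply list_sum_zero. intros y _.
    rewrite map_map. apply list_sum_zero. intros z _.
    rewrite T. destruct (Nat.eqb_spec q x); [congruence|lia].
Qed.

(** * The arithmetized automaton *)

Section Accept.
Context {M : Interp} {HM : PRA M}.
Add Ring Mring6 : (@Msrt M HM).
Variable k : nat.
Hypothesis k_ge2 : 2 <= k.
Implicit Types x u v W : M.

Definition dig x : M := fn (digP k) [x].
Definition rest x : M := fn (restP k) [x].
Definition tail (i : M) x : M := fn (tailP k) [i; x].

Lemma dig_val x : dig x = modk k (pre x).
Proof. unfold dig, digP, c1. rewrite pra_C; auto. Qed.

Lemma rest_val x : rest x = divk k (pre x).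
Proof. unfold rest, restP, c1. rewrite pra_C; auto. Qed.

Lemma tail_0 x : tail zero x = x.
Proof. unfold tail, tailP. rewrite pra_R0; auto. rewrite proj_val; auto. Qed.

Lemma tail_S i x : tail (su i) x = rest (tail i x).
Proof.
  unfold tail, tailP. rewrite pra_RS; auto. unfold c1. rewrite pra_C; auto. simpl. rewrite proj_val; auto.
Qed.

Lemma rest_0 : rest zero = zero.
Proof. rewrite rest_val, pre_0, divk_0; auto. Qed.

Definition letter x (l : nat) : Prop :=
  l <= k /\ (x = zero -> l = k) /\ (x <> zero -> l < k /\ dig x = num l).

Lemma dval_lt l : l < k -> dval k l = S l.
Proof. intros H. unfold dval. destruct (Nat.eqb_spec l k); auto; lia. Qed.

Lemma letter_ex x : exists l, letter x l /\ x = add (num (dval k l)) (mul (num k) (rest x)).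
Proof.
  destruct (casex x) as [->|[y ->]].
  - exists k. split; [split; [auto|split; [auto|tauto]]|]. rewrite rest_0. unfold dval. rewrite Nat.eqb_refl. simpl. ring.
  - destruct (div_ex k y) as (j & D & Hj & E); [lia|]. destruct (modk_divk_val k j D Hj) as [E1 E2].
    exists j. split; [split; [lia|split]|].
    + intros H; now apply pra_S1 in H.
    + intros _. split; auto. rewrite dig_val, pre_S, E. auto.
    + rewrite dval_lt, rest_val, pre_S, E, E2 by auto. simpl num. now rewrite add_S_l.
Qed.

Lemma letter_intro l D : l < k -> letter (add (num (S l)) (mul (num k) D)) l /\
  rest (add (num (S l)) (mul (num k) D)) = D.
Proof.
  intros H. destruct (modk_divk_val k l D H) as [E1 E2]. simpl num. rewrite add_S_l.
  split; [split; [lia|split]|].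
  - intros X; now apply pra_S1 in X.
  - intros _. split; auto. rewrite dig_val, pre_S; auto.
  - rewrite rest_val, pre_S; auto.
Qed.

(** Every letter removed lowers a code by at least 1, so a word is exhausted after as many steps as
    its own code says. Hence the [add u v] steps of [acc2P] suffice, even when their number is
    nonstandard. *)
Lemma tail_le i x : tail i x = zero \/ le (add i (tail i x)) x.
Proof.
  revert i. apply (ind (fun i => tail i x = zero \/ le (add i (tail i x)) x)).
  - unfold le, tail. dtac.
  - right. rewrite tail_0, add_0_l. apply le_refl.
  - intros i [H|H]; rewrite tail_S; [left; rewrite H; apply rest_0|].
    destruct (casex (tail i x)) as [E|[y E]]; rewrite E in *; [left; apply rest_0|right].
    rewrite rest_val, pre_S. eapply le_trans; [|exact H]. destruct (modk_divk k y) as [_ Ey]; [lia|].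
    apply le_ex. exists (add (modk k y) (mul (num (k - 1)) (divk k y))). rewrite Ey at 1.
    replace k with (S (k - 1)) at 2 by lia. simpl num. rewrite mul_S_l, (su_add1 i), (su_add1 (add (modk k y) _)). ring.
Qed.

Lemma tail_zero i x : le x i -> tail i x = zero.
Proof.
  intros H. destruct (tail_le i x) as [|H']; auto. apply le_ex in H as [d ->]. apply le_ex in H' as [e E].
  assert (X : add d (add (tail (add x d) x) e) = zero).
  { apply (add_cancel_l x). rewrite add_0_r. rewrite E at 4. ring. }
  apply add_eq_0 in X as [_ X]. apply add_eq_0 in X as [X _]. exact X.
Qed.

Definition code (s : nat) W : M := add (num (S s)) (mul (num k) W).

Lemma code_nz s W : code s W <> zero.
Proof. unfold code. simpl num. rewrite add_S_l. apply pra_S1. Qed.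

Lemma tail_1_code s W : s < k -> tail (su zero) (code s W) = W.
Proof. intros H. rewrite tail_S, tail_0. apply letter_intro; auto. Qed.

Variables (r : nat -> nat -> option op) (pmax : nat) (b : nat -> nat).
Hypothesis b_0 : b 0 = k.
Hypothesis r_lt : forall s s' o, r s s' = Some o -> s < k /\ s' < k.
Hypothesis r_bound : forall s s' up p e, r s s' = Some (OLin up p e) -> 0 < p <= pmax /\ e <= pmax.

Let P := aut r k pmax.

Definition R2 (i u v : M) : M := fn (run2P P) [i; u; v].

Lemma R2_0 u v : R2 zero u v = num 0.
Proof. unfold R2, run2P. rewrite pra_R0, constP_val; auto. Qed.

Lemma tailP4 (i w u v : M) j : j < 4 -> fn (c2 (tailP k) (proj 4 0) (proj 4 j)) [i; w; u; v] = tail i (nth j [i; w; u; v] zero).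
Proof. intros H. unfold c2. rewrite pra_C; auto. simpl fns. rewrite !proj_val by (simpl; lia). reflexivity. Qed.

Lemma letterP4 (t : PRF 4) xs l : length xs = 4 -> letter (fn t xs) l ->
  fn (iteP t (c1 (digP k) t) (constP 4 k)) xs = num l.
Proof.
  intros L (_ & H1 & H2). destruct (iteP_val 4 t (c1 (digP k) t) (constP 4 k) xs L) as [I1 I2].
  destruct (classic (fn t xs = zero)) as [E|E].
  - rewrite I1, H1, constP_val; auto.
  - rewrite I2; auto. unfold c1. rewrite pra_C; auto. apply H2; auto.
Qed.

Lemma R2_stop i u v : tail i u = zero -> tail i v = zero -> R2 (su i) u v = R2 i u v.
Proof.
  intros H1 H2. unfold R2 at 1. unfold run2P. rewrite pra_RS; auto. fold (run2P P).
  match goal with |- fn (iteP ?c ?a ?b) ?xs = _ => destruct (iteP_val 4 c a b xs eq_refl) as [I1 _] end.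
  change (alph P) with k in *. rewrite I1.
  - rewrite proj_val by (simpl; lia). reflexivity.
  - unfold c2 at 1. rewrite pra_C; auto. simpl fns. rewrite !tailP4 by lia. simpl nth. rewrite H1, H2. apply add_0_l.
Qed.

Lemma R2_go i u v q a c : q < nstates pmax -> R2 i u v = num q -> letter (tail i u) a -> letter (tail i v) c ->
  tail i u <> zero \/ tail i v <> zero -> R2 (su i) u v = num (dstep r k pmax q a c).
Proof.
  intros Hq HR Ha Hc N. unfold R2 at 1. unfold run2P. rewrite pra_RS; auto. fold (run2P P).
  match goal with |- fn (iteP ?c ?a ?b) ?xs = _ => destruct (iteP_val 4 c a b xs eq_refl) as [_ I2] end.
  change (alph P) with k in *. rewrite I2.
  - unfold c3. rewrite pra_C; auto. simpl fns. rewrite !letterP4 with (l := a) (xs := [_;_;_;_]) by (auto; rewrite tailP4 by lia; exact Ha).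
    rewrite letterP4 with (l := c) (xs := [_;_;_;_]) by (auto; rewrite tailP4 by lia; exact Hc).
    rewrite proj_val by (simpl; lia). simpl nth. change (fn (run2P P) [i; u; v]) with (R2 i u v). rewrite HR.
    change [num q; num a; num c] with (map (@num M) [q; a; c]). rewrite (proj1 fn_num) by auto. f_equal.
    destruct Ha as [Ha _], Hc as [Hc _]. apply eval_tab3; auto; lia.
  - unfold c2 at 1. rewrite pra_C; auto. simpl fns. rewrite !tailP4 by lia. simpl nth.
    intros E. apply add_eq_0 in E as [E1 E2]. destruct N; auto.
Qed.

Lemma dstep_val st a c : enc (astep r k st a c) < nstates pmax -> dstep r k pmax (enc st) a c = enc (astep r k st a c).
Proof. intros H. unfold dstep. rewrite dec_enc. apply Nat.ltb_lt in H. now rewrite H. Qed.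

Lemma lin_bound p e l : 0 < p <= pmax -> e <= 2 * pmax -> l <= k ->
  (p * dval k l + e - 1) / k <= 2 * pmax.
Proof.
  intros Hp He Hl. assert (Hd : dval k l <= k) by (unfold dval; destruct (Nat.eqb_spec l k); lia).
  apply Nat.lt_succ_r. apply Nat.Div0.div_lt_upper_bound; nia.
Qed.

(** One automaton step in arithmetical terms. For unread parts U and V, possibly nonstandard, either
    both are exhausted with carry zero, or V begins with the one letter that [astep] admits. *)
Lemma lin_step p e U V : 0 < p -> V = add (mul (num p) U) (num e) ->
  (U = zero /\ V = zero /\ e = 0) \/
  exists s lu, p * dval k lu + e = S s /\ letter U lu /\ letter V (s mod k) /\ V <> zero /\
    rest V = add (mul (num p) (rest U)) (num (s / k)).
Proof.
  intros Hp E. destruct (letter_ex U) as (lu & Lu & EU).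
  destruct (p * dval k lu + e) as [|s] eqn:Es.
  - left. assert (dval k lu = 0) by nia. assert (e = 0) by nia. subst e.
    assert (lu = k). { unfold dval in H. destruct (Nat.eqb_spec lu k); auto; lia. }
    assert (U = zero). { apply NNPP; intros N. destruct Lu as (_ & _ & Lu). destruct (Lu N); lia. }
    subst U. split; auto. split; auto. rewrite E. simpl. rewrite mul_0_r. apply add_0_l.
  - right. exists s, lu. split; auto. split; auto.
    assert (Hm : s mod k < k) by (apply Nat.mod_upper_bound; lia).
    assert (EV : V = add (num (S (s mod k))) (mul (num k) (add (mul (num p) (rest U)) (num (s / k))))).
    { transitivity (add (num (S s)) (mul (num k) (mul (num p) (rest U)))).
      - rewrite <- Es, E. rewrite EU at 1. rewrite num_add, num_mul. ring.
      - pose proof (Nat.div_mod_eq s k) as D. rewrite D at 1.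
        replace (S (k * (s / k) + s mod k)) with (S (s mod k) + k * (s / k)) by lia.
        rewrite num_add, num_mul. ring. }
    destruct (letter_intro (s mod k) (add (mul (num p) (rest U)) (num (s / k))) Hm) as [L1 L2].
    rewrite <- EV in L1, L2. split; auto. split; auto.
    rewrite EV. simpl num. rewrite add_S_l. apply pra_S1.
Qed.

Lemma R2_first s W s' W' st : s < k -> s' < k -> astep r k AInit s' s = st -> enc st < nstates pmax ->
  R2 (su zero) (code s' W') (code s W) = num (enc st).
Proof.
  intros Hs Hs' E H. rewrite (R2_go zero _ _ 0 s' s).
  - f_equal. rewrite <- E. apply (dstep_val AInit). rewrite E; auto.
  - unfold nstates; lia.
  - apply R2_0.
  - rewrite tail_0. apply letter_intro; auto.
  - rewrite tail_0. apply letter_intro; auto.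
  - left. rewrite tail_0. apply code_nz.
Qed.

(** The state after each step is again an [ALin] whose carry relates the unread parts. Counting
    begins after the first step, which reads the two machine states. *)
Lemma run_lin_acc u v up p : 0 < p <= pmax ->
  (exists e, In e (seq 0 (S (2 * pmax))) /\ R2 (su zero) u v = num (enc (ALin up p e)) /\
     tail (su zero) (if up then u else v) = add (mul (num p) (tail (su zero) (if up then v else u))) (num e)) ->
  forall i, exists e, In e (seq 0 (S (2 * pmax))) /\ R2 (su i) u v = num (enc (ALin up p e)) /\
     tail (su i) (if up then u else v) = add (mul (num p) (tail (su i) (if up then v else u))) (num e).
Proof.
  intros Hp H0.
  apply (ind (fun i => exists e, In e (seq 0 (S (2 * pmax))) /\ R2 (su i) u v = num (enc (ALin up p e)) /\
     tail (su i) (if up then u else v) = add (mul (num p) (tail (su i) (if up then v else u))) (num e))); auto.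
  (* The carry ranges over a standard finite set, so its quantifier is a finite disjunction and the
     invariant stays quantifier-free. *)
  - apply (DQ_exl QF). intros e. unfold R2, tail. dtac.
  - intros i (e & He & HR & HT). apply in_seq in He.
    destruct (lin_step p e _ _ ltac:(lia) HT) as [(Z1 & Z2 & ->)|(s & lu & Es & L1 & L2 & NZ & E)].
    + exists 0. split; [apply in_seq; lia|].
      assert (tail (su i) u = zero /\ tail (su i) v = zero) as [Zu Zv] by (destruct up; auto).
      rewrite R2_stop by auto. split; auto. rewrite !(tail_S (su i)), Z1, Z2, rest_0. simpl. ring.
    + assert (Hb : s / k <= 2 * pmax).
      { pose proof (lin_bound p e lu Hp ltac:(lia) (proj1 L1)) as X. rewrite Es in X. simpl in X.
        now rewrite Nat.sub_0_r in X. }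
      exists (s / k). split; [apply in_seq; lia|]. rewrite !(tail_S (su i)). split; auto.
      assert (Hst : astep r k (ALin up p e) (if up then s mod k else lu) (if up then lu else s mod k) = ALin up p (s / k)).
      { destruct up; cbn [astep]; rewrite Es, Nat.eqb_refl; auto. }
      rewrite <- Hst, <- dstep_val by (rewrite Hst; apply enc_lt; lia).
      apply R2_go; auto; try (destruct up; auto; fail). apply enc_lt; lia.
Qed.

Lemma pow_sub_step x i : pow k (sub x i) = su zero \/ exists Y, pow k (sub x i) = mul (num k) (su Y) /\ pow k (sub x (su i)) = su Y.
Proof.
  rewrite sub_S_r. destruct (casex (sub x i)) as [->|[y ->]]; [left; apply pow_0|right].
  rewrite pre_S, pow_S. replace k with (S (k - 1)) by lia. destruct (pow_pos (k - 1) y) as [Y ->]. eauto.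
Qed.

(** Since k^(n+1) - 1 = (k - 1) + k (k^n - 1), the word starts with the letter k - 2 and continues
    with the word of k^n - 1. Truncated subtraction keeps the exponent at zero once u is exhausted,
    while v may go on. *)
Lemma run_rst_acc u v x : R2 (su zero) u v = num (enc ARst) -> su (tail (su zero) u) = pow k (sub x zero) ->
  forall i, R2 (su i) u v = num (enc ARst) /\ su (tail (su i) u) = pow k (sub x i).
Proof.
  intros H1 H2. apply (ind (fun i => R2 (su i) u v = num (enc ARst) /\ su (tail (su i) u) = pow k (sub x i))); auto.
  - unfold R2, tail, pow. dtac.
  - intros i [HR HT]. destruct (letter_ex (tail (su i) v)) as (lv & Lv & _).
    assert (G : forall lu, letter (tail (su i) u) lu -> lu = k \/ lu = k - 2 -> R2 (su (su i)) u v = num (enc ARst)).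
    { intros lu Lu Hlu. destruct (classic (tail (su i) u <> zero \/ tail (su i) v <> zero)) as [N|N].
      - assert (Hst : astep r k ARst lu lv = ARst).
        { cbn [astep]. destruct (Nat.eqb_spec lu k); auto. destruct (Nat.eqb_spec lu (k - 2)); auto; lia. }
        rewrite <- Hst, <- dstep_val by (rewrite Hst; unfold nstates; simpl; lia).
        apply R2_go; auto. unfold nstates; simpl; lia.
      - rewrite R2_stop; auto; apply NNPP; tauto. }
    destruct (pow_sub_step x i) as [E|(Y & E & E')].
    + rewrite E in HT. apply pra_S2 in HT. split.
      * apply (G k); auto. split; [auto|split; auto]. rewrite HT; tauto.
      * rewrite tail_S, HT, rest_0. rewrite sub_S_r.
        assert (Z : sub x i = zero).
        { destruct (casex (sub x i)) as [|[y Ey]]; auto. exfalso. rewrite Ey, pow_S in E.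
          replace k with (S (S (k - 2))) in E by lia. destruct (pow_pos (S (k - 2)) y) as [Y EY]. rewrite EY in E.
          simpl num in E. rewrite !mul_S_l, !add_S_r in E. apply pra_S2 in E. rewrite !add_S_l in E. now apply pra_S1 in E. }
        rewrite Z, pre_0, pow_0. auto.
    + rewrite E in HT. rewrite E'.
      assert (ET : tail (su i) u = add (num (S (k - 2))) (mul (num k) Y)).
      { apply pra_S2. rewrite HT, mul_S_r, <- add_S_l. replace k with (S (S (k - 2))) at 2 by lia. simpl num. apply add_comm. }
      destruct (letter_intro (k - 2) Y ltac:(lia)) as [L1 L2]. rewrite <- ET in L1, L2. split.
      * apply (G (k - 2)); auto.
      * now rewrite tail_S, L2.
Qed.

Lemma run1_zero i x : fn (run1P P) [i; x] = zero.
Proof.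
  revert i. apply (ind (fun i => fn (run1P P) [i; x] = zero)).
  - dtac.
  - unfold run1P. rewrite pra_R0, constP_val; auto.
  - intros i IH. unfold run1P. rewrite pra_RS; auto. fold (run1P P).
    match goal with |- fn (iteP ?c ?a ?b) ?xs = _ => destruct (iteP_val 3 c a b xs eq_refl) as [I1 I2] end.
    change (alph P) with k in *.
    assert (ET : forall w, fn (c2 (tailP k) (proj 3 0) (proj 3 2)) [i; w; x] = tail i x).
    { intros w. unfold c2. rewrite pra_C; auto. simpl fns. rewrite !proj_val by (simpl; lia). reflexivity. }
    destruct (classic (tail i x = zero)) as [Z|Z].
    + rewrite I1 by (rewrite ET; auto). rewrite proj_val by (simpl; lia). exact IH.
    + rewrite I2 by (rewrite ET; auto). unfold c2 at 1. rewrite pra_C; auto. simpl fns.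
      rewrite proj_val by (simpl; lia). simpl nth. rewrite IH. unfold c1 at 1. rewrite pra_C; auto.
      simpl fns. rewrite ET. change (fn (digP k) [tail i x]) with (dig (tail i x)).
      destruct (letter_ex (tail i x)) as (l & (_ & _ & L) & _). destruct (L Z) as [_ ->].
      change [zero; num l] with (map (@num M) [0; l]). rewrite (proj1 fn_num) by auto.
      change (@zero M) with (@num M 0). f_equal. apply eval_tab2_0.
Qed.

Lemma acc1_one x : fn (acc1P P) [x] = su zero.
Proof.
  unfold acc1P, c1, c2. rewrite pra_C; auto. simpl fns. rewrite pra_C; auto. simpl fns.
  rewrite !proj_val by (simpl; lia). simpl nth. rewrite run1_zero.
  change [@zero M] with (map (@num M) [0]). rewrite (proj1 fn_num) by auto. reflexivity.
Qed.

Lemma acc2_one u v st : R2 (add u v) u v = num (enc st) -> enc st < nstates pmax -> accept (enc st) = true ->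
  fn (acc2P P) [u; v] = su zero.
Proof.
  intros H1 H2 H3. unfold acc2P, c1, c2, c3. rewrite pra_C; auto. simpl fns. rewrite pra_C; auto. simpl fns.
  rewrite pra_C; auto. simpl fns. rewrite !proj_val by (simpl; lia). simpl nth.
  change (fn addP [u; v]) with (add u v). change (fn (run2P P) [add u v; u; v]) with (R2 (add u v) u v).
  rewrite H1. change [num (enc st)] with (map (@num M) [enc st]). rewrite (proj1 fn_num) by auto.
  simpl NR. rewrite eval_tab1 by auto. simpl fR. rewrite H3. reflexivity.
Qed.

(** A descent of the machine has to become a descent of R, so the arithmetized automaton must accept
    every step that takes place in the model. *)
Theorem Step_relcode s W s' W' : Step b r s W s' W' ->
  fn (relcodeP P) [code s' W'; code s W] = su zero.
Proof.
  intros (o & Ho & Hr). destruct (r_lt _ _ _ Ho) as [Hs Hs'].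
  unfold relcodeP, c1, c2. rewrite !pra_C; auto. simpl fns. rewrite !pra_C; auto. simpl fns.
  rewrite !pra_C; auto. simpl fns. rewrite !proj_val by (simpl; lia). simpl nth.
  rewrite !acc1_one.
  change (mul (mul (su zero) (su zero)) (fn (acc2P P) [code s' W'; code s W]) = su zero).
  enough (E : fn (acc2P P) [code s' W'; code s W] = su zero) by (rewrite E; rewrite !mul_1_l; auto).
  set (u := code s' W'). set (v := code s W).
  (* The invariants concern the times after the first step, hence the number of steps is written as
     a successor. *)
  assert (Ei : exists i, add u v = su i).
  { unfold u, code. simpl num. rewrite !add_S_l. eauto. }
  destruct Ei as [i Ei].
  assert (Zu : tail (su i) u = zero) by (rewrite <- Ei; apply tail_zero, le_ex; eauto).
  assert (Zv : tail (su i) v = zero) by (rewrite <- Ei; apply tail_zero, le_ex; exists u; apply add_comm).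
  destruct o as [up p e|].
  - destruct (r_bound _ _ _ _ _ Ho) as [Hp He].
    assert (He2 : e <= 2 * pmax) by lia.
    destruct (run_lin_acc u v up p Hp) with (i := i) as (e' & He' & HR & HT).
    + exists e. split; [apply in_seq; lia|]. split.
      * apply R2_first; auto; [simpl; now rewrite Ho|apply enc_lt; lia].
      * unfold u, v. simpl in Hr. destruct up; rewrite !tail_1_code by auto; exact Hr.
    (* When both words are exhausted, the linear relation forces the carry to be zero, which is
       accepting. *)
    + assert (E0 : num e' = @zero M).
      { destruct up; rewrite Zu, Zv, mul_0_r, add_0_l in HT; auto. }
      apply (@num_inj M HM e' 0) in E0. subst e'.
      apply (acc2_one u v (ALin up p 0)); [rewrite Ei; auto|apply enc_lt; lia|].
      unfold accept. now rewrite dec_enc.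
  - destruct Hr as [x Hx]. rewrite b_0 in Hx.
    destruct (run_rst_acc u v x) with (i := i) as [HR _].
    + apply R2_first; auto; [simpl; now rewrite Ho|unfold nstates; simpl; lia].
    + unfold u. rewrite tail_1_code, sub_0_r by auto. exact Hx.
    + apply (acc2_one u v ARst); [rewrite Ei; auto|unfold nstates; simpl; lia|reflexivity].
Qed.
End Accept.

(** * From Pi01 sentences to machines *)

Section Bound.
Variables (m : nat) (b md : nat -> nat).

(** The leading 1 covers the coefficient of [oId]. *)
Definition op_bound : nat := 1 + list_sum (map (fun i => b i + md i) (seq 0 m)).

Lemma op_bound_ge i : i < m -> b i + md i <= op_bound.
Proof.
  intros H. unfold op_bound. apply le_S. induction m as [|n IH]; [lia|].
  rewrite seq_S, map_app, list_sum_app. simpl. destruct (Nat.eq_dec i n) as [->|]; [lia|].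
  assert (i < n) by lia. specialize (IH H0). lia.
Qed.
End Bound.

Lemma rl_bound m b md c :
  (forall i, i < m -> 1 < md i) -> (forall i, i < m -> exists g, b i = md i * S g) -> used c <= m ->
  forall e s s' up p q, rl b md c e s s' = Some (OLin up p q) -> 0 < p <= op_bound m b md /\ q <= op_bound m b md.
Proof.
  intros H1 H2.
  assert (B : forall i, i < m -> 1 < b i <= op_bound m b md /\ 1 < md i <= op_bound m b md).
  { intros i Hi. pose proof (op_bound_ge m b md i Hi). destruct (H2 i Hi) as [g Hg]. specialize (H1 i Hi). nia. }
  assert (O : 1 <= op_bound m b md) by (unfold op_bound; lia).
  induction c as [|i|c1 IH1 c2 IH2|i c IH]; intros Hu e s s' up p q H; simpl in *.
  - discriminate.
  - specialize (B i ltac:(lia)). rl_cases. lia.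
  - rl_cases; [apply IH1 in H|apply IH2 in H]; lia.
  - specialize (B i ltac:(lia)). rl_cases; try (apply IH in H; lia); lia.
Qed.

(* All quantifiers are bounded by the single variable [x], which is [Var d] below [d] of them. *)
Fixpoint bq (j d : nat) (a : form) : form :=
  match j with
  | O => a
  | S j => FAll (FImp (Lt (Var 0) (shiftT (Var d))) (bq j (S d) a))
  end.

Lemma bq_Delta0 j a : Delta0 a -> forall d, Delta0 (bq j d a).
Proof. intros H; induction j; intros d; cbn [bq]; auto. apply d0_ball; auto. Qed.

Lemma bq_ffv j a : forall d, ffv (j + d) a -> ffv (S d) (bq j d a).
Proof.
  induction j as [|j IH]; intros d H; cbn [bq].
  - apply (ffv_mono _ d); auto.
  - simpl. split; [repeat split; auto; lia|]. apply IH. now rewrite Nat.add_succ_r.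
Qed.

Lemma bq_msat {M : Interp} x (rho : nat -> M) a j : forall ys,
  msat (lenv ys (scons x rho)) (bq j (length ys) a) <->
  forall zs, length zs = j -> Forall (fun z => le (su z) x) zs -> msat (lenv (zs ++ ys) (scons x rho)) a.
Proof.
  assert (V : forall ys : list M, lenv ys (scons x rho) (length ys) = x) by (induction ys; simpl; auto).
  induction j as [|j IH]; intros ys; cbn [bq].
  - split.
    + intros H [|z zs] L _; [exact H|discriminate].
    + intros H; apply (H []); auto.
  - simpl. rewrite V. split.
    + intros H zs L F. destruct (@exists_last _ zs) as (zs' & z & ->); [intros ->; discriminate|].
      rewrite length_app in L; simpl in L. apply Forall_app in F as [F1 F2]. inversion F2; subst.
      specialize (H z H2). apply (IH (z :: ys)) with (zs := zs') in H; auto; [|lia].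
      rewrite <- app_assoc. exact H.
    + intros H z Hz. apply (IH (z :: ys)). intros zs L F. specialize (H (zs ++ [z])).
      rewrite <- app_assoc in H. apply H.
      * rewrite length_app; simpl; lia.
      * apply Forall_app; auto.
Qed.

Lemma bound_ex {M : Interp} {HM : PRA M} (xs : list M) : exists x, Forall (fun z => le (su z) x) xs.
Proof.
  induction xs as [|y xs [x H]]; [exists zero; auto|].
  exists (su (add y x)). constructor.
  - apply le_ex. exists x. now rewrite add_S_l.
  - eapply Forall_impl; [|exact H]. intros z Hz. eapply le_trans; [exact Hz|].
    apply le_ex. exists (su y). rewrite add_S_r. now rewrite add_comm.
Qed.

(** One bound x for all quantifiers loses nothing, as every finite tuple of elements of a model lies
    below some x ([bound_ex]). Since f is fixed before the model, truth in the standard model and a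
    counterexample in another one concern the same f. *)
Lemma Pi01_PRF n a : Delta0 a -> ffv n a -> exists f : PRF 1, forall (M : Interp) (HM : PRA M) (rho : nat -> M),
  (forall x : M, fn f [x] = zero) <-> msat rho (nAll n a).
Proof.
  intros D F.
  destruct (Delta0_PRF (bq n 0 a)) with (n := 1) as [f Hf].
  - apply bq_Delta0; auto.
  - apply bq_ffv. now rewrite Nat.add_0_r.
  - exists f. intros M HM rho. rewrite msat_nAll.
    assert (E : forall x xs, length xs = n -> (msat (lenv xs (scons x rho)) a <-> msat (lenv xs rho) a)).
    { intros x xs L. apply (msat_ffv a n); auto. intros i Hi. rewrite !(nth_lenv xs _ i x) by lia. auto. }
    split.
    + intros H xs L. destruct (bound_ex xs) as [x Hx]. specialize (H x).
      apply (Hf M HM rho [x]) in H; auto. apply (bq_msat x rho a n []) with (zs := xs) in H; auto.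
      rewrite app_nil_r in H. apply (E x); auto.
    + intros H x. apply (Hf M HM rho [x]); auto. apply (bq_msat x rho a n []). intros zs L _.
      rewrite app_nil_r. apply E; auto.
Qed.

Theorem mainTheorem4 :
  forall pi : form, Pi01 pi -> sat (fun _ => 0) pi ->
  exists P : AutPres, valid P /\ wf_pres P /\ Provable (PRA_TI P) pi.
Proof.
  intros pi (n & th & -> & D & F) Hpi.
  destruct (Pi01_PRF n th D F) as [f Hf].
  set (c := comp f [0] 1 2). set (m := max 2 (used c)).
  assert (Hu : used c <= m) by (unfold m; lia). assert (H2 : 2 <= m) by (unfold m; lia).
  (* The machine has [size c + 2] states, each of which must be a letter below k = [b 0]. *)
  destruct (crt_exists m (size c + 2)) as (b & md & md_gt & b_self & b_other & b_ge).
  set (r := mach b md c). set (k := b 0). set (pmax := op_bound m b md).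
  assert (Hk : 2 <= k) by (unfold k; specialize (b_ge 0); lia).
  assert (r_lt : forall s s' o, r s s' = Some o -> s < k /\ s' < k).
  { intros s s' o H. apply mach_range in H. unfold k; specialize (b_ge 0); lia. }
  assert (r_bd : forall s s' up p e, r s s' = Some (OLin up p e) -> 0 < p <= pmax /\ e <= pmax).
  { intros s s' up p e. unfold r, mach. destruct (s <? size c).
    - apply (rl_bound m b md c md_gt b_self Hu).
    - destruct (s =? size c).
      + destruct (s' =? size c + 1); [|discriminate]. intros H; inversion H; subst.
        assert (L1 : 1 < m) by lia. pose proof (op_bound_ge m b md 1 L1). pose proof (md_gt 1 L1).
        destruct (b_self 1 L1) as [g Hg]. unfold pmax. nia.
      + destruct (s =? size c + 1); [|discriminate]. destruct (s' =? 0); discriminate. }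
  (* Here the truth of the sentence enters, for the sake of well-foundedness. *)
  assert (Hf0 : forall x, eval f [x] = 0).
  { apply sat_msat in Hpi. exact (proj2 (Hf natI PRA_nat _) Hpi). }
  exists (aut r k pmax). split; [apply aut_valid; lia|split].
  - apply (aut_wf r k pmax Hk b eq_refl r_lt). apply (mach_wf m b md md_gt b_self b_other f Hu H2 Hf0).
  - apply completeness. intros M rho HT.
    assert (HM : PRA M) by (apply (PRA_of_axioms rho); intros a Ha; apply HT; left; auto).
    assert (TI : TIsem M (fun y x => fn (relcodeP (aut r k pmax)) [y; x] = su zero)).
    { apply (TIsem_of_axioms rho (Rform (aut r k pmax))); [reflexivity|]. intros a Ha; apply HT; right; auto. }
    apply (Hf M HM). intros x. apply NNPP; intros Hx.
    destruct (mach_loop m b md md_gt b_self b_other f Hu H2 x Hx) as (B & DB & (s0 & W0 & HB0) & HB).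
    (* The codes of the configurations in B. The state ranges over finitely many standard values,
       which gives a disjunction, and W is recovered from z by the term [rest]. *)
    set (Bz := fun z : M => exists s, In s (seq 0 (size c + 2)) /\ (z = code k s (rest k z) /\ B s (rest k z))).
    assert (Bz_code : forall s W, B s W -> Bz (code k s W)).
    { intros s W H. destruct (HB s W H) as (s' & W' & (o & Ho & _) & _).
      assert (Hs : s < k) by (apply (r_lt _ _ _ Ho)). apply mach_range in Ho. fold c in Ho.
      exists s. split; [apply in_seq; lia|].
      assert (E : rest k (code k s W) = W) by (apply (letter_intro k Hk s W Hs)). rewrite E; auto. }
    apply (TI_descent _ TI Bz) with (z := code k s0 W0); auto.
    + apply (DQ_exl Delta0). intros s. apply DQ_and; [apply _| |].
      * unfold code. dtac.
      * apply (DQ_comp1 Delta0 E1 (fun z => rest k z) (B s) (DB s)). apply DT_fn1; dtac.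
    + intros z (s & _ & Ez & H). destruct (HB s _ H) as (s' & W' & St & HB').
      exists (code k s' W'). split; [|auto].
      rewrite Ez. apply (Step_relcode k Hk r pmax b eq_refl r_lt r_bd). exact St.
Qed.
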